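(* Let $V$ be a Hausdorff nuclear space, $\overline{\,\cdot\,}$ a continuous antilinear involution of $V$, and $\Lambda$ a continuous Hermitian bilinear form on $V$. Then there exist point-separating many continuous positive linear functionals of $\big(\mathcal{S}^\bullet(V),\star_\Lambda,{}^*\big)$, i.e. the common kernel of all continuous positive linear functionals on this $^*$-algebra is $\{0\}$.
   Context: $V$ is complex. Let $\mathcal{I}_V$ be the set of continuous positive Hermitian forms $\langle\cdot\,|\,\cdot\rangle_\alpha$ on $V$ (sesquilinear, antilinear in the first argument, Hermitian, positive semi-definite), $\|v\|_\alpha:=\sqrt{\langle v|v\rangle_\alpha}$, and $\mathcal{P}_V$ the set of all these seminorms (for a nuclear space $\mathcal{P}_V$ is cofinal in the set of all continuous seminorms). Let $\mathcal{T}^k_{\mathrm{alg}}(V)$ be the algebraic $k$-th tensor power ($\mathcal{T}^0_{\mathrm{alg}}(V)=\mathbb{C}$), $\mathcal{T}^\bullet_{\mathrm{alg}}(V)=\bigoplus_{k\ge 0}\mathcal{T}^k_{\mathrm{alg}}(V)$, and $\langle X\rangle_k$ the degree-$k$ component of $X$. Each $\langle\cdot|\cdot\rangle_\alpha\in\mathcal{I}_V$ is extended to a positive Hermitian form $\langle X|Y\rangle_\alpha^\bullet:=\sum_{k}\langle\langle X\rangle_k|\langle Y\rangle_k\rangle_\alpha^\bullet$ on $\mathcal{T}^\bullet_{\mathrm{alg}}(V)$, where $\langle x_1\otimes\cdots\otimes x_k|y_1\otimes\cdots\otimes y_k\rangle_\alpha^\bullet:=k!\prod_{m=1}^k\langle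 x_m|y_m\rangle_\alpha$; set $\|X\|_\alpha^\bullet:=\sqrt{\langle X|X\rangle_\alpha^\bullet}$. $\mathcal{T}^\bullet(V)$ is $\mathcal{T}^\bullet_{\mathrm{alg}}(V)$ with the locally convex topology defined by all seminorms $\|\cdot\|_\alpha^\bullet$, $\|\cdot\|_\alpha\in\mathcal{P}_V$. Let $\mathrm{Sym}^\bullet$ be the symmetrisation operator, $\mathrm{Sym}^\bullet(x_1\otimes\cdots\otimes x_k)=\frac1{k!}\sum_{\sigma\in\mathfrak{S}_k}x_{\sigma(1)}\otimes\cdots\otimes x_{\sigma(k)}$, and let $\mathcal{S}^\bullet(V)$ be its image (the symmetric tensors) with the subspace topology. For a continuous bilinear form $\Lambda$ on $V$, let $P_\Lambda$ be the linear endomorphism of $\mathcal{T}^\bullet(V)\otimes\mathcal{T}^\bullet(V)$ (outer tensor product) with $P_\Lambda\big((x_1\otimes\cdots\otimes x_k)\otimes(y_1\otimes\cdots\otimes y_\ell)\big)=k\ell\,\Lambda(x_k,y_1)\,(x_1\otimes\cdots\otimes x_{k-1})\otimes(y_2\otimes\cdots\otimes y_\ell)$ for $k,\ell\ge1$, and zero if $k=0$ or $\ell=0$ (the tensor sign between the two brackets is the outer one). With $\mu_\vee(X\otimes Y):=\mathrm{Sym}^\bullet(X\otimes Y)$ (product in the tensor algebra on the right), $X\star_\Lambda Y:=\sum_{t=0}^\infty\frac1{t!}\mu_\vee\big((P_\Lambda)^t(X\otimes Y)\big)$ for $X,Y\in\mathcal{S}^\bullet(V)$. The $^*$-involution is the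 antilinear map with $(x_1\otimes\cdots\otimes x_k)^*:=\overline{x_k}\otimes\cdots\otimes\overline{x_1}$ (complex conjugation on scalars), restricted to symmetric tensors. A bilinear form $\Lambda$ is Hermitian if $\Lambda(v,w)=\overline{\Lambda(\overline{w},\overline{v})}$ for all $v,w\in V$. A linear functional $\omega:\mathcal{S}^\bullet(V)\to\mathbb{C}$ is positive for $\star_\Lambda$ if $\omega(X^*\star_\Lambda X)\ge0$ for all $X\in\mathcal{S}^\bullet(V)$. *)

(* Defs.v *)
From HB Require Import structures.
From mathcomp Require Import all_boot all_order all_algebra perm.
From mathcomp Require Import all_classical all_reals all_analysis.
From mathcomp Require Import complex ring_quotient finmap.
From mathcomp.multinomials Require monalg.
(* the notations of monalg clash with those of mathcomp-analysis *)
Import -(notations) monalg.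

Set Implicit Arguments.
Unset Strict Implicit.
Unset Printing Implicit Defensive.

Import Order.TTheory GRing.Theory Num.Theory.
Import numFieldNormedType.Exports.

Local Open Scope classical_set_scope.
Local Open Scope ring_scope.

Section ModSpan.
Context {K : nzRingType} {M : lmodType K}.

Inductive span_of (S : set M) : M -> Prop :=
| span_of0 : span_of S 0
| span_of_comb a x y : S x -> span_of S y -> span_of S (a *: x + y).

Definition span_pred (S : set M) : {pred M} := fun x => `[< span_of S x >].

Fact span_of_lin (S : set M) a x y :
  span_of S x -> span_of S y -> span_of S (a *: x + y).
Proof.
move=> + Sy; elim=> [|b z t Sz _ IH]; first by rewrite scaler0 add0r.
by rewrite scalerDr scalerA -addrA; exact: span_of_comb.
Qed.

Fact span_pred_submod (S : set M) : submod_closed (span_pred S).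
Proof.
split; first by apply/asboolP; exact: span_of0.
by move=> a x y /asboolP Sx /asboolP Sy; apply/asboolP; exact: span_of_lin.
Qed.

HB.instance Definition _ (S : set M) :=
  GRing.isSubmodClosed.Build K M (span_pred S) (span_pred_submod S).

Definition mod_span (S : set M) := Quotient.quot (span_pred S).

End ModSpan.

Section ModSpanLmod.
Context {K : nzRingType} {M : lmodType K} (S : set M).
Local Notation Q := (mod_span S).

HB.instance Definition _ := Choice.on Q.
HB.instance Definition _ := EqQuotient.on Q.
HB.instance Definition _ := GRing.Zmodule.on Q.

Fact mod_span_scale_key : unit. Proof. by []. Qed.
Definition mod_span_scale : K -> Q -> Q :=
  locked_with mod_span_scale_key (fun a x => \pi_Q%qT (a *: repr x)).
Canonical mod_span_scale_unlockable := [unlockable fun mod_span_scale].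

Fact pi_mod_span_eq (x y : M) :
  (\pi_Q%qT x == \pi_Q%qT y :> Q) = (x - y \in span_pred S).
Proof. by rewrite -Quotient.idealrBE. Qed.

Fact pi_mod_spanD x y : \pi_Q%qT (x + y) = \pi_Q%qT x + \pi_Q%qT y :> Q.
Proof. exact: (@pi_addr _ _ _ _ _ (Quotient.quot (span_pred S))). Qed.

Fact pi_mod_spanZ a x : \pi_Q%qT (a *: x) = mod_span_scale a (\pi_Q%qT x).
Proof.
apply/eqP; rewrite [mod_span_scale]unlock pi_mod_span_eq -scalerBr rpredZ//.
by rewrite -pi_mod_span_eq reprK.
Qed.

Fact mod_span_scaleA a b x :
  mod_span_scale a (mod_span_scale b x) = mod_span_scale (a * b) x.
Proof. by rewrite -[x]reprK -(pi_mod_spanZ b) -!pi_mod_spanZ scalerA. Qed.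

Fact mod_span_scale1 : left_id 1 mod_span_scale.
Proof. by move=> x; rewrite -[x in LHS]reprK -pi_mod_spanZ scale1r reprK. Qed.

Fact mod_span_scaleDr : right_distributive mod_span_scale +%R.
Proof.
move=> a x y; rewrite -[x]reprK -[y]reprK -pi_mod_spanD -!pi_mod_spanZ.
by rewrite -pi_mod_spanD scalerDr.
Qed.

Fact mod_span_scaleDl x : {morph mod_span_scale^~ x : a b / a + b}.
Proof.
by move=> a b; rewrite -[x]reprK -!pi_mod_spanZ -pi_mod_spanD scalerDl.
Qed.

HB.instance Definition _ := GRing.Zmodule_isLmodule.Build K Q
  mod_span_scaleA mod_span_scale1 mod_span_scaleDr mod_span_scaleDl.

Fact pi_mod_span_linear a x y :
  \pi_Q%qT (a *: x + y) = a *: \pi_Q%qT x + \pi_Q%qT y :> Q.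
Proof. by rewrite pi_mod_spanD pi_mod_spanZ. Qed.

End ModSpanLmod.

Section Presented.
Context {K : nzRingType} {I : choiceType} (S : set (malg I K)).
Local Notation Q := (mod_span S).

Fact gen_key : unit. Proof. by []. Qed.
Definition gen : I -> Q :=
  locked_with gen_key (fun i => \pi_Q%qT (mkmalgU i 1)).
Canonical gen_unlockable := [unlockable fun gen].

(* [slift s f] is the [s]-semilinear map sending [gen i] to [f i]; it is
   well defined as soon as [f] respects the relations, see [sliftE] *)
Definition free_slift {W : lmodType K} (s : K -> K) (f : I -> W)
  (g : malg I K) : W := \sum_(i <- msupp g) s (mcoeff i g) *: f i.

Fact slift_key : unit. Proof. by []. Qed.
Definition slift {W : lmodType K} : (K -> K) -> (I -> W) -> Q -> W :=
  locked_with slift_key (fun s f x => free_slift s f (repr x)).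
Canonical slift_unlockable W := [unlockable fun @slift W].

Lemma genE i : gen i = \pi_Q%qT (mkmalgU i 1).
Proof. by rewrite [gen]unlock. Qed.

Lemma slift_def {W : lmodType K} s (f : I -> W) x :
  slift s f x = free_slift s f (repr x).
Proof. by rewrite [@slift _]unlock. Qed.

Section theory.
Context {W : lmodType K} (s : {rmorphism K -> K}) (f : I -> W).

Lemma free_sliftw (d : {fset I}) (g : malg I K) : (msupp g `<=` d)%fset ->
  free_slift s f g = \sum_(i <- d) s (mcoeff i g) *: f i.
Proof.
move=> gd; rewrite /free_slift; apply: big_fset_incl => // i _.
by move=> /mcoeff_outdom ->; rewrite rmorph0 scale0r.
Qed.

Lemma free_slift_lin a x y :
  free_slift s f (a *: x + y) = s a *: free_slift s f x + free_slift s f y.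
Proof.
rewrite (@free_sliftw (msupp x `|` msupp y)%fset) //; last first.
  apply: fsubset_trans (msuppD_le _ _) _.
  by apply: fsetSU; exact: msuppZ_le.
rewrite (@free_sliftw (msupp x `|` msupp y)%fset) ?fsubsetUl//.
rewrite (@free_sliftw (msupp x `|` msupp y)%fset y) ?fsubsetUr//.
rewrite scaler_sumr -big_split/=; apply: eq_bigr => i _.
by rewrite mcoeffD mcoeffZ rmorphD rmorphM scalerDl scalerA.
Qed.

Lemma free_slift0 : free_slift s f 0 = 0.
Proof. by rewrite /free_slift msupp0 big_seq_fset0. Qed.

Lemma free_sliftU i : free_slift s f (mkmalgU i 1) = f i.
Proof.
by rewrite (free_sliftw msuppU_le) big_seq_fset1 mcoeffUU rmorph1 scale1r.
Qed.

Hypothesis fS : forall z, S z -> free_slift s f z = 0.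

Lemma slift_pi z : slift s f (\pi_Q%qT z) = free_slift s f z.
Proof.
rewrite slift_def; have : span_of S (repr (\pi_Q%qT z : Q) - z).
  by apply/asboolP; rewrite -[asbool _]/(_ \in span_pred S)
    -pi_mod_span_eq reprK.
move: (repr _) => t H; rewrite -[t](subrK z); move: (t - z) H => u.
rewrite -[u in free_slift _ _ (u + _)]scale1r.
rewrite free_slift_lin => H.
suff -> : free_slift s f u = 0 by rewrite scaler0 add0r.
elim: H => [|a x y Sx _ IH]; first exact: free_slift0.
by rewrite free_slift_lin (fS Sx) IH scaler0 addr0.
Qed.

Lemma sliftE i : slift s f (gen i) = f i.
Proof. by rewrite genE slift_pi free_sliftU. Qed.

Lemma slift_lin a x y :
  slift s f (a *: x + y) = s a *: slift s f x + slift s f y.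
Proof.
rewrite -[x]reprK -[y]reprK -pi_mod_span_linear !slift_pi.
exact: free_slift_lin.
Qed.

End theory.

Lemma gen_ind (P : Q -> Prop) :
  P 0 -> (forall a i x, P x -> P (a *: gen i + x)) -> forall x, P x.
Proof.
move=> P0 PD x; rewrite -[x]reprK [repr x]monalgE.
elim: (enum_fset _) => [|i r IH].
  by rewrite big_nil -[0](scale0r 0) -[_ *: 0]addr0 pi_mod_span_linear scale0r
    add0r -[0 : malg I K](subrr 0) -scaleN1r addrC pi_mod_span_linear
    scaleN1r addNr.
rewrite big_cons; set z := mkmalgU _ _.
have -> : z = mcoeff i (repr x) *: mkmalgU i 1.
  apply/malgP => k; rewrite mcoeffZ !mcoeffU.
  by case: eqP; rewrite ?mulr1n ?mulr1 ?mulr0n ?mulr0.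
by rewrite pi_mod_span_linear -genE; exact: PD.
Qed.

End Presented.

Section TensorProduct.
Context {K : comNzRingType}.

Definition bilinear_relations (U W : lmodType K) : set (malg (U * W)%type K) :=
  [set z | (exists a u u' w, z = mkmalgU (a *: u + u', w) 1
              - (a *: mkmalgU (u, w) 1 + mkmalgU (u', w) 1)) \/
           (exists a u w w', z = mkmalgU (u, a *: w + w') 1
              - (a *: mkmalgU (u, w) 1 + mkmalgU (u, w') 1))].

Arguments bilinear_relations : clear implicits.

Definition tensor (U W : lmodType K) := mod_span (bilinear_relations U W).
HB.instance Definition _ U W := GRing.Lmodule.on (tensor U W).

Context {U W X : lmodType K}.

Definition tens (u : U) (w : W) : tensor U W := gen _ (u, w).

Lemma tens_linl a u u' w :
  tens (a *: u + u') w = a *: tens u w + tens u' w.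
Proof.
rewrite /tens !genE -pi_mod_span_linear; apply/eqP.
rewrite pi_mod_span_eq; apply/asboolP.
rewrite -[_ - _]scale1r -[_ *: _]addr0; apply: span_of_comb;
  last exact: span_of0.
by left; exists a, u, u', w.
Qed.

Lemma tens_linr u a w w' :
  tens u (a *: w + w') = a *: tens u w + tens u w'.
Proof.
rewrite /tens !genE -pi_mod_span_linear; apply/eqP.
rewrite pi_mod_span_eq; apply/asboolP.
rewrite -[_ - _]scale1r -[_ *: _]addr0; apply: span_of_comb;
  last exact: span_of0.
by right; exists a, u, w, w'.
Qed.

Lemma tensor_ind (P : tensor U W -> Prop) :
  P 0 -> (forall a u w x, P x -> P (a *: tens u w + x)) -> forall x, P x.
Proof. by move=> P0 PD; apply: gen_ind => // a [u w]; exact: PD. Qed.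

Definition tensor_lift (f : U -> W -> X) : tensor U W -> X :=
  slift idfun (fun p => f p.1 p.2).

Section theory.
Variable f : U -> W -> X.
Hypothesis f_linl : forall w, linear (f^~ w).
Hypothesis f_linr : forall u, linear (f u).

Let f_rel z : bilinear_relations U W z ->
  free_slift idfun (fun p => f p.1 p.2) z = 0.
Proof.
move=> [] [a] [u] [v] [w] ->;
  rewrite -[- _]scaleN1r addrC free_slift_lin free_slift_lin !free_sliftU/=.
- by rewrite f_linl scaleN1r addNr.
- by rewrite f_linr scaleN1r addNr.
Qed.

Lemma tensor_liftE u w : tensor_lift f (tens u w) = f u w.
Proof. exact: sliftE. Qed.

Lemma tensor_lift_linear : linear (tensor_lift f).
Proof. by move=> a x y; exact: (slift_lin f_rel). Qed.
End theory.

End TensorProduct.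

(* The tensor algebra is the free vector space on finite sequences of vectors,
   modulo multilinearity; [word [:: x1; ..; xk]] is the elementary tensor
   x1 (x) .. (x) xk, and the words of size k span the k-th tensor power. *)

Section TensorAlgebra.
Context {K : comNzRingType}.

Definition multilinear_relations (V : lmodType K) : set (malg (seq V) K) :=
  [set z | exists a (u u' : seq V) x y,
    z = mkmalgU (u ++ (a *: x + y) :: u') 1
      - (a *: mkmalgU (u ++ x :: u') 1 + mkmalgU (u ++ y :: u') 1)].

Arguments multilinear_relations : clear implicits.

Definition talg (V : lmodType K) := mod_span (multilinear_relations V).
HB.instance Definition _ V := GRing.Lmodule.on (talg V).

Context {V : lmodType K}.

Definition word (u : seq V) : talg V := gen _ u.

Definition semimultilinear {W : lmodType K} (s : K -> K) (f : seq V -> W) :=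
  forall a (u u' : seq V) x y,
    f (u ++ (a *: x + y) :: u') = s a *: f (u ++ x :: u') + f (u ++ y :: u').

(* [s]-semilinear extension of a map defined on elementary tensors *)
Definition talg_slift {W : lmodType K} (s : K -> K) (f : seq V -> W) :
  talg V -> W := slift s f.

Definition talg_lift {W : lmodType K} (f : seq V -> W) : talg V -> W :=
  talg_slift idfun f.

Section theory.
Context {W : lmodType K} {s : {rmorphism K -> K}} {f : seq V -> W}.
Hypothesis f_lin : semimultilinear s f.

Let f_rel z : multilinear_relations V z -> free_slift s f z = 0.
Proof.
move=> [a] [u] [u'] [x] [y] ->.
rewrite -[- _]scaleN1r addrC free_slift_lin free_slift_lin !free_sliftU/=.
by rewrite f_lin rmorphN1 scaleN1r addNr.
Qed.

Lemma talg_sliftE u : talg_slift s f (word u) = f u.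
Proof. exact: sliftE. Qed.

Lemma talg_slift_lin a x y : talg_slift s f (a *: x + y) =
  s a *: talg_slift s f x + talg_slift s f y.
Proof. exact: (slift_lin f_rel). Qed.
End theory.

Lemma talg_liftE {W : lmodType K} (f : seq V -> W) u :
  semimultilinear idfun f -> talg_lift f (word u) = f u.
Proof. by move=> fl; exact: (talg_sliftE (s := idfun) fl). Qed.

Lemma talg_lift_linear {W : lmodType K} (f : seq V -> W) :
  semimultilinear idfun f -> linear (talg_lift f).
Proof. by move=> fl a x y; exact: (talg_slift_lin (s := idfun) fl). Qed.

Lemma talg_ind (P : talg V -> Prop) :
  P 0 -> (forall a u x, P x -> P (a *: word u + x)) -> forall x, P x.
Proof. exact: gen_ind. Qed.

Lemma word_multilinear : semimultilinear idfun word.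
Proof.
move=> a u u' x y; rewrite /word !genE -pi_mod_span_linear; apply/eqP.
rewrite pi_mod_span_eq; apply/asboolP.
rewrite -[_ - _]scale1r -[_ *: _]addr0; apply: span_of_comb;
  last exact: span_of0.
by exists a, u, u', x, y.
Qed.

Lemma semimultilinear_nth {W : lmodType K} (s : K -> K) (f : seq V -> W)
    a (v v1 v2 : seq V) j : semimultilinear s f ->
  size v1 = size v -> size v2 = size v -> (j < size v)%N ->
  v`_j = a *: v1`_j + v2`_j ->
  (forall k, k != j -> v1`_k = v`_k /\ v2`_k = v`_k) ->
  f v = s a *: f v1 + f v2.
Proof.
move=> fl s1 s2 jv vj vk.
have E (w : seq V) : size w = size v -> (forall k, k != j -> w`_k = v`_k) ->
    w = take j v ++ w`_j :: drop j.+1 v.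
  move=> sw wk; rewrite -{1}(cat_take_drop j w) (drop_nth 0) ?sw//.
  congr (_ ++ _ :: _).
    apply: (@eq_from_nth _ 0); first by rewrite !size_take sw.
    move=> i; rewrite size_take sw jv => ij.
    by rewrite !nth_take// wk// ltn_eqF.
  apply: (@eq_from_nth _ 0); first by rewrite !size_drop sw.
  by move=> i _; rewrite !nth_drop wk// gtn_eqF// addSn ltnS leq_addr.
rewrite (E v)// vj fl -E//; last by move=> k /vk[].
by rewrite -E// => k /vk[].
Qed.

(* extension of a map defined on pairs of elementary tensors, [s]-semilinear in
   the first argument and linear in the second *)
Definition talg_slift2 {W : lmodType K} (s : K -> K) (B : seq V -> seq V -> W)
    (X Y : talg V) : W :=
  talg_slift s (fun u => talg_lift (B u) Y) X.

Section theory2.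
Context {W : lmodType K} {s : {rmorphism K -> K}} {B : seq V -> seq V -> W}.
Hypothesis B_linl : forall w, semimultilinear s (B^~ w).
Hypothesis B_linr : forall u, semimultilinear idfun (B u).

Let B_semil Y : semimultilinear s (fun u => talg_lift (B u) Y).
Proof.
move=> a u u' x y /=; elim/talg_ind: Y => [|b w Y IH].
  have l0 v : talg_lift (B v) 0 = 0.
    have := talg_lift_linear (B_linr v) (-1) 0 0.
    by rewrite !scaleN1r addNr => ->; rewrite addNr.
  by rewrite !l0 scaler0 addr0.
rewrite !(talg_lift_linear (B_linr _)) IH !(talg_liftE _ (B_linr _)) B_linl.
by rewrite !scalerDr !scalerA [b * _]mulrC addrACA.
Qed.

Lemma talg_slift2E u w : talg_slift2 s B (word u) (word w) = B u w.
Proof.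
by rewrite /talg_slift2 (talg_sliftE (@B_semil _)) (talg_liftE _ (B_linr _)).
Qed.

Lemma talg_slift2_linl Y a x y : talg_slift2 s B (a *: x + y) Y =
  s a *: talg_slift2 s B x Y + talg_slift2 s B y Y.
Proof. exact: (talg_slift_lin (@B_semil Y)). Qed.

Lemma talg_slift2_linr X : linear (talg_slift2 s B X).
Proof.
move=> a x y; elim/talg_ind: X => [|b u X IH].
  have l0 Y : talg_slift2 s B 0 Y = 0.
    have := talg_slift2_linl Y (-1) 0 0.
    by rewrite rmorphN1 !scaleN1r addNr => ->; rewrite addNr.
  by rewrite !l0 scaler0 addr0.
rewrite !talg_slift2_linl IH /talg_slift2 !(talg_sliftE (@B_semil _)).
rewrite (talg_lift_linear (B_linr _)).
by rewrite !scalerDr !scalerA [_ * a]mulrC addrACA.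
Qed.
End theory2.

Definition talg_mul : talg V -> talg V -> talg V :=
  talg_slift2 idfun (fun u w => word (u ++ w)).

Lemma word_cat_linl w : semimultilinear idfun (fun u => word (u ++ w)).
Proof. by move=> a u u' x y; rewrite -!catA; exact: word_multilinear. Qed.

Lemma word_cat_linr u : semimultilinear idfun (fun w => word (u ++ w)).
Proof. by move=> a w w' x y; rewrite !catA; exact: word_multilinear. Qed.

End TensorAlgebra.

Section StarProduct.
Context {C : numClosedFieldType} {V : lmodType C}.
Implicit Types (X Y : talg V) (u w : seq V).

Definition perm_word n (s : 'S_n) u : seq V := [seq u`_(s i) | i <- enum 'I_n].

Definition Sym_word u : talg V :=
  (size u)`!%:R^-1 *: \sum_(s : 'S_(size u)) word (perm_word s u).

Definition Sym : talg V -> talg V := talg_lift Sym_word.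

Lemma nth_perm_word n (s : 'S_n) u (i : 'I_n) : (perm_word s u)`_i = u`_(s i).
Proof. by rewrite (nth_map i) ?size_enum_ord// nth_ord_enum. Qed.

Lemma size_perm_word n (s : 'S_n) u : size (perm_word s u) = n.
Proof. by rewrite size_map size_enum_ord. Qed.

Lemma Sym_word_multilinear : semimultilinear idfun Sym_word.
Proof.
move=> a u u' x y.
have E z : Sym_word (u ++ z :: u') = (size (u ++ x :: u'))`!%:R^-1 *:
    \sum_(s : 'S_(size (u ++ x :: u'))) word (perm_word s (u ++ z :: u')).
  rewrite /Sym_word (_ : size (u ++ z :: u') = size (u ++ x :: u'))//.
  by rewrite !size_cat.
rewrite !E/= [a *: (_ *: _)]scalerA mulrC -scalerA -scalerDr; congr (_ *: _).
rewrite scaler_sumr -big_split/=; apply: eq_bigr => s _.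
have uS : (size u < size (u ++ x :: u'))%N.
  by rewrite size_cat -addn1 leq_add2l.
pose j := (s^-1)%g (Ordinal uS).
apply: (@semimultilinear_nth _ _ _ idfun _ _ _ _ _ j word_multilinear);
  rewrite ?size_perm_word//.
  by rewrite !nth_perm_word permKV/= !nth_cat ltnn subnn.
move=> k kj; have [kn|kn] := ltnP k (size (u ++ x :: u')); last first.
  by split; rewrite !nth_default// size_perm_word.
rewrite -[k]/(val (Ordinal kn)) !nth_perm_word !nth_cat.
have : s (Ordinal kn) != Ordinal uS.
  by apply: contra kj => /eqP kE; rewrite /j -kE permK.
rewrite -val_eqE/=; case: ltngtP => // us _.
by rewrite -[(_ - _)%N]prednK ?subn_gt0.
Qed.

Lemma Sym_linear : linear Sym.
Proof. exact: talg_lift_linear Sym_word_multilinear. Qed.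

Lemma SymE u : Sym (word u) = Sym_word u.
Proof. exact: talg_liftE Sym_word_multilinear. Qed.

Local Notation TT :=
  (tensor [the lmodType C of talg V] [the lmodType C of talg V]).

Definition mu_vee : TT -> talg V :=
  tensor_lift (fun X Y => Sym (talg_mul X Y)).

Definition contract_word (L : V -> V -> C) u w : TT :=
  match u, w with
  | x :: u', y :: w' => ((size u)%:R * (size w)%:R * L (last x u') y) *:
                        tens (word (belast x u')) (word w')
  | _, _ => 0
  end.

Definition contract (L : V -> V -> C) : TT -> TT :=
  tensor_lift (talg_slift2 idfun (contract_word L)).

(* only finitely many terms are nonzero, see [iter_contract_eq0] *)
Definition star (L : V -> V -> C) X Y : talg V :=
  \sum_(t \in [set: nat])
    (t`!%:R^-1 *: mu_vee (iter t (contract L) (tens X Y))).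

Definition talg_invol (conjV : V -> V) : talg V -> talg V :=
  talg_slift Num.conj_op (fun u => word (rev (map conjV u))).

(* tensors of different degrees are orthogonal *)
Definition form_word (h : V -> V -> C) u w : C^o :=
  if size u == size w
  then (size u)`!%:R * \prod_(m < size u) h u`_m w`_m else 0.

Definition talg_form (h : V -> V -> C) : talg V -> talg V -> C :=
  talg_slift2 Num.conj_op (form_word h).

Definition talg_norm (h : V -> V -> C) X : C := sqrtC (talg_form h X X).

End StarProduct.

Section StarProductTheory.
Context {C : numClosedFieldType} {V : lmodType C}.
Implicit Types (X Y : talg V) (u w : seq V).

Definition bilinear_form (L : V -> V -> C) : Prop :=
  (forall x, scalar (L x)) /\ (forall y, scalar (L^~ y)).

Section contract.
Variable L : V -> V -> C.
Hypothesis L_bilin : bilinear_form L.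

Lemma contract_word_rcons u x y w : contract_word L (rcons u x) (y :: w) =
  ((size u).+1%:R * (size w).+1%:R * L x y) *: tens (word u) (word w).
Proof.
case: u => [|x0 u]; first exact: erefl.
by rewrite [LHS]/= last_rcons belast_rcons size_rcons.
Qed.

Lemma contract_word_linr u : semimultilinear idfun (contract_word L u).
Proof.
case/lastP: u => [|u z] a w w' x y; rewrite -[idfun a]/a.
  by case: w => [|? ?]; rewrite scaler0 addr0.
case: w => [|y0 w]; rewrite ?cat0s ?cat_cons !contract_word_rcons.
  by rewrite L_bilin.1 mulrDr mulrCA scalerDl scalerA.
rewrite !size_cat word_multilinear tens_linr scalerDr.
by rewrite !scalerA [_ * a]mulrC.
Qed.

Lemma contract_word_linl w : semimultilinear idfun (contract_word L ^~ w).
Proof.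
case: w => [|z w] a u u' x y; rewrite -[idfun a]/a.
  by case: u => [|? ?]; rewrite scaler0 addr0.
case/lastP: u' => [|u' y0].
  rewrite !cats1 !contract_word_rcons.
  by rewrite L_bilin.2 mulrDr mulrCA scalerDl scalerA.
rewrite -!rcons_cons -!rcons_cat !contract_word_rcons.
rewrite !size_cat word_multilinear tens_linl scalerDr.
by rewrite !scalerA [_ * a]mulrC.
Qed.

Lemma contract_tens X Y :
  contract L (tens X Y) = talg_slift2 idfun (contract_word L) X Y.
Proof.
rewrite /contract tensor_liftE// => Z.
  by move=> a x y; apply: (talg_slift2_linl (s := idfun));
    [exact: contract_word_linl|exact: contract_word_linr].
exact: (talg_slift2_linr (s := idfun) contract_word_linl contract_word_linr).
Qed.

Lemma contract_linear : linear (contract L).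
Proof.
apply: tensor_lift_linear => Z.
  by move=> a x y; apply: (talg_slift2_linl (s := idfun));
    [exact: contract_word_linl|exact: contract_word_linr].
exact: (talg_slift2_linr (s := idfun) contract_word_linl contract_word_linr).
Qed.

Lemma contract_tens_word u w :
  contract L (tens (word u) (word w)) = contract_word L u w.
Proof.
by rewrite contract_tens
  (talg_slift2E (s := idfun) contract_word_linl contract_word_linr).
Qed.

Let iter_contract_lin t a x y : iter t (contract L) (a *: x + y) =
  a *: iter t (contract L) x + iter t (contract L) y.
Proof. by elim: t => //= t ->; rewrite contract_linear. Qed.

Let iter_contract0 t : iter t (contract L) 0 = 0.
Proof.
have := iter_contract_lin t (-1) 0 0.
by rewrite !scaleN1r addNr => ->; rewrite addNr.
Qed.

Lemma iter_contract_word_eq0 t u w : (size u < t)%N ->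
  iter t (contract L) (tens (word u) (word w)) = 0.
Proof.
elim: t u w => // t IH u w; rewrite iterSr contract_tens_word.
case/lastP: u => [|u x]; first by rewrite iter_contract0.
case: w => [|y w].
  by case: (rcons u x) => [|? ?]; rewrite iter_contract0.
rewrite size_rcons ltnS => ut; rewrite contract_word_rcons.
by rewrite -[_ *: _]addr0 iter_contract_lin IH// iter_contract0 addr0 scaler0.
Qed.

Lemma iter_contract_eq0 X Y :
  exists N, forall t, (N <= t)%N -> iter t (contract L) (tens X Y) = 0.
Proof.
move: X; apply: talg_ind => [|a u X [N NX]].
  exists 0%N => t _; have := tens_linl (-1) (0 : talg V) 0 Y.
  by rewrite !scaleN1r addNr => ->; rewrite addNr iter_contract0.
exists (maxn (size u).+1 N) => t; rewrite geq_max => /andP[ut Nt].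
rewrite tens_linl iter_contract_lin (NX _ Nt) addr0.
move: Y {NX}; apply: talg_ind => [|b w Y IH].
  have := tens_linr (word u) (-1) (0 : talg V) 0.
  by rewrite !scaleN1r addNr => ->; rewrite addNr iter_contract0 scaler0.
rewrite tens_linr iter_contract_lin scalerDr IH addr0.
by rewrite (iter_contract_word_eq0 _ ut) !scaler0.
Qed.
End contract.

End StarProductTheory.

Section SymmetricTensors.
Context {C : numClosedFieldType}.

Definition symmetric_tensor (V : lmodType C) : {pred talg V} :=
  fun X => X \in range (@Sym C V).
Arguments symmetric_tensor : clear implicits.

Fact symmetric_submod (V : lmodType C) : submod_closed (symmetric_tensor V).
Proof.
have S_lin a x y : x \in symmetric_tensor V -> y \in symmetric_tensor V ->
    a *: x + y \in symmetric_tensor V.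
  move=> /set_mem[x0 _ <-] /set_mem[y0 _ <-].
  by apply/mem_set; exists (a *: x0 + y0) => //; rewrite Sym_linear.
split; last by move=> a x y; exact: S_lin.
have S0 : Sym 0 \in symmetric_tensor V by apply/mem_set; exists 0.
by have := S_lin (-1) _ _ S0 S0; rewrite scaleN1r addNr.
Qed.

HB.instance Definition _ (V : lmodType C) :=
  GRing.isSubmodClosed.Build C (talg V) (symmetric_tensor V) (symmetric_submod V).

Record salg (V : lmodType C) := SAlg {
  salg_val :> talg V;
  salg_valP : salg_val \in symmetric_tensor V }.

HB.instance Definition _ V := [isSub for @salg_val V].
HB.instance Definition _ V := [Choice of salg V by <:].
HB.instance Definition _ V := [SubChoice_isSubLmodule of salg V by <:].

Context {V : lmodType C}.
Implicit Types X Y : salg V.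

Fact star_symmetric (L : V -> V -> C) (X Y : talg V) :
  star L X Y \in symmetric_tensor V.
Proof.
rewrite /star; apply: rpred_sum => t _; apply: rpredZ.
rewrite /mu_vee /tensor_lift slift_def /free_slift.
apply: rpred_sum => p _; apply: rpredZ.
by apply/mem_set; exists (talg_mul p.1 p.2).
Qed.

Lemma invol_word_semimultilinear (conjV : V -> V) :
  linear_for (Num.conj_op \; *:%R) conjV ->
  semimultilinear Num.conj_op (fun u => word (rev (map conjV u))).
Proof.
move=> cl a u u' x y; rewrite !map_cat/= !rev_cat !rev_cons -!cats1 -!catA/=.
by rewrite cl word_multilinear.
Qed.

Let rev_perm n : 'S_n := perm (@rev_ord_inj n).

Lemma Sym_invol (conjV : V -> V) (X : talg V) :
  linear_for (Num.conj_op \; *:%R) conjV ->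
  talg_invol conjV (Sym X) = Sym (talg_invol conjV X).
Proof.
move=> cl; have cw := invol_word_semimultilinear cl.
have I_lin a x y : talg_invol conjV (a *: x + y) =
    a^* *: talg_invol conjV x + talg_invol conjV y.
  exact: (talg_slift_lin (s := Num.conj_op) cw).
have IE u : talg_invol conjV (word u) = word (rev (map conjV u)).
  exact: (talg_sliftE (s := Num.conj_op) cw).
have I0 : talg_invol conjV 0 = 0.
  by have := I_lin (-1) 0 0; rewrite rmorphN1 !scaleN1r addNr => ->; rewrite addNr.
have ID x y : talg_invol conjV (x + y) = talg_invol conjV x + talg_invol conjV y.
  by rewrite -[x in LHS]scale1r I_lin rmorph1 scale1r.
have IZ a x : talg_invol conjV (a *: x) = a^* *: talg_invol conjV x.
  by rewrite -[a *: x]addr0 I_lin I0 addr0.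
have S0 : Sym 0 = 0 :> talg V.
  by have := Sym_linear (-1) (0 : talg V) 0; rewrite !scaleN1r addNr => ->; rewrite addNr.
move: X; apply: talg_ind => [|a u X IH]; first by rewrite S0 I0 S0.
rewrite Sym_linear !I_lin IH Sym_linear; congr (_ *: _ + _).
rewrite IE !SymE; set v := rev _.
have vn : size v = size u by rewrite size_rev size_map.
have -> : Sym_word v = (size u)`!%:R^-1 *:
    \sum_(s : 'S_(size u)) word (perm_word s v) by rewrite /Sym_word vn.
rewrite /Sym_word IZ fmorphV rmorph_nat; congr (_ *: _).
rewrite (big_morph _ ID I0).
rewrite [RHS](reindex_inj (h := fun s => (rev_perm _ * s * rev_perm _)%g)); last first.
  by move=> s t /mulIg/mulgI.
apply: eq_bigr => s _; rewrite IE; congr word.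
apply: (@eq_from_nth _ 0); rewrite size_rev size_map !size_perm_word// => i iu.
rewrite nth_rev size_map !size_perm_word//.
have ru : (size u - i.+1 < size u)%N by rewrite ltn_subrL (leq_ltn_trans _ iu).
rewrite (nth_map 0) ?size_perm_word//.
rewrite -[(size u - i.+1)%N]/(val (rev_ord (Ordinal iu))).
rewrite -[i in RHS]/(val (Ordinal iu)) !nth_perm_word !permM !permE.
rewrite /v nth_rev size_map; last exact: ltn_ord.
set k := s _; rewrite /= (nth_map 0); last first.
  by rewrite ltn_subrL (leq_ltn_trans _ iu).
by rewrite subnSK ?ltn_ord// subKn// ltnW// ltn_ord.
Qed.

Record antilinear_involution := AntilinearInvolution {
  ainvol_fun :> V -> V;
  ainvol_antilinear : linear_for (Num.conj_op \; *:%R) ainvol_fun;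
  ainvol_involutive : involutive ainvol_fun }.

Fact invol_symmetric (conjV : antilinear_involution) X :
  talg_invol conjV X \in symmetric_tensor V.
Proof.
case: X => X /= /set_mem[Y _ <-]; rewrite Sym_invol; last first.
  exact: ainvol_antilinear.
by apply/mem_set; exists (talg_invol conjV Y).
Qed.

Definition salg_star (L : V -> V -> C) X Y : salg V :=
  SAlg (star_symmetric L X Y).

Definition salg_invol (conjV : antilinear_involution) X : salg V :=
  SAlg (invol_symmetric conjV X).

End SymmetricTensors.
Arguments antilinear_involution {C} V.
Arguments symmetric_tensor {C} V _.

Section Topology.
Context {C : numClosedFieldType}.

Definition positive_hermitian_forms (V : tvsType C) : set (V -> V -> C) :=
  [set h | [/\ (forall x, scalar (h x)),
               (forall x y, h x y = (h y x)^*),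
               (forall x, 0 <= h x x) &
               continuous (fun p : V * V => h p.1 p.2)]].

Arguments positive_hermitian_forms : clear implicits.

HB.instance Definition _ (V : lmodType C) := isPointed.Build (talg V) 0.

HB.instance Definition _ (V : tvsType C) :=
  @isSubBaseTopological.Build (talg V)
    ((V -> V -> C) * talg V * C)%type
    [set i | positive_hermitian_forms V i.1.1 /\ 0 < i.2]
    (fun i => [set Y | talg_norm i.1.1 (Y - i.1.2) < i.2]).

HB.instance Definition _ (V : tvsType C) :=
  Topological.copy (salg V) (initial_topology (@salg_val C V)).

End Topology.
Arguments positive_hermitian_forms {C} V _.

Section Nuclear.
Context {C : numClosedFieldType}.

Definition seminorm (V : lmodType C) (p : V -> C) : Prop :=
  [/\ (forall x, 0 <= p x),
      (forall a x, p (a *: x) = `|a| * p x) &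
      (forall x y, p (x + y) <= p x + p y)].

(* [B], with [iota], is the Banach space associated with the seminorm [p], i.e.
   the completion of V / ker p *)
Definition is_local_banach (V : lmodType C) (p : V -> C)
    (B : completeNormedModType C) (iota : {linear V -> B}) : Prop :=
  (forall x, `|iota x| = p x) /\ dense (range iota).

(* Grothendieck's definition: every continuous seminorm p is dominated by a
   continuous seminorm q such that the canonical map between the associated
   Banach spaces is nuclear. Continuous linear forms on the Banach space of q
   are linear forms on V bounded by a multiple of q, and the nuclear expansion
   needs to be checked on the dense image of V only. *)
Definition nuclear (V : tvsType C) : Prop :=
  forall p : V -> C, seminorm p -> continuous p ->
  exists q : V -> C, [/\ seminorm q, continuous q, (forall x, p x <= q x) &
    exists (B : completeNormedModType C) (iota : {linear V -> B}),
      is_local_banach p iota /\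
      exists (lambda : nat -> C) (f : nat -> {scalar V}) (b : nat -> B),
        [/\ cvgn (series (fun n => `|lambda n|)),
            (forall n x, `|f n x| <= q x),
            (forall n, `|b n| <= 1) &
            forall x, series (fun n => (lambda n * f n x) *: b n) @ \oo
                      --> iota x]].

End Nuclear.

Definition hermitian_form {C : numClosedFieldType} {V : lmodType C}
    (conjV : V -> V) (L : V -> V -> C) : Prop :=
  forall v w, L v w = (L (conjV w) (conjV v))^*.

Definition positive_functional {C : numClosedFieldType} {V : lmodType C}
    (conjV : antilinear_involution V) (L : V -> V -> C)
    (omega : salg V -> C) : Prop :=
  forall X, 0 <= omega (salg_star L (salg_invol conjV X) X).

Definition complexField (R : realType) : numClosedFieldType := R[i].

(* Main.v *)
Require Import Defs.
From HB Require Import structures.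
From mathcomp Require Import all_boot all_order all_algebra.
From mathcomp Require Import perm spectral sesquilinear.
From mathcomp Require Import all_classical all_reals all_analysis.
From mathcomp Require Import complex.
From mathcomp Require Import ring zify.
From Stdlib Require Import Permutation.
(* Sym is the symmetrisation of tensors, not the group of permutations of a set *)
Import Defs.

(** The separating functionals are Gaussian moments. For a symmetric bilinear
    form b and a linear form rho on V, let gaussian rho b send x1 (x) ... (x) xk
    to the sum, over all partial pairings of the indices, of the product of the
    b(xi, xj) over the pairs {i, j} and of the rho(xi) over the unpaired i: the
    k-th moment of a Gaussian of mean rho and covariance b.

    Positivity. On the formal exponential e^v = sum_k v^k / k! the functional
    takes the value g(v) = exp(rho(v) + b(v, v) / 2), and the star product of e^v
    and e^w is e^Lambda(v, w) e^(v + w). Hence, when rho and b are real for the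
    involution, the value at the star product of the adjoint of e^v with e^w is
    conj(g(v)) g(w) exp(H(v, w)), where
    H(v, w) = Lambda(conj v, w) + b(conj v, w). If H is positive semidefinite, so
    are its powers (psdM, the product theorem of Schur), and the functional is
    positive. This is carried out degree by degree: powers v^k, which span the symmetric tensors by polarization
    (Sym_span), replace exponentials, and gauss_two_powers and mixed_term_shift
    replace the multiplicativity of the exponential (gaussian_positive).

    The covariance. A continuous Lambda is bounded by p(v) p(w) for a continuous
    seminorm p (bilinear_seminorm), and nuclearity bounds p^2 by a multiple S of
    a series sum_n mu_n |f_n|^2 with summable mu and equicontinuous f
    (nuclear_expansion). With f^+(v) the conjugate of f(conj v), the form
    b = S sum_n mu_n (f_n (x) f_n^+ + f_n^+ (x) f_n) is real and
    b(conj v, v) >= |Lambda(conj v, v)|, so H is positive semidefinite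
    (covariance_exists).

    Continuity. All f_n, all f_n^+ and rho are dominated by one continuous
    Hilbert seminorm (hilbert_domination). As b is a summable combination of
    products of such forms, every pairing of k letters contributes at most a
    geometric factor in k, and the number of pairings of k letters grows like
    sqrt(k!) up to a geometric factor (gbound_sqr); the factor k! in the square
    of the norm of degree k compensates it (gaussian_bound,
    gaussian_continuous).

    Separation. The form b is kept fixed and rho runs over all continuous real
    linear forms. If all gaussian rho b vanish on a symmetric X then, taking the
    derivative in rho in the direction sigma, they vanish on the contraction
    annih sigma X, whose degree is smaller (gaussian_annih). By induction
    annih sigma X = 0 for all sigma; as the continuous real linear forms
    separate the points of V, X is a scalar (head_contract_eq0), and this scalar
    is the value of each of the functionals on X (gaussian_separates). *)

Set Implicit Arguments.
Unset Strict Implicit.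
Unset Printing Implicit Defensive.

Import Order.TTheory GRing.Theory Num.Theory.
Import numFieldNormedType.Exports.

Local Open Scope classical_set_scope.
Local Open Scope ring_scope.

(** * Positive semidefinite kernels *)
Section PsdKernels.
Context {C : numClosedFieldType} {T : Type}.
Implicit Types (K L : T -> T -> C).

Definition psd K : Prop :=
  (forall x y, K y x = (K x y)^*) /\
  forall n (c : 'I_n -> C) (t : 'I_n -> T),
    0 <= \sum_i \sum_j (c i)^* * c j * K (t i) (t j).

Lemma psd_rank1 (f : T -> C) : psd (fun x y => (f x)^* * f y).
Proof.
split=> [x y|n c t]; first by rewrite rmorphM /= conjCK mulrC.
have -> : \sum_i \sum_j (c i)^* * c j * ((f (t i))^* * f (t j)) =
    (\sum_i c i * f (t i)) * (\sum_i c i * f (t i))^*.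
  rewrite rmorph_sum mulrC mulr_suml; apply: eq_bigr => i _.
  rewrite mulr_sumr; apply: eq_bigr => j _; rewrite rmorphM; ring.
exact: mul_conjC_ge0.
Qed.

Lemma psdD K L : psd K -> psd L -> psd (fun x y => K x y + L x y).
Proof.
move=> [Ks Kp] [Ls Lp]; split=> [x y|n c t].
  by rewrite rmorphD /= Ks// Ls.
under eq_bigr do under eq_bigr do rewrite mulrDr.
under eq_bigr do rewrite big_split /=.
by rewrite big_split /= addr_ge0// ?Kp ?Lp.
Qed.

Lemma psdZ a K : 0 <= a -> psd K -> psd (fun x y => a * K x y).
Proof.
move=> a0 [Ks Kp]; split=> [x y|n c t].
  by rewrite rmorphM /= Ks// (CrealP (ger0_real a0)).
under eq_bigr do under eq_bigr do rewrite mulrCA.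
under eq_bigr do rewrite -mulr_sumr.
by rewrite -mulr_sumr mulr_ge0 ?Kp.
Qed.

Lemma eq_psd K L : (forall x y, K x y = L x y) ->
  psd K -> psd L.
Proof.
move=> KL [Ks Kp]; split=> [x y|n c t]; first by rewrite -!KL// Ks.
by under eq_bigr do under eq_bigr do rewrite -KL//; exact: Kp.
Qed.

(** Spectral theorem for the matrix of K on a finite family: on that family K is
    a sum of nonnegative multiples of rank one kernels. *)
Lemma psd_spectral K n (t : 'I_n -> T) : psd K ->
  exists (d : 'I_n -> C) (P : 'I_n -> 'I_n -> C), (forall l, 0 <= d l) /\
    forall i j, K (t i) (t j) = \sum_l d l * ((P l i)^* * P l j).
Proof.
move=> [Ks Kp]; pose A := \matrix_(i < n, j < n) K (t i) (t j).
have Ah : A \is hermsymmx.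
  apply/is_hermitianmxP; rewrite expr0 scale1r.
  by apply/matrixP => i j; rewrite !mxE Ks.
have /orthomx_spectralP AE := hermitian_normalmx Ah.
have PU := spectral_unitarymx A.
set P := spectralmx A in AE PU; set d := spectral_diag A in AE.
rewrite invmx_unitary// in AE.
exists (fun l => d 0 l), (fun l i => P l i); split; last first.
  move=> i j; have /matrixP/(_ i j) := AE; rewrite mxE => ->.
  rewrite mxE; apply: eq_bigr => l _.
  rewrite mul_mx_diag !mxE; ring.
move=> l; have /unitarymxP PP := PU.
have : P *m A *m map_mx Num.conj_op P^T = diag_mx d.
  by rewrite {1}AE !mulmxA PP mul1mx -mulmxA PP mulmx1.
move=> /matrixP/(_ l l); rewrite [in RHS]mxE eqxx mulr1n => <-.
have := Kp n (fun i => (P l i)^*) t; congr (0 <= _).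
rewrite mxE exchange_big /=; apply: eq_bigr => j _.
rewrite mxE mulr_suml; apply: eq_bigr => i _.
by rewrite !mxE conjCK mulrAC.
Qed.

(** The product theorem of Schur. For a rank one kernel K, multiplication by K
    only rescales the coefficients c by a function; the spectral decomposition
    reduces the general case to this one. *)
Lemma psdM K L : psd K -> psd L -> psd (fun x y => K x y * L x y).
Proof.
move=> Kp [Ls Lp]; split=> [x y|n c t].
  by rewrite rmorphM /= Kp.1// Ls.
have [d [P [d0 KE]]] := psd_spectral t Kp.
have -> : \sum_i \sum_j (c i)^* * c j * (K (t i) (t j) * L (t i) (t j)) =
  \sum_l d l * \sum_i \sum_j (c i * P l i)^* * (c j * P l j) * L (t i) (t j).
  under [RHS]eq_bigr do rewrite mulr_sumr.
  rewrite [RHS]exchange_big /=; apply: eq_bigr => i _.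
  under [RHS]eq_bigr do rewrite mulr_sumr.
  rewrite [RHS]exchange_big /=; apply: eq_bigr => j _.
  rewrite KE mulr_suml mulr_sumr; apply: eq_bigr => l _.
  by rewrite rmorphM; ring.
by apply: sumr_ge0 => l _; rewrite mulr_ge0// Lp.
Qed.

Lemma psd_1 : psd (fun _ _ => 1).
Proof.
by apply: eq_psd (psd_rank1 (fun=> 1)) => x y; rewrite conjC1 mulr1.
Qed.

Lemma psdX K r : psd K -> psd (fun x y => K x y ^+ r).
Proof.
move=> Kp; elim: r => [|r IH]; first exact: psd_1.
by apply: eq_psd (psdM Kp IH) => x y; rewrite exprS.
Qed.

End PsdKernels.

Lemma psd_pull {C : numClosedFieldType} {T U : Type} (K : T -> T -> C)
    (g : U -> T) : psd K -> psd (fun u w => K (g u) (g w)).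
Proof.
move=> [Ks Kp]; split=> [x y|n c t]; first exact: Ks.
exact: (Kp n c (fun i => g (t i))).
Qed.

(** * Linear maps *)

Section LinearMaps.
Context {K : nzRingType} {U W : lmodType K} {L : U -> W}.
Hypothesis Ll : linear L.

Lemma lin0 : L 0 = 0.
Proof. by have := Ll (-1) 0 0; rewrite !scaleN1r addNr => ->; rewrite addNr. Qed.

Lemma linZ a x : L (a *: x) = a *: L x.
Proof. by rewrite -[a *: x]addr0 Ll lin0 addr0. Qed.

Lemma linD x y : L (x + y) = L x + L y.
Proof. by rewrite -[x]scale1r Ll !scale1r. Qed.

Lemma lin_sum I (s : seq I) P (F : I -> U) :
  L (\sum_(i <- s | P i) F i) = \sum_(i <- s | P i) L (F i).
Proof. exact: (big_morph L linD lin0). Qed.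

Lemma lin_comb I (s : seq (K * I)) (g : I -> U) :
  L (\sum_(p <- s) p.1 *: g p.2) = \sum_(p <- s) p.1 *: L (g p.2).
Proof. by rewrite lin_sum; apply: eq_bigr => p _; rewrite linZ. Qed.

End LinearMaps.

Lemma scalar0 (K : comNzRingType) (V : lmodType K) (f : V -> K) : scalar f -> f 0 = 0.
Proof. by move=> fl; exact: (@lin0 K V K^o f fl). Qed.

Lemma scalarB (K : comNzRingType) (V : lmodType K) (f : V -> K) x y :
  scalar f -> f (x - y) = f x - f y.
Proof. by move=> fl; rewrite addrC -scaleN1r fl mulN1r addrC. Qed.

(** * Gaussian moments of words *)

Section Deletion.
Context {K : comNzRingType} {V : Type}.

(** The transpose of the contraction of words by f at all positions. The letters
    that are kept move into F, which makes the recursion structural in u. *)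
Fixpoint delsum {W : lmodType K} (f : V -> K) (F : seq V -> W) (u : seq V) : W :=
  if u is x :: u' then f x *: F u' + delsum f (F \o cons x) u' else 0.

Context {W : lmodType K}.
Implicit Types (f g : V -> K) (F G : seq V -> W).

Lemma eq_delsum_size f g F G u : f =1 g ->
  (forall w, (size w).+1 = size u -> F w = G w) -> delsum f F u = delsum g G u.
Proof.
move=> fg; elim: u F G => //= x u IH F G FG.
by rewrite fg FG// (IH _ (G \o cons x))// => w wu; exact/FG/congr1.
Qed.

Lemma eq_delsum f F G u : F =1 G -> delsum f F u = delsum f G u.
Proof. by move=> FG; apply: eq_delsum_size. Qed.

Lemma delsum_linr f a F G u :
  delsum f (fun w => a *: F w + G w) u = a *: delsum f F u + delsum f G u.
Proof.
elim: u F G => [|x u IH] F G /=; first by rewrite scaler0 addr0.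
rewrite (IH (F \o cons x) (G \o cons x)) !scalerDr !scalerA [_ * a]mulrC.
by rewrite addrACA.
Qed.

Lemma delsum_linl a f g F u :
  delsum (fun x => a * f x + g x) F u = a *: delsum f F u + delsum g F u.
Proof.
elim: u F => [|x u IH] F /=; first by rewrite scaler0 addr0.
by rewrite IH scalerDl !scalerDr scalerA addrACA.
Qed.

(** Both sides sum over ordered pairs of distinct positions. *)
Lemma delsumC f g F u : delsum f (delsum g F) u = delsum g (delsum f F) u.
Proof.
elim: u F => //= x u IH F.
have E h k : delsum h (delsum k F \o cons x) u =
    k x *: delsum h F u + delsum h (delsum k (F \o cons x)) u.
  by rewrite -delsum_linr; exact: eq_delsum.
by rewrite !E IH addrCA.
Qed.

Definition perm_invariant F := forall u w, Permutation u w -> F u = F w.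

Lemma delsum_perm f F : perm_invariant F -> perm_invariant (delsum f F).
Proof.
move=> FP u w uw; elim: uw F FP => //=.
- move=> x {}u {}w uw IH F FP; rewrite (FP _ _ uw) IH//.
  by move=> s t st; apply: FP; constructor.
- move=> x y {}u F FP; rewrite addrCA; congr (_ + (_ + _)).
  by apply: eq_delsum => s; apply: FP; constructor.
- by move=> s t r _ IH1 _ IH2 F FP; rewrite IH1// IH2.
Qed.

Lemma delsum_nseq f F m n v w :
  delsum f F (nseq m v ++ nseq n w) =
    (m%:R * f v) *: F (nseq m.-1 v ++ nseq n w) +
    (n%:R * f w) *: F (nseq m v ++ nseq n.-1 w).
Proof.
elim: m F => [|m IHm] F /=.
  rewrite mul0r scale0r add0r; elim: n F => [|n IHn] F /=.
    by rewrite mul0r scale0r.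
  rewrite IHn /=; case: n {IHn} => [|n] /=.
    by rewrite mul0r scale0r addr0 mul1r.
  by rewrite -scalerDl; congr (_ *: _); ring.
rewrite IHm /=; case: m {IHm} => [|m] /=.
  by rewrite mul0r scale0r add0r mul1r.
by rewrite addrA -scalerDl; congr (_ *: _ + _); ring.
Qed.

End Deletion.

Section DeletionMultilinear.
Context {K : comNzRingType} {V W : lmodType K}.
Implicit Types (f : V -> K) (F : seq V -> W).

Lemma semimultilinear_cons (s : K -> K) F x :
  semimultilinear s F -> semimultilinear s (F \o cons x).
Proof. by move=> Fl a u u' y z; exact: (Fl a (x :: u) u'). Qed.

Lemma delsum_multilinear f F : scalar f -> semimultilinear idfun F ->
  semimultilinear idfun (delsum f F).
Proof.
move=> fl Fl a u u' x y; elim: u F Fl => [|z u IH] F Fl /=.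
  rewrite fl scalerDl -[delsum f _ u' in LHS]/(delsum f (fun w => F ((a *: x + y) :: w)) u').
  have -> : delsum f (fun w => F ((a *: x + y) :: w)) u' =
      delsum f (fun w => a *: F (x :: w) + F (y :: w)) u'.
    by apply: eq_delsum => w; rewrite (Fl a [::] w).
  by rewrite delsum_linr scalerDr scalerA addrACA.
rewrite Fl IH; last exact: semimultilinear_cons.
by rewrite !scalerDr !scalerA [f z * a]mulrC addrACA.
Qed.

Lemma linear_delsum (U : lmodType K) (L : W -> U) f F u : linear L ->
  L (delsum f F u) = delsum f (L \o F) u.
Proof. by move=> Ll; elim: u F => [|x u IH] F /=; rewrite ?lin0// Ll IH. Qed.

End DeletionMultilinear.

Section Gauss.
Context {K : comNzRingType} {V : Type}.
Implicit Types (rho : V -> K) (b : V -> V -> K).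

(** The moment of a Gaussian of mean rho and covariance b, expanded by the fate
    of the first letter: it stays alone, or it is paired with a later letter,
    which is deleted. The latter is not a structural recursion, whence the fuel
    n. *)
Fixpoint gauss_rec rho b n (u : seq V) : K^o :=
  match n, u with
  | n'.+1, x :: u' =>
      rho x * gauss_rec rho b n' u' + delsum (b x) (gauss_rec rho b n') u'
  | _, _ => 1
  end.

Definition gauss rho b (u : seq V) : K^o := gauss_rec rho b (size u) u.

Lemma gauss_rec_fuel rho b n m u : (size u <= n)%N -> (size u <= m)%N ->
  gauss_rec rho b n u = gauss_rec rho b m u.
Proof.
elim: n m u => [|n IH] [|m] [|x u] //= un um.
rewrite (IH m u un um); congr (_ + _); apply: eq_delsum_size => // w wu.
by apply: IH; lia.
Qed.

Lemma gauss_cons rho b x u :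
  gauss rho b (x :: u) = rho x * gauss rho b u + delsum (b x) (gauss rho b) u.
Proof.
rewrite {1}/gauss /=; congr (_ + _); apply: eq_delsum_size => // w wu.
by apply: gauss_rec_fuel => //; rewrite -wu.
Qed.

(** The induction that matches gauss_cons: two letters may disappear at once. *)
Lemma gauss_ind (P : seq V -> Prop) :
  (P [::]) ->
  (forall x u, P u -> (forall w, (size w).+1 = size u -> P w) -> P (x :: u)) ->
  forall u, P u.
Proof.
move=> P0 PS u; have [n] := ubnP (size u); elim: n u => // n IH [|x u] //= un.
by apply: PS => [|w wu]; apply: IH; lia.
Qed.

(** Expanding the first two letters of both sides leaves the term b x y, which
    is symmetric, and terms exchanged by x <-> y up to delsumC. *)
Lemma gauss_swap rho b x y u : (forall x y, b x y = b y x) ->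
  gauss rho b (x :: y :: u) = gauss rho b (y :: x :: u).
Proof.
move=> bC; rewrite !gauss_cons /= -![_ *: _ : K^o]/(_ * _).
have E z t : delsum (b z) (gauss rho b \o cons t) u =
    rho t * delsum (b z) (gauss rho b) u + delsum (b z) (delsum (b t) (gauss rho b)) u.
  rewrite -[RHS](delsum_linr (W := K^o)); apply: eq_delsum => w /=.
  exact: gauss_cons.
by rewrite !E delsumC bC; ring.
Qed.

Lemma gauss_perm rho b : (forall x y, b x y = b y x) ->
  perm_invariant (gauss rho b).
Proof.
move=> bC.
suff H n u w : (size u < n)%N -> Permutation u w -> gauss rho b u = gauss rho b w.
  by move=> u w; apply: (H (size u).+1).
elim: n u w => // n IH u w un uw; elim: uw un => //=.
- move=> x {}u {}w uw _ un; rewrite !gauss_cons (IH _ _ _ uw); last lia.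
  congr (_ + _).
  (* invariance is known for the words shorter than n only, hence the cut-off *)
  pose G s : K^o := if (size s < n)%N then gauss rho b s else 0.
  have GP : perm_invariant G.
    move=> s t st; rewrite /G.
    have -> : size t = size s by have := Permutation_length st.
    by case: ltnP => // sn; exact: IH.
  have E s : (size s <= n)%N -> delsum (b x) (gauss rho b) s = delsum (b x) G s.
    by move=> sn; apply: eq_delsum_size => // t ts; rewrite /G ifT//; lia.
  have ws : size w = size u by have := Permutation_length uw.
  by rewrite !E ?ws; try lia; exact: (delsum_perm (b x) GP uw).
- by move=> x y {}u _; exact: gauss_swap.
- move=> s t r st IH1 tr IH2 sn; rewrite IH1// IH2//.
  by have ->: size t = size s by have := Permutation_length st.
Qed.

End Gauss.

Section GaussMorph.
Context {K : comNzRingType} {V : Type}.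

Lemma delsum_morph (L : comNzRingType) (phi : {rmorphism K -> L}) (f : V -> K)
    (F : seq V -> K^o) u :
  phi (delsum f F u) = delsum (phi \o f) (phi \o F : seq V -> L^o) u.
Proof.
elim: u F => [|x u IH] F /=; first exact: rmorph0.
by rewrite rmorphD rmorphM -IH.
Qed.

Lemma gauss_morph (L : comNzRingType) (phi : {rmorphism K -> L}) rho
    (b : V -> V -> K) u :
  phi (gauss rho b u) = gauss (phi \o rho) (fun x y => phi (b x y)) u.
Proof.
elim/(@gauss_ind V): u => [|x u IHu IH]; first by rewrite /gauss /= rmorph1.
rewrite !gauss_cons rmorphD rmorphM IHu delsum_morph; congr (_ + _).
by apply: (@eq_delsum_size L V L^o) => // w /IH.
Qed.

Lemma delsum_map (U : Type) (W : lmodType K) (g : U -> V) (f : V -> K) (F : seq V -> W) u :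
  delsum f F (map g u) = delsum (f \o g) (F \o map g) u.
Proof. by elim: u F => //= x u IH F; rewrite IH. Qed.

Lemma gauss_map (U : Type) (g : U -> V) rho (b : V -> V -> K) u :
  gauss rho b (map g u) = gauss (rho \o g) (fun x y => b (g x) (g y)) u.
Proof.
elim/(@gauss_ind U): u => [|x u IHu IH] //=.
rewrite !gauss_cons IHu delsum_map; congr (_ + _).
by apply: eq_delsum_size => // w /IH.
Qed.

Lemma eq_gauss (rho rho' : V -> K) (b b' : V -> V -> K) u :
  rho =1 rho' -> b =2 b' -> gauss rho b u = gauss rho' b' u.
Proof.
move=> rr bb; elim/(@gauss_ind V): u => [|x u IHu IH] //.
rewrite !gauss_cons IHu rr; congr (_ + _).
by apply: eq_delsum_size => [y|w /IH].
Qed.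

End GaussMorph.

(** The moments of mean rho + X sigma, with X an indeterminate, have the moments
    of mean rho + s sigma as values at s; their derivative at 0 contracts one
    letter with sigma, as for the derivative of a Gaussian integral in its mean.
    *)
Lemma gauss_deform (K : comNzRingType) (V : Type) (rho sigma : V -> K) (b : V -> V -> K) u :
  let P := gauss (fun x => (rho x)%:P + sigma x *: 'X) (fun x y => (b x y)%:P) u in
  (forall s, P.[s] = gauss (fun x => rho x + s * sigma x) b u) /\
  P`_1 = delsum sigma (gauss rho b) u.
Proof.
move=> P; split=> [s|].
  rewrite -[LHS]/(horner_eval s P) /P gauss_morph.
  apply: eq_gauss => [x|x y] /=.
    by rewrite /horner_eval !hornerE mulrC.
  by rewrite /horner_eval hornerC.
rewrite /P {P}; set R := fun x => _; set B := fun x y => _.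
suff [] : (gauss R B u)`_0 = gauss rho b u /\
    (gauss R B u)`_1 = delsum sigma (gauss rho b) u by [].
elim/(@gauss_ind V): u => [|x u [IH0 IH1] IH].
  by rewrite /gauss /= !coef1.
have E k (g : seq V -> K^o) : (forall w, (size w).+1 = size u -> (gauss R B w)`_k = g w) ->
    (delsum (B x) (gauss R B) u)`_k = delsum (b x) g u.
  move=> gE; have -> : delsum (b x) g u = delsum (b x) (fun w => (gauss R B w)`_k : K^o) u.
    by apply: eq_delsum_size => // w /gE.
  elim: u (gauss R B) {IH0 IH1 IH gE} => [|y u IH] F /=; first by rewrite coef0.
  by rewrite coefD IH /B -[_ *: _ : {poly K}^o]/(_ * _) coefCM.
rewrite !gauss_cons /= !coefD {2 4}/R !mulrDl !coefD !coefCM -!scalerAl !coefZ !coefXM /=.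
rewrite IH0 IH1 mulr0 addr0; split.
  by rewrite (E 0 (gauss rho b))// => w /IH[].
rewrite (E 1 (delsum sigma (gauss rho b))); last by move=> w /IH[].
have -> : delsum sigma (gauss rho b \o cons x) u =
    rho x *: delsum sigma (gauss rho b) u + delsum sigma (delsum (b x) (gauss rho b)) u.
  by rewrite -delsum_linr; apply: eq_delsum => w /=; exact: gauss_cons.
by rewrite delsumC -![_ *: _ : K^o]/(_ * _); ring.
Qed.

(** By symmetry only the first letter needs to be examined. *)
Lemma gauss_multilinear (K : comNzRingType) (V : lmodType K) (rho : V -> K) (b : V -> V -> K) :
  (forall x y, b x y = b y x) -> scalar rho -> (forall x, scalar (b x)) ->
  semimultilinear idfun (gauss rho b).
Proof.
move=> bC rl bl a u u' x y.
have E z : gauss rho b (u ++ z :: u') = gauss rho b (z :: u ++ u').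
  by apply: gauss_perm => //; apply/Permutation_sym/Permutation_middle.
rewrite !E !gauss_cons rl /=.
have -> : delsum (b (a *: x + y)) (gauss rho b) (u ++ u') =
    delsum (fun z => a * b x z + b y z) (gauss rho b) (u ++ u').
  by apply: eq_delsum_size => // z; rewrite bC bl ![b z _]bC.
by rewrite delsum_linl -![_ *: _ : K^o]/(_ * _); ring.
Qed.

(** * Gaussian moments of two powers *)
Section TwoPowers.
Context {C : numClosedFieldType} {V : Type}.
Variables (rho : V -> C) (b : V -> V -> C).
Local Notation G := (gauss rho b).

(** The contribution to the moment of v^m w^n of the pairings that link exactly r
    letters v with letters w, when such links have weight c: choose r letters on
    either side and a bijection between them; the other letters are paired
    within v^m and within w^n. *)
Definition mixed_term (c : C) v w m n r : C :=
  ('C(m, r) * 'C(n, r) * r`!)%:R * c ^+ r * (G (nseq (m - r) v) * G (nseq (n - r) w)).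

Lemma mixed_term_eq0 c v w m n r : (m < r)%N -> mixed_term c v w m n r = 0.
Proof. by move=> mr; rewrite /mixed_term bin_small// !mul0n !mul0r. Qed.

Lemma gauss_nseqS m n v w :
  G (nseq m.+1 v ++ nseq n w) = rho v * G (nseq m v ++ nseq n w) +
    m%:R * b v v * G (nseq m.-1 v ++ nseq n w) +
    n%:R * b v w * G (nseq m v ++ nseq n.-1 w).
Proof. by rewrite /= gauss_cons delsum_nseq addrA. Qed.

Lemma gauss_nseq1S m v : G (nseq m.+1 v) =
  rho v * G (nseq m v) + m%:R * b v v * G (nseq m.-1 v).
Proof.
by have := gauss_nseqS m 0 v v; rewrite !cats0 mul0r mul0r addr0.
Qed.

(** With the next lemma: removing one letter v, which is unpaired, or paired with
    another v, or with a w. *)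
Lemma mixed_termS0 c v w m n : mixed_term c v w m.+1 n 0 =
  rho v * mixed_term c v w m n 0 + m%:R * b v v * mixed_term c v w m.-1 n 0.
Proof. by rewrite /mixed_term !bin0 !subn0 gauss_nseq1S; ring. Qed.

Lemma mixed_termSS c v w m n s : mixed_term c v w m.+1 n s.+1 =
  rho v * mixed_term c v w m n s.+1 + m%:R * b v v * mixed_term c v w m.-1 n s.+1
  + n%:R * c * mixed_term c v w m n.-1 s.
Proof.
rewrite /mixed_term binS mulnDl mulnDl natrD !mulrDl subSS.
have -> : (n.-1 - s = n - s.+1)%N by lia.
congr (_ + _); last first.
  rewrite factS exprS.
  have /(congr1 (fun k : nat => k%:R : C)) := mul_bin_diag n s.
  move=> E; rewrite !natrM in E.
  transitivity (c * 'C(m, s)%:R * (s.+1%:R * 'C(n, s.+1)%:R) * (s`!)%:R * c ^+ s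
     * (G (nseq (m - s) v) * G (nseq (n - s.+1) w))); first by ring.
  by rewrite -E; ring.
have [ms|sm] := ltnP m s.+1.
  by rewrite (bin_small ms) (@bin_small m.-1); [ring|lia].
have -> : (m - s = (m - s.+1).+1)%N by lia.
rewrite gauss_nseq1S.
have -> : (m.-1 - s.+1 = (m - s.+1).-1)%N by lia.
have /(congr1 (fun k : nat => k%:R : C)) := mul_bin_down m s.+1.
move=> E; rewrite !natrM in E.
transitivity (rho v * ('C(m, s.+1)%:R * 'C(n, s.+1)%:R * (s.+1)`!%:R * c ^+ s.+1 *
   (G (nseq (m - s.+1) v) * G (nseq (n - s.+1) w))) +
   ((m - s.+1)%:R * 'C(m, s.+1)%:R) * b v v * ('C(n, s.+1)%:R * (s.+1)`!%:R * c ^+ s.+1 *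
   (G (nseq (m - s.+1).-1 v) * G (nseq (n - s.+1) w)))); first by ring.
by rewrite -E; ring.
Qed.

(** The coefficients of the identity
    exp(b(v + w, v + w) / 2) = exp(b(v, v) / 2) exp(b(v, w)) exp(b(w, w) / 2);
    proved by removing the letters v one by one. *)
Lemma gauss_two_powers v w m n N : (m < N)%N ->
  G (nseq m v ++ nseq n w) = \sum_(r < N) mixed_term (b v w) v w m n r.
Proof.
have [k] := ubnP m; elim: k m n N => // k IH [|m] n N mk.
  case: N => // N _; rewrite big_ord_recl big1 => [|i _]; last first.
    exact: mixed_term_eq0.
  by rewrite /mixed_term !bin0 !subn0 expr0 /= -[G [::]]/1 addr0 !mulr1 !mul1r.
case: N => // N; rewrite ltnS => mN.
rewrite gauss_nseqS big_ord_recl mixed_termS0.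
under eq_bigr do rewrite [lift _ _ : nat]/= /bump add1n mixed_termSS.
rewrite !big_split /= -!mulr_sumr -IH//.
rewrite addrA; congr (_ + _).
rewrite addrACA -!mulrDr.
have E (f : nat -> C) : f 0%N + \sum_(i < N) f i.+1 = \sum_(i < N.+1) f i.
  by rewrite big_ord_recl.
rewrite !(E (mixed_term _ _ _ _ _)) -IH//; [|lia..].
by case: m mk mN => [|m] mk mN; rewrite ?mul0r// -IH//; lia.
Qed.

Lemma ffact_add m t s : (m ^_ (t + s) = m ^_ t * (m - t) ^_ s)%N.
Proof.
elim: s => [|s IH]; first by rewrite addn0 ffactn0 muln1.
by rewrite addnS !ffactnSr IH mulnA subnDA.
Qed.

(** Among the t + s links between v^m and w^n, choose the t of weight a. *)
Lemma mixed_term_contract a v w m n t s :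
  t`!%:R^-1 * ((m ^_ t)%:R * (n ^_ t)%:R * a ^+ t) *
    mixed_term (b v w) v w (m - t) (n - t) s =
  ('C(m, t + s) * 'C(n, t + s) * (t + s)`!)%:R *
   (b v w ^+ s * a ^+ t *+ 'C(t + s, t)) *
   (G (nseq (m - (t + s)) v) * G (nseq (n - (t + s)) w)).
Proof.
rewrite /mixed_term -!subnDA -mulr_natr.
set P := G _ * G _; set x := b v w ^+ s; set y := a ^+ t.
have nz k : (k`!)%:R != 0 :> C by rewrite pnatr_eq0 -lt0n fact_gt0.
have E1 : (m ^_ t * 'C(m - t, s) * s`! = 'C(m, t + s) * (t + s)`!)%N.
  by rewrite -mulnA bin_ffact bin_ffact ffact_add.
have E2 : (n ^_ t * 'C(n - t, s) * s`! = 'C(n, t + s) * (t + s)`!)%N.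
  by rewrite -mulnA bin_ffact bin_ffact ffact_add.
have E3 : ('C(t + s, t) * (t`! * s`!) = (t + s)`!)%N.
  by rewrite -(bin_fact (leq_addr s t)) addKn.
move: E1 E2 E3 => /(congr1 (fun k : nat => k%:R : C)) + /(congr1 (fun k : nat => k%:R : C))
  + /(congr1 (fun k : nat => k%:R : C)).
move=> E1 E2 E3; rewrite !natrM in E1 E2 E3.
apply: (mulfI (nz t)); apply: (mulfI (nz s)).
transitivity (((m ^_ t)%:R * 'C(m - t, s)%:R * s`!%:R) *
  ((n ^_ t)%:R * 'C(n - t, s)%:R * s`!%:R) * (x * y * P)).
  by field.
rewrite E1 E2.
transitivity ('C(m, t + s)%:R * 'C(n, t + s)%:R * (t + s)`!%:R *
 ('C(t + s, t)%:R * (t`!%:R * s`!%:R)) * (x * y * P)); last by ring.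
by rewrite E3; ring.
Qed.

Lemma sum_triangle (f : nat -> nat -> C) N :
  \sum_(t < N) \sum_(s < N - t) f t s = \sum_(r < N) \sum_(t < r.+1) f t (r - t)%N.
Proof.
elim: N => [|N IH]; first by rewrite !big_ord0.
rewrite big_ord_recr [RHS]big_ord_recr /= -IH subSnn big_ord1.
rewrite [\sum_(t < N.+1) f t (N - t)%N]big_ord_recr /= subnn addrA; congr (_ + _).
rewrite -big_split /=; apply: eq_bigr => t _.
by rewrite subSn ?big_ord_recr//= ltnW// ltn_ord.
Qed.

(** The coefficients of exp(a) exp(b(v, w)) = exp(a + b(v, w)): the t-fold
    contractions of the star product, of weight a, merge with the links of weight
    b(v, w) of the Gaussian moments by the binomial theorem. *)
Lemma mixed_term_shift a v w m n N : (m < N)%N ->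
  \sum_(t < N) t`!%:R^-1 * ((m ^_ t)%:R * (n ^_ t)%:R * a ^+ t) *
    G (nseq (m - t) v ++ nseq (n - t) w) =
  \sum_(r < N) mixed_term (a + b v w) v w m n r.
Proof.
move=> mN.
transitivity (\sum_(t < N) \sum_(s < N - t)
  t`!%:R^-1 * ((m ^_ t)%:R * (n ^_ t)%:R * a ^+ t) *
    mixed_term (b v w) v w (m - t) (n - t) s).
  apply: eq_bigr => t _; rewrite -mulr_sumr.
  have [tm|mt] := leqP t m; last by rewrite ffact_small// !mul0r mulr0 !mul0r.
  by rewrite (@gauss_two_powers _ _ _ _ (N - t))//; lia.
rewrite (sum_triangle (fun t s => t`!%:R^-1 * ((m ^_ t)%:R * (n ^_ t)%:R * a ^+ t) *
    mixed_term (b v w) v w (m - t) (n - t) s)).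
apply: eq_bigr => r _; rewrite /mixed_term [a + _]addrC exprDn.
rewrite mulr_sumr mulr_suml; apply: eq_bigr => -[t /= tr] _.
by rewrite mixed_term_contract subnKC.
Qed.

End TwoPowers.

(** * Polarization *)
Lemma span_range {K : nzRingType} {M : lmodType K} {I : Type} (g : I -> M) X :
  span_of (range g) X -> exists s : seq (K * I), X = \sum_(p <- s) p.1 *: g p.2.
Proof.
elim=> [|a x y [i _ <-] _ [s ->]]; first by exists [::]; rewrite big_nil.
by exists ((a, i) :: s); rewrite big_cons.
Qed.

Lemma span_sum {K : nzRingType} {M : lmodType K} (S : set M) I (s : seq I) (P : pred I) (F : I -> M) :
  (forall i, P i -> span_of S (F i)) -> span_of S (\sum_(i <- s | P i) F i).
Proof.
move=> SF; elim/big_ind: _ => //; first exact: span_of0.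
by move=> x y Sx Sy; rewrite -[x]scale1r; exact: span_of_lin.
Qed.

Lemma span_scale {K : nzRingType} {M : lmodType K} (S : set M) a X :
  span_of S X -> span_of S (a *: X).
Proof. by move=> SX; rewrite -[_ *: _]addr0; apply: span_of_lin => //; exact: span_of0. Qed.

Lemma perm_eq_Permutation (T : eqType) (s t : seq T) :
  perm_eq s t -> Permutation s t.
Proof.
elim: s t => [|x s IH] t; first by move/perm_size/esym/size0nil ->; constructor.
move=> st; have xt : x \in t by rewrite -(perm_mem st) mem_head.
case/splitPr: xt st => t1 t2 st.
apply: Permutation_trans (Permutation_middle _ _ _); apply: perm_skip; apply: IH.
by move: st; rewrite perm_sym perm_catC /= perm_cons perm_catC perm_sym.
Qed.

Lemma multilinear_sum_head {K : comNzRingType} {V W : lmodType K} (F : seq V -> W)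
    I (s : seq I) P (g : I -> V) u : semimultilinear idfun F ->
  F ((\sum_(i <- s | P i) g i) :: u) = \sum_(i <- s | P i) F (g i :: u).
Proof.
by move=> Fl; apply: (@lin_sum K V W (fun x => F (x :: u))) => a x y; exact: (Fl a [::]).
Qed.

Lemma multilinear_power {K : comNzRingType} {V W : lmodType K} (F : seq V -> W)
    (I : finType) (P : pred I) (g : I -> V) m : semimultilinear idfun F ->
  F (nseq m (\sum_(i | P i) g i)) =
  \sum_(t : m.-tuple I | all P t) F [seq g i | i <- t].
Proof.
elim: m F => [|m IH] F Fl.
  by rewrite (big_pred1 [tuple]) // => t; rewrite tuple0.
rewrite multilinear_sum_head//.
under eq_bigr => i Pi.
  rewrite -[F _]/((F \o cons (g i)) _) IH; last exact: semimultilinear_cons.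
  over.
rewrite pair_big_dep (reindex (fun t : m.+1.-tuple I => (thead t, behead_tuple t))) /=.
  by apply: eq_big => t; case/tupleP: t => i t; rewrite theadE.
exists (fun p : I * m.-tuple I => [tuple of p.1 :: p.2]) => [t _|[i t] _] /=.
  by rewrite -tuple_eta.
by congr pair; apply/val_inj.
Qed.

(** Inclusion-exclusion: the subsets A that contain the entries of t cancel in
    pairs under toggling an index i that t misses. *)
Lemma sum_sign_superset (K : numDomainType) n (t : seq 'I_n) :
  \sum_(A : {set 'I_n} | all (mem A) t) (-1) ^+ #|A| =
  if [forall i, i \in t] then (-1) ^+ n else 0 :> K.
Proof.
have [/forallP tall|] := ifPn.
  rewrite (big_pred1 [set: 'I_n]%SET) ?cardsT ?card_ord// => A.
  apply/idP/eqP => [/allP At|->]; last by apply/allP => i; rewrite inE.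
  by apply/setP => i; rewrite inE; exact/At/tall.
rewrite negb_forall => /existsP[i it].
set S := \sum_(A | _) _; suff : S = - S.
  by move=> /eqP; rewrite -addr_eq0 -mulr2n mulrn_eq0 => /orP[//|/eqP].
pose tog (A : {set 'I_n}) := if i \in A then A :\ i else i |: A.
have togK : involutive tog.
  move=> A; rewrite /tog; have [iA|iA] := boolP (i \in A).
    by rewrite finset.setD11 finset.setD1K.
  by rewrite finset.setU11 finset.setU1K.
rewrite {1}/S (reindex_inj (inv_inj togK)) -sumrN; apply: eq_big => A.
  apply: eq_in_all => j jt; have ji : j != i by apply: contraNneq it => <-.
  by rewrite /tog; case: ifP => _; rewrite !inE (negbTE ji).
move=> _; rewrite /tog; case: ifPn => iA.
  by rewrite [in RHS](cardsD1 i A) iA exprS mulN1r opprK.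
by rewrite cardsU1 iA exprS mulN1r.
Qed.

Section Powers.
Context {C : numClosedFieldType} {V : lmodType C}.

(** The tensor v (x) ... (x) v; the pair (degree, letter) is a single argument so
    that the powers are the range of a function. *)
Definition power (p : nat * V) : talg V := word (nseq p.1 p.2).

(** An n-tuple of indices below n in which every index occurs is a permutation. *)
Lemma sum_covering_tuple (W : lmodType C) n (F : seq 'I_n -> W) :
  \sum_(t : n.-tuple 'I_n | [forall i, i \in t]) F t =
  \sum_(s : 'S_n) F [seq s i | i <- enum 'I_n].
Proof.
pose h (s : 'S_n) : n.-tuple 'I_n := [tuple s i | i < n].
pose h' (t : n.-tuple 'I_n) : 'S_n := insubd (1%g : 'S_n) (finfun (tnth t)).
rewrite (reindex_onto h h') => [|t /forallP tall]; last first.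
  apply: eq_from_tnth => i; rewrite tnth_mktuple -pvalE -[pval _]/(val _).
  rewrite insubdK ?ffunE//; apply/injectiveP => j k; rewrite !ffunE.
  move: j k; apply/tuple_uniqP; apply: (leq_size_uniq (enum_uniq 'I_n)) => //.
  by rewrite size_tuple size_enum_ord.
rewrite big_mkcond [RHS]big_mkcond; apply: eq_bigr => s _ /=.
have -> : [forall i, i \in h s].
  apply/forallP => i; apply/tnthP; exists (s^-1 i)%g.
  by rewrite tnth_mktuple permKV.
have -> : h' (h s) = s.
  apply: val_inj; rewrite insubdK; apply/ffunP || apply/injectiveP.
    by move=> i; rewrite ffunE tnth_mktuple -pvalE.
  by move=> i j; rewrite !ffunE !tnth_mktuple => /perm_inj.
by rewrite eqxx.
Qed.

(** Polarization:
    sum_s x_s(1) (x) ... (x) x_s(n) = sum_A (-1)^(n - #A) (sum_(i in A) x_i)^n.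
    Expanding the powers on the right, the coefficient of the word of an index
    tuple is a signed sum over the sets that contain the tuple; it vanishes
    unless all indices occur. *)
Lemma Sym_word_power u : span_of (range power) (Sym_word u).
Proof.
rewrite /Sym_word; apply: span_scale; set n := size u.
have -> : \sum_(s : 'S_n) word (perm_word s u) = \sum_(A : {set 'I_n})
    ((-1) ^+ n * (-1) ^+ #|A|) *: power (n, \sum_(i in A) u`_i).
  under [RHS]eq_bigr => A _ do rewrite /power/=
    (multilinear_power _ _ _ word_multilinear) scaler_sumr.
  rewrite (exchange_big_dep predT)//=.
  under eq_bigr => t _ do rewrite -scaler_suml -mulr_sumr sum_sign_superset.
  pose F := fun s : seq 'I_n => word [seq u`_(nat_of_ord i) | i <- s] : talg V.
  transitivity (\sum_(t : n.-tuple 'I_n | [forall i, i \in t]) F t).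
    rewrite sum_covering_tuple; apply: eq_bigr => s _.
    by rewrite /F /perm_word -[in RHS]map_comp.
  rewrite big_mkcond; apply: eq_bigr => t _; case: ifP => _.
    by rewrite -exprMn mulrNN mulr1 expr1n scale1r.
  by rewrite mulr0 scale0r.
apply: span_sum => A _; apply: span_scale; rewrite -[power _]scale1r -[_ *: _]addr0.
by apply: span_of_comb; [eexists|exact: span_of0].
Qed.

Lemma Sym_span X : span_of (range power) (Sym X).
Proof.
elim/(@talg_ind C V): X => [|a u X IH]; first by rewrite (lin0 Sym_linear); exact: span_of0.
rewrite Sym_linear SymE; apply: span_of_lin => //; exact: Sym_word_power.
Qed.

Lemma symmetric_powers X : X \in symmetric_tensor V ->
  exists s : seq (C * (nat * V)), X = \sum_(p <- s) p.1 *: power p.2.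
Proof. by move=> /set_mem[Y _ <-]; exact: span_range (Sym_span Y). Qed.

Lemma talg_words (X : talg V) :
  exists s : seq (C * seq V), X = \sum_(p <- s) p.1 *: word p.2.
Proof.
have : span_of (range (@word C V)) X; last exact: span_range.
elim/(@talg_ind C V): X => [|a u X]; first exact: span_of0.
by apply: span_of_comb; exists u.
Qed.

Lemma perm_word_Permutation (u : seq V) (s : 'S_(size u)) :
  Permutation (perm_word s u) u.
Proof.
have uE : u = [seq u`_(nat_of_ord i) | i <- enum 'I_(size u)].
  by rewrite (map_comp (nth 0 u) val) val_enum_ord map_nth_iota0 ?take_size.
rewrite [X in Permutation _ X]uE /perm_word.
rewrite (map_comp (fun i : 'I_(size u) => u`_i) s).
apply: Permutation_map; apply: perm_eq_Permutation.
apply: uniq_perm; last 1 first.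
- move=> i; rewrite mem_enum; apply/mapP; exists (s^-1 i)%g; first by rewrite mem_enum.
  by rewrite permKV.
- by rewrite map_inj_uniq ?enum_uniq//; exact: perm_inj.
- exact: enum_uniq.
Qed.

End Powers.

(** * Positivity of the Gaussian functionals for the star product *)
Section GaussFunctional.
Context {C : numClosedFieldType} {V : lmodType C}.
Variables (rho : V -> C) (b : V -> V -> C).
Hypotheses (bC : forall x y, b x y = b y x) (rl : scalar rho) (bl : forall x, scalar (b x)).

Definition gaussian : talg V -> C^o := talg_lift (gauss rho b : seq V -> C^o).

Let gml := gauss_multilinear bC rl bl.

Lemma gaussian_linear : linear gaussian.
Proof. exact: (talg_lift_linear gml). Qed.

Lemma gaussianE u : gaussian (word u) = gauss rho b u.
Proof. exact: (talg_liftE _ gml). Qed.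

Lemma gaussian_Sym X : gaussian (Sym X) = gaussian X.
Proof.
elim/(@talg_ind C V): X => [|a u X IH].
  by rewrite (lin0 Sym_linear).
rewrite Sym_linear !gaussian_linear IH; congr (_ + _); congr (_ *: _).
rewrite SymE /Sym_word (linZ gaussian_linear) (lin_sum gaussian_linear).
under eq_bigr => s _ do rewrite gaussianE (gauss_perm _ bC (perm_word_Permutation s)).
rewrite sumr_const card_Sn gaussianE -[gauss _ _ _ *+ _]mulr_natl.
by apply: mulKf; rewrite pnatr_eq0 -lt0n fact_gt0.
Qed.

End GaussFunctional.

Section StarPowers.
Context {C : numClosedFieldType} {V : lmodType C}.
Variable L : V -> V -> C.
Hypothesis L_bilin : bilinear_form L.

Lemma talg_mul_linl Y : linear (fun X : talg V => talg_mul X Y).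
Proof.
move=> a x y; exact: (talg_slift2_linl (s := idfun) word_cat_linl word_cat_linr).
Qed.

Lemma talg_mul_linr X : linear (@talg_mul C V X).
Proof. exact: (talg_slift2_linr (s := idfun) word_cat_linl word_cat_linr). Qed.

Lemma talg_mul_word u w : talg_mul (word u) (word w) = word (u ++ w) :> talg V.
Proof. exact: (talg_slift2E (s := idfun) word_cat_linl word_cat_linr). Qed.

Lemma mu_vee_lin : linear (@mu_vee C V).
Proof.
apply: tensor_lift_linear => Z a x y; first by rewrite talg_mul_linl Sym_linear.
by rewrite talg_mul_linr Sym_linear.
Qed.

Lemma mu_vee_tens X Y : mu_vee (tens X Y) = Sym (talg_mul X Y) :> talg V.
Proof.
apply: tensor_liftE => Z a x y; first by rewrite talg_mul_linl Sym_linear.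
by rewrite talg_mul_linr Sym_linear.
Qed.

Lemma contract_powers k l v w :
  contract L (tens (power (k, v)) (power (l, w))) =
  (k%:R * l%:R * L v w) *: tens (power (k.-1, v)) (power (l.-1, w)).
Proof.
rewrite (contract_tens_word L_bilin); case: k => [|k]; first by rewrite !mul0r scale0r.
case: l => [|l]; first by rewrite mulr0 mul0r scale0r; case: nseq.
have -> : nseq k.+1 v = rcons (nseq k v) v by elim: k => //= k ->.
by rewrite contract_word_rcons !size_nseq.
Qed.

Lemma iter_contract_powers t k l v w :
  iter t (contract L) (tens (power (k, v)) (power (l, w))) =
  ((k ^_ t)%:R * (l ^_ t)%:R * L v w ^+ t) *:
    tens (power ((k - t)%N, v)) (power ((l - t)%N, w)).
Proof.
elim: t => [|t IH]; first by rewrite !ffactn0 !subn0 !mulr1 scale1r.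
rewrite iterS IH (linZ (contract_linear L_bilin)) contract_powers scalerA !subnS.
by congr (_ *: _); rewrite !ffactnSr !natrM exprS; ring.
Qed.

(** The star product is a sum over all t of which finitely many terms are
    nonzero, but their number depends on the factors; cut at a fixed N, the sum
    is bilinear. *)
Definition star_trunc N (X Y : talg V) : talg V :=
  \sum_(t < N) t`!%:R^-1 *: mu_vee (iter t (contract L) (tens X Y)).

Lemma star_truncE X Y : exists N0, forall N, (N0 <= N)%N -> star L X Y = star_trunc N X Y.
Proof.
have [N0 N0P] := iter_contract_eq0 L_bilin X Y.
exists N0 => N N0N; rewrite /star_trunc.
rewrite (fsbig_ord _ N (fun t => t`!%:R^-1 *: mu_vee (iter t (contract L) (tens X Y)))).
rewrite /star; apply/esym/fsbig_widen => // t [_ /= /negP]; rewrite -leqNgt => Nt.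
by rewrite N0P ?(leq_trans N0N)// (lin0 mu_vee_lin) scaler0.
Qed.

Lemma iter_contract_linear t : linear (iter t (contract L)).
Proof. by elim: t => // t IH a x y; rewrite !iterS IH (contract_linear L_bilin). Qed.

Lemma star_trunc_linl N Y : linear (fun X => star_trunc N X Y).
Proof.
move=> a x y; rewrite /star_trunc scaler_sumr -big_split /=; apply: eq_bigr => t _.
by rewrite tens_linl iter_contract_linear mu_vee_lin scalerDr !scalerA [_ * a]mulrC.
Qed.

Lemma star_trunc_linr N X : linear (star_trunc N X).
Proof.
move=> a x y; rewrite /star_trunc scaler_sumr -big_split /=; apply: eq_bigr => t _.
by rewrite tens_linr iter_contract_linear mu_vee_lin scalerDr !scalerA [_ * a]mulrC.
Qed.

Section Positivity.
Variables (rho : V -> C) (b : V -> V -> C).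
Hypotheses (bC : forall x y, b x y = b y x) (rl : scalar rho) (bl : forall x, scalar (b x)).

(** The t-fold contraction of v^k and w^l is Lambda(v, w)^t v^(k-t) (x) w^(l-t)
    up to a factor, so mixed_term_shift with a = Lambda(v, w) applies. *)
Lemma gaussian_star_powers N k l v w : (k < N)%N ->
  gaussian rho b (star_trunc N (power (k, v)) (power (l, w))) =
  \sum_(r < N) mixed_term rho b (L v w + b v w) v w k l r.
Proof.
move=> kN; rewrite (lin_sum (gaussian_linear bC rl bl)).
rewrite -mixed_term_shift//; apply: eq_bigr => t _.
rewrite (linZ (gaussian_linear bC rl bl)) iter_contract_powers (linZ mu_vee_lin).
rewrite (linZ (gaussian_linear bC rl bl)) mu_vee_tens gaussian_Sym// talg_mul_word.
by rewrite gaussianE// -[LHS]/(_ * (_ * _)) mulrA.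
Qed.

Variable conjV : V -> V.
Hypothesis cV : linear_for (Num.conj_op \; *:%R) conjV.
Hypothesis rho_real : forall v, rho (conjV v) = (rho v)^*.
Hypothesis b_real : forall v w, b (conjV v) (conjV w) = (b v w)^*.
Hypothesis H_psd : psd (fun v w => L (conjV v) w + b (conjV v) w).

Lemma gauss_conj u : gauss rho b (map conjV u) = (gauss rho b u)^*.
Proof.
rewrite gauss_map -[RHS]/(Num.conj_op _) gauss_morph; apply: eq_gauss => [x|x y] //=.
Qed.

Lemma invol_power k v : talg_invol conjV (power (k, v)) = power (k, conjV v).
Proof.
rewrite /talg_invol (talg_sliftE (s := Num.conj_op) (invol_word_semimultilinear cV)).
by rewrite /power /= map_nseq rev_nseq.
Qed.

Lemma invol_comb (s : seq (C * (nat * V))) :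
  talg_invol conjV (\sum_(p <- s) p.1 *: power p.2) =
  \sum_(p <- s) p.1^* *: power (p.2.1, conjV p.2.2).
Proof.
have lin a x y : talg_invol conjV (a *: x + y) =
    a^* *: talg_invol conjV x + talg_invol conjV y.
  exact: (talg_slift_lin (s := Num.conj_op) (invol_word_semimultilinear cV)).
have z0 : talg_invol conjV 0 = 0.
  by have := lin (-1) 0 0; rewrite rmorphN1 !scaleN1r addNr => ->; rewrite addNr.
elim: s => [|[a [k v]] s IH]; first by rewrite !big_nil.
by rewrite !big_cons lin IH invol_power.
Qed.

(** For X = sum_p a_p v_p^(k_p) the value at X^* * X is a sum over r of the
    kernels r! conj(z_p) z_q H(v_p, v_q)^r, where z_p collects the factors of the
    mixed terms that depend on p alone. By psdX and psdM these kernels are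
    positive semidefinite. *)
Lemma gaussian_positive X : X \in symmetric_tensor V ->
  0 <= gaussian rho b (star L (talg_invol conjV X) X).
Proof.
move=> /symmetric_powers[s ->]; rewrite invol_comb.
have [N0 N0P] := star_truncE (\sum_(p <- s) p.1^* *: power (p.2.1, conjV p.2.2))
  (\sum_(p <- s) p.1 *: power p.2).
pose N := (maxn N0 (\max_(p <- s) p.2.1).+1).
rewrite (N0P N) ?leq_maxl//.
have sN p : p \in s -> (p.2.1 < N)%N.
  move=> ps; apply: leq_trans (leq_maxr _ _); rewrite ltnS.
  exact: (@leq_bigmax_seq _ s xpredT (fun p : C * (nat * V) => p.2.1) p ps isT).
have -> : gaussian rho b (star_trunc N (\sum_(p <- s) p.1^* *: power (p.2.1, conjV p.2.2))
    (\sum_(p <- s) p.1 *: power p.2)) =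
  \sum_(p <- s) \sum_(q <- s) p.1^* * q.1 *
    \sum_(r < N) mixed_term rho b (L (conjV p.2.2) q.2.2 + b (conjV p.2.2) q.2.2)
      (conjV p.2.2) q.2.2 p.2.1 q.2.1 r.
  rewrite (lin_sum (star_trunc_linl N _)) (lin_sum (gaussian_linear bC rl bl)).
  rewrite big_seq [RHS]big_seq; apply: eq_bigr => -[a [k v]] ps.
  rewrite (linZ (star_trunc_linl N _)) (lin_sum (star_trunc_linr N _)).
  rewrite (linZ (gaussian_linear bC rl bl)) (lin_sum (gaussian_linear bC rl bl)).
  rewrite scaler_sumr; apply: eq_bigr => -[a' [l w]] _.
  rewrite (linZ (star_trunc_linr N _)) (linZ (gaussian_linear bC rl bl)) scalerA.
  by rewrite gaussian_star_powers ?(sN _ ps).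
pose K r (p q : C * (nat * V)) : C := r`!%:R * (
  (p.1 * ('C(p.2.1, r)%:R * gauss rho b (nseq (p.2.1 - r) p.2.2)))^* *
  (q.1 * ('C(q.2.1, r)%:R * gauss rho b (nseq (q.2.1 - r) q.2.2))) *
  (L (conjV p.2.2) q.2.2 + b (conjV p.2.2) q.2.2) ^+ r).
have Kpsd r : psd (K r).
  apply: psdZ; first exact: ler0n.
  apply: psdM.
    exact: (psd_rank1 (fun p : C * (nat * V) => p.1 * ('C(p.2.1, r)%:R * gauss rho b (nseq (p.2.1 - r) p.2.2)))).
  apply: psdX; exact: (psd_pull (fun p : C * (nat * V) => p.2.2) H_psd).
have -> : \sum_(p <- s) \sum_(q <- s) p.1^* * q.1 *
    \sum_(r < N) mixed_term rho b (L (conjV p.2.2) q.2.2 + b (conjV p.2.2) q.2.2)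
      (conjV p.2.2) q.2.2 p.2.1 q.2.1 r =
  \sum_(r < N) \sum_(p <- s) \sum_(q <- s) K r p q.
  under eq_bigr do under eq_bigr do rewrite mulr_sumr.
  under eq_bigr do rewrite exchange_big /=.
  rewrite exchange_big /=; apply: eq_bigr => r _; apply: eq_bigr => p _.
  apply: eq_bigr => q _; rewrite /K /mixed_term -map_nseq gauss_conj.
  rewrite !natrM !(rmorphM (Num.conj_op : {rmorphism C -> C})) rmorph_nat /=; ring.
apply: sumr_ge0 => r _; rewrite big_tnth; under eq_bigr do rewrite big_tnth.
have := (Kpsd r).2 _ (fun=> 1) (tnth (in_tuple s)).
congr (0 <= _); apply: eq_bigr => i _; apply: eq_bigr => j _.
by rewrite -[_^*]/(1^*) conjC1 !mul1r.
Qed.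

End Positivity.
End StarPowers.

(** * The Gaussian functionals separate symmetric tensors *)
Lemma natmul_roots_eq0 (R : numDomainType) (P : {poly R}) :
  (forall n : nat, P.[n%:R] = 0) -> P = 0.
Proof.
move=> PN; apply: (@roots_geq_poly_eq0 _ P [seq n%:R | n <- iota 0 (size P)]).
- by apply/allP => _ /mapP[n _ ->]; apply/eqP/PN.
- by rewrite map_inj_uniq ?iota_uniq// => m n /eqP; rewrite eqr_nat => /eqP.
- by rewrite size_map size_iota.
Qed.

Section Annihilation.
Context {C : numClosedFieldType} {V : lmodType C}.
Implicit Types (sigma : V -> C) (X Y : talg V).

(** The annihilation operator: contraction with sigma at all positions. *)
Definition annih sigma : talg V -> talg V :=
  talg_lift (delsum sigma (@word C V)).

Lemma annih_linear sigma : scalar sigma -> linear (annih sigma).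
Proof. by move=> sl; exact: (talg_lift_linear (delsum_multilinear sl word_multilinear)). Qed.

Lemma annih_word sigma u : scalar sigma -> annih sigma (word u) = delsum sigma (@word C V) u.
Proof. by move=> sl; exact: (talg_liftE _ (delsum_multilinear sl word_multilinear)). Qed.

Lemma annih_power sigma k v : scalar sigma ->
  annih sigma (power (k, v)) = (k%:R * sigma v) *: power (k.-1, v).
Proof.
move=> sl; rewrite annih_word//=.
have := delsum_nseq sigma (@word C V) k 0 v v.
by rewrite !cats0 mul0r scale0r addr0.
Qed.

(** On symmetric tensors all positions contribute equally, so that annih may be
    replaced by the contraction of the first letter, times the degree: the first
    letter is a tensor factor V to which separation of points applies. *)
Definition head_contract_word sigma (u : seq V) : talg V :=
  if u is x :: u' then ((size u)%:R * sigma x) *: word u' else 0.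

Definition head_contract sigma : talg V -> talg V :=
  talg_lift (head_contract_word sigma).

Lemma head_contract_multilinear sigma : scalar sigma ->
  semimultilinear idfun (head_contract_word sigma).
Proof.
move=> sl a [|z u] u' x y /=.
  by rewrite sl mulrDr scalerDl scalerA mulrCA.
by rewrite !size_cat /= word_multilinear scalerDr !scalerA [_ * a]mulrC.
Qed.

Lemma head_contract_linear sigma : scalar sigma -> linear (head_contract sigma).
Proof. by move=> sl; exact: (talg_lift_linear (head_contract_multilinear sl)). Qed.

Lemma head_contractE sigma u : scalar sigma ->
  head_contract sigma (word u) = head_contract_word sigma u.
Proof. by move=> sl; exact: (talg_liftE _ (head_contract_multilinear sl)). Qed.

Lemma annih_symmetric sigma X : scalar sigma -> span_of (range power) X ->
  annih sigma X = head_contract sigma X.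
Proof.
move=> sl; elim=> [|a x y [[k v] _ <-] _ IH].
  by rewrite (lin0 (annih_linear sl)) (lin0 (head_contract_linear sl)).
rewrite (annih_linear sl) (head_contract_linear sl) IH; congr (_ *: _ + _).
rewrite annih_power// head_contractE//; case: k => [|k] /=.
  by rewrite mul0r scale0r.
by rewrite size_nseq.
Qed.

Lemma annih_span sigma X : scalar sigma -> span_of (range power) X ->
  span_of (range power) (annih sigma X).
Proof.
move=> sl; elim=> [|a x y [[k v] _ <-] _ IH].
  by rewrite (lin0 (annih_linear sl)); exact: span_of0.
rewrite (annih_linear sl) annih_power//; apply: span_of_lin => //.
apply: span_scale; rewrite -[power _]scale1r -[_ *: _]addr0.
by apply: span_of_comb; [eexists|exact: span_of0].
Qed.

(** Multiplication by v on the left, divided by the degree of the result so that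
    head_contract_prepend has no factor. *)
Definition prepend_word v (u : seq V) : talg V := (size u).+1%:R^-1 *: word (v :: u).

Definition prepend v : talg V -> talg V := talg_lift (prepend_word v).

Lemma prepend_multilinear v : semimultilinear idfun (prepend_word v).
Proof.
move=> a u u' x y; rewrite /prepend_word !size_cat /=.
have -> : word (v :: u ++ (a *: x + y) :: u') =
    a *: word (v :: u ++ x :: u') + word (v :: u ++ y :: u').
  exact: (word_multilinear a (v :: u)).
rewrite scalerDr !scalerA; congr (_ *: _ + _); exact: mulrC.
Qed.

Lemma prepend_linear v : linear (prepend v).
Proof. exact: (talg_lift_linear (@prepend_multilinear v)). Qed.

Lemma prependE v u : prepend v (word u) = prepend_word v u.
Proof. exact: (talg_liftE _ (@prepend_multilinear v)). Qed.

Lemma prepend_linl a v w Y : prepend (a *: v + w) Y = a *: prepend v Y + prepend w Y.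
Proof.
elim/(@talg_ind C V): Y => [|c u Y IH].
  by rewrite !(lin0 (prepend_linear _)) scaler0 addr0.
rewrite !prepend_linear IH !prependE /prepend_word.
have -> : word ((a *: v + w) :: u) = a *: word (v :: u) + word (w :: u).
  exact: (word_multilinear a [::]).
rewrite !scalerDr !scalerA.
rewrite addrACA; congr (_ *: _ + _ + _); ring.
Qed.

Lemma head_contract_prepend sigma v Y : scalar sigma ->
  head_contract sigma (prepend v Y) = sigma v *: Y.
Proof.
move=> sl; elim/(@talg_ind C V): Y => [|c u Y IH].
  by rewrite (lin0 (prepend_linear _)) (lin0 (head_contract_linear sl)) scaler0.
rewrite prepend_linear (head_contract_linear sl) IH prependE scalerDr; congr (_ + _).
rewrite (linZ (head_contract_linear sl)) head_contractE//= !scalerA.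
by rewrite -?mulrA mulKf ?pnatr_eq0// mulrC.
Qed.

Lemma prepend_decomp X : exists (c : C) (s : seq (V * talg V)),
  X = c *: word [::] + \sum_(p <- s) prepend p.1 p.2.
Proof.
elim/(@talg_ind C V): X => [|a [|v u] X [c [s ->]]].
- by exists 0, [::]; rewrite big_nil scale0r addr0.
- by exists (a + c), s; rewrite addrA -scalerDl.
exists c, ((v, (a * (size u).+1%:R) *: word u) :: s); rewrite big_cons /= addrCA.
congr (_ + _); rewrite (linZ (prepend_linear v)) prependE scalerA mulfK ?pnatr_eq0//.
Qed.

End Annihilation.

Section BilinearSeparation.
Context {K : fieldType} {V W U : lmodType K} (B : V -> W -> U).
Hypothesis Bl : forall w, linear (B^~ w).
Hypothesis Br : forall v, linear (B v).
Variable F : (V -> K) -> Prop.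
Hypothesis F_scalar : forall sigma, F sigma -> scalar sigma.
Hypothesis F_sep : forall v, (forall sigma, F sigma -> sigma v = 0) -> v = 0.

(** Linear forms that separate V also separate the first factor of a tensor
    product. If v is the first vector of the sum and sigma v <> 0, the hypothesis
    at sigma expresses the companion Y of v by those of the other terms;
    substituting it leaves a shorter sum that satisfies the hypothesis. *)
Lemma bilinear_sum_eq0 (s : seq (V * W)) :
  (forall sigma, F sigma -> \sum_(p <- s) sigma p.1 *: p.2 = 0) ->
  \sum_(p <- s) B p.1 p.2 = 0.
Proof.
have [n] := ubnP (size s); elim: n s => // n IH [|[v Y] s] /= sn s0.
  by rewrite big_nil.
have [v0|vN0] := EM (v = 0).
  rewrite big_cons /= v0 (lin0 (Bl Y)) add0r; apply: IH => // sigma Fs.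
  by have := s0 _ Fs; rewrite big_cons /= v0 (scalar0 (F_scalar Fs)) scale0r add0r.
have [sigma Fs sv] : exists2 sigma, F sigma & sigma v != 0.
  apply: contrapT => H; apply: vN0; apply: F_sep => sigma Fs.
  by apply: contrapT => /eqP sv; apply: H; exists sigma.
have YE : Y = - \sum_(p <- s) (sigma p.1 / sigma v) *: p.2.
  have /eqP := s0 _ Fs; rewrite big_cons /= addr_eq0 => /eqP vY.
  apply: (scalerI sv); rewrite vY scalerN scaler_sumr.
  congr (- _); apply: eq_bigr => p _; rewrite scalerA; congr (_ *: _).
  by rewrite mulrCA divff// mulr1.
pose s' := [seq (- (sigma p.1 / sigma v) *: v + p.1, p.2) | p <- s].
have s'E (H : lmodType K) (A : V -> W -> H) : (forall w, linear (A^~ w)) ->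
    linear (A v) -> \sum_(p <- s') A p.1 p.2 = A v Y + \sum_(p <- s) A p.1 p.2.
  move=> Al Ar; rewrite YE -scaleN1r (linZ Ar) (lin_sum Ar) scaler_sumr -big_split /=.
  rewrite big_map; apply: eq_bigr => p _ /=.
  by rewrite (Al p.2) (linZ Ar) scalerA mulN1r.
have /IH : (size s' < n)%N by rewrite size_map.
rewrite s'E// big_cons; apply=> tau Ft; rewrite (s'E W (fun x y => tau x *: y)).
- by have := s0 _ Ft; rewrite big_cons.
- by move=> w a x y /=; rewrite (F_scalar Ft) scalerDl scalerA.
- by move=> a x y; rewrite scalerDr !scalerA mulrC.
Qed.

End BilinearSeparation.

Section Separation.
Context {C : numClosedFieldType} {V : lmodType C}.
Implicit Types (sigma : V -> C) (X Y : talg V).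
Variable F : (V -> C) -> Prop.
Hypothesis F_scalar : forall sigma, F sigma -> scalar sigma.
Hypothesis F_sep : forall v, (forall sigma, F sigma -> sigma v = 0) -> v = 0.

Lemma head_contract_eq0 X :
  (forall sigma, F sigma -> head_contract sigma X = 0) -> exists c, X = c *: word [::].
Proof.
have [c [s ->]] := prepend_decomp X => H; exists c.
have Bl w : linear ((@prepend C V)^~ w) by move=> a x y; exact: prepend_linl.
rewrite (bilinear_sum_eq0 Bl (@prepend_linear C V) F_scalar F_sep) ?addr0//.
move=> sigma Fs; have sl := F_scalar Fs.
have := H _ Fs; rewrite (linD (head_contract_linear sl)) (linZ (head_contract_linear sl)).
rewrite head_contractE//= scaler0 add0r (lin_sum (head_contract_linear sl)) => E.
by rewrite -[RHS]E; apply: eq_bigr => p _; rewrite head_contract_prepend.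
Qed.

(** This bound on the degree is the one that the induction on X uses, and it
    needs no decomposition of X into homogeneous components. *)
Fixpoint nilp n X : Prop :=
  if n is n'.+1 then forall sigma, F sigma -> nilp n' (annih sigma X) else X = 0.

Lemma nilp_lin n a X Y : nilp n X -> nilp n Y -> nilp n (a *: X + Y).
Proof.
elim: n X Y => [|n IH] X Y /=; first by move=> -> ->; rewrite scaler0 addr0.
move=> HX HY sigma Fs; rewrite (annih_linear (F_scalar Fs)).
by apply: IH; [exact: HX|exact: HY].
Qed.

Lemma nilp0 n : nilp n 0.
Proof. by elim: n => //= n IH sigma Fs; rewrite (lin0 (annih_linear (F_scalar Fs))). Qed.

Lemma nilp_word n u : (size u < n)%N -> nilp n (word u).
Proof.
elim: n u => // n IH u un sigma Fs; rewrite (annih_word _ (F_scalar Fs)).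
have : forall w, (size w).+1 = size u -> nilp n (word w).
  by move=> w wu; apply: IH; lia.
elim: u (@word C V) {un} => [|x u IHu] G GP /=; first exact: nilp0.
apply: nilp_lin; first exact: GP.
by apply: IHu => w wu; apply: GP; rewrite /= wu.
Qed.

Lemma nilp_exists X : exists n, nilp n X.
Proof.
have [s ->] := talg_words X.
exists (\max_(p <- s) size p.2).+1.
have : forall p, p \in s -> nilp (\max_(p <- s) size p.2).+1 (word p.2).
  move=> p ps; apply: nilp_word; rewrite ltnS.
  exact: (@leq_bigmax_seq _ s xpredT (fun p : C * seq V => size p.2) p ps isT).
move: _.+1 => n; elim: s => [|p s IH] sP; first by rewrite big_nil; exact: nilp0.
rewrite big_cons; apply: nilp_lin; first by apply: sP; rewrite mem_head.
by apply: IH => q qs; apply: sP; rewrite inE qs orbT.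
Qed.

Variable b : V -> V -> C.
Hypotheses (bC : forall x y, b x y = b y x) (bl : forall x, scalar (b x)).
Hypothesis F0 : exists rho, F rho.
Hypothesis F_closed : forall rho sigma (n : nat), F rho -> F sigma ->
  F (fun x => rho x + n%:R * sigma x).

(** On X, the moments of mean rho + n sigma are a polynomial in n, which vanishes
    at all natural numbers and so is zero; gauss_deform identifies its linear
    coefficient. Natural multiples suffice, so F need only be closed under
    these. *)
Lemma gaussian_annih rho sigma X : F rho -> F sigma ->
  (forall tau, F tau -> gaussian tau b X = 0) -> gaussian rho b (annih sigma X) = 0.
Proof.
move=> Fr Fs X0; have [rl sl] := (F_scalar Fr, F_scalar Fs).
have [s XE] := talg_words X.
pose P := \sum_(p <- s) p.1 *: (gauss (fun x => (rho x)%:P + sigma x *: 'X)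
   (fun x y => (b x y)%:P) p.2 : {poly C}).
have P0 : P = 0.
  apply: natmul_roots_eq0 => n.
  have Ft := F_closed n Fr Fs.
  rewrite -(X0 _ Ft) XE (lin_comb (gaussian_linear bC (F_scalar Ft) bl)).
  rewrite horner_sum; apply: eq_bigr => p _; rewrite hornerZ.
  rewrite (gaussianE bC (F_scalar Ft) bl); congr (_ * _).
  by have [-> _] := gauss_deform rho sigma b p.2.
have := congr1 (fun Q : {poly C} => Q`_1) P0; rewrite coef0 /P coef_sum => <-.
rewrite XE (lin_comb (annih_linear sl)) (lin_sum (gaussian_linear bC rl bl)).
apply: eq_bigr => p _; rewrite (linZ (gaussian_linear bC rl bl)) coefZ.
congr (_ * _); have [_ ->] := gauss_deform rho sigma b p.2.
rewrite annih_word// (linear_delsum _ _ _ (gaussian_linear bC rl bl)).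
by apply: eq_delsum => w; exact: gaussianE.
Qed.

(** Induction on the degree of X: all annih sigma X are zero, so X is a scalar,
    and the Gaussian functionals are 1 at the empty word. *)
Lemma gaussian_separates X : X \in symmetric_tensor V ->
  (forall rho, F rho -> gaussian rho b X = 0) -> X = 0.
Proof.
move=> /set_mem[Y _ <-]; have := Sym_span Y; move: (Sym Y) => {}Y Ys.
have [n] := nilp_exists Y; elim: n Y Ys => // n IH Y Ys Yn Y0.
have [|c YE] := @head_contract_eq0 Y.
  move=> sigma Fs; rewrite -(annih_symmetric (F_scalar Fs) Ys).
  apply: IH; [exact: annih_span (F_scalar Fs) Ys|exact: Yn|].
  by move=> rho Fr; exact: gaussian_annih.
have [rho Fr] := F0; have := Y0 _ Fr.
rewrite YE (linZ (gaussian_linear bC (F_scalar Fr) bl)) (gaussianE bC (F_scalar Fr) bl).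
by rewrite -[_ *: _]/(c * 1) mulr1 => ->; rewrite scale0r.
Qed.

End Separation.

(** * Norms of Gaussian moments on tensor powers *)
Section Limits.
Context {C : numFieldType}.

Lemma cvg_ge0 (T : Type) (F : set_system T) {FF : ProperFilter F} (f : T -> C) (l : C) :
  (forall x, 0 <= f x) -> f x @[x --> F] --> l -> 0 <= l.
Proof.
move=> f0 fl; have -> : l = `|l|; last exact: normr_ge0.
apply: (@cvg_unique C _ (f x @[x --> F])) => //.
have -> : f = (fun x => `|f x|) by apply/funext => x; rewrite ger0_norm.
exact: cvg_norm.
Qed.

Lemma cvg_norm_le (T : Type) (F : set_system T) {FF : ProperFilter F} (f : T -> C) (l M : C) :
  (forall x, `|f x| <= M) -> f x @[x --> F] --> l -> `|l| <= M.
Proof.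
move=> fM fl; rewrite -subr_ge0; apply: (@cvg_ge0 _ F FF (fun x => M - `|f x|)).
  by move=> x; rewrite subr_ge0.
by apply: cvgB; [exact: cvg_cst|exact: cvg_norm].
Qed.

End Limits.

Section TensorNorm.
Context {C : numClosedFieldType} {V : Type}.
Variable h : V -> V -> C.

(** The form induced by h on tensor powers, without the factor k! of the norm on
    the tensor algebra. *)
Fixpoint hword (u w : seq V) : C :=
  match u, w with
  | x :: u', y :: w' => h x y * hword u' w'
  | [::], [::] => 1
  | _, _ => 0
  end.

Lemma hword_size u w : size u != size w -> hword u w = 0.
Proof.
elim: u w => [|x u IH] [|y w] //= uw; rewrite IH ?mulr0//.
Qed.

(** The form of degree k, as a kernel on the words of all lengths: with restr
    below, it keeps words and their sums free of a length index. *)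
Definition hdeg k (u w : seq V) : C := if size u == k then hword u w else 0.

Hypothesis h_psd : psd h.

Let indicator k (u : seq V) : C := (size u == k)%:R.

Lemma psd_indicator k : psd (fun u w => indicator k u * indicator k w).
Proof. by apply: eq_psd (psd_rank1 (indicator k)) => u w; rewrite /indicator rmorph_nat. Qed.

(** The degree k.+1 is a product of kernels pulled back along head and behead, so
    that psdM applies; x0 is the head of the empty word, at which the indicator
    vanishes. *)
Lemma hdegS k u w (x0 : V) : hdeg k.+1 u w = indicator k.+1 u * indicator k.+1 w *
  (h (head x0 u) (head x0 w) * hdeg k (behead u) (behead w)).
Proof.
rewrite /hdeg /indicator; case: u => [|x u] /=; first by rewrite !mul0r.
rewrite eqSS; case: eqVneq => [uk|]; last by rewrite !mul0r.
rewrite mul1r; case: w => [|y w] /=; first by rewrite mul0r.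
rewrite eqSS; case: eqVneq => [|wk]; first by rewrite mul1r.
by rewrite hword_size ?mulr0 ?mul0r// uk eq_sym.
Qed.

Lemma psd_hdeg k : psd (hdeg k).
Proof.
elim: k => [|k IH].
  apply: eq_psd (psd_indicator 0) => -[|x u] [|y w]; rewrite /hdeg/indicator/= ?mul0r ?mulr0 ?mulr1//.
have [x0|V0] := pselect (exists x0 : V, True); last first.
  apply: eq_psd (psd_rank1 (fun=> 0)) => u w; rewrite mulr0 /hdeg.
  by case: u => // x u; exfalso; apply: V0; exists x.
have {x0} [x0 _] := x0.
apply: eq_psd (psdM (psd_indicator k.+1) (psdM (psd_pull (head x0) h_psd) (psd_pull behead IH))).
by move=> u w; rewrite (hdegS _ _ _ x0).
Qed.

Definition restr k (F : seq V -> C) u : C := if size u == k then F u else 0.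

Definition hnorm2 k n (c : 'I_n -> C) (t : 'I_n -> seq V) : C :=
  \sum_i \sum_j (c i)^* * c j * hdeg k (t i) (t j).

Lemma hnorm2_ge0 k n (c : 'I_n -> C) t : 0 <= hnorm2 k c t.
Proof. exact: (psd_hdeg k).2. Qed.

(** The functional F has norm at most M on the k-th tensor power. Testing it on
    formal combinations of words, of squared norm hnorm2, requires no linear
    structure on V. *)
Definition bounded_on k (M : C) (F : seq V -> C) : Prop :=
  forall n (c : 'I_n -> C) (t : 'I_n -> seq V),
    `|\sum_i c i * restr k F (t i)| <= M * sqrtC (hnorm2 k c t).

(** Boundedness is positivity of a kernel, and so behaves well under Schur
    products. *)
Lemma bounded_onP k M F : 0 <= M ->
  bounded_on k M F <->
  psd (fun u w => M ^+ 2 * hdeg k u w - (restr k F u)^* * restr k F w).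
Proof.
move=> M0.
have E n (c : 'I_n -> C) (t : 'I_n -> seq V) :
    \sum_i \sum_j (c i)^* * c j *
      (M ^+ 2 * hdeg k (t i) (t j) - (restr k F (t i))^* * restr k F (t j)) =
    M ^+ 2 * hnorm2 k c t - `|\sum_i c i * restr k F (t i)| ^+ 2.
  rewrite normCK rmorph_sum mulr_sumr mulr_suml.
  under [X in _ - X]eq_bigr do rewrite mulr_sumr.
  rewrite [X in _ - X]exchange_big /= -sumrB; apply: eq_bigr => i _.
  rewrite mulr_sumr -sumrB; apply: eq_bigr => j _.
  rewrite (rmorphM (Num.conj_op : {rmorphism C -> C})) /=; ring.
have B n (c : 'I_n -> C) (t : 'I_n -> seq V) :
    (`|\sum_i c i * restr k F (t i)| <= M * sqrtC (hnorm2 k c t)) =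
    (0 <= M ^+ 2 * hnorm2 k c t - `|\sum_i c i * restr k F (t i)| ^+ 2).
  rewrite subr_ge0 -{2}[hnorm2 k c t]sqrtCK -exprMn ler_pXn2r// nnegrE ?normr_ge0//.
  by rewrite mulr_ge0// sqrtC_ge0 hnorm2_ge0.
split=> [FM|[_ FM] n c t]; last by rewrite B -E; exact: FM.
split=> [u w|n c t]; last by rewrite E -B; exact: FM.
rewrite (psd_hdeg k).1 rmorphB; congr (_ - _).
  rewrite (rmorphM (Num.conj_op : {rmorphism C -> C})).
  by rewrite (rmorphXn (Num.conj_op : {rmorphism C -> C})) /= (geC0_conj M0).
by rewrite (rmorphM (Num.conj_op : {rmorphism C -> C})) /= conjCK mulrC.
Qed.

Lemma bounded_on_add k M N F G : bounded_on k M F -> bounded_on k N G ->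
  bounded_on k (M + N) (fun u => F u + G u).
Proof.
move=> FM GN n c t; rewrite mulrDl.
have -> : \sum_i c i * restr k (fun u => F u + G u) (t i) =
    \sum_i c i * restr k F (t i) + \sum_i c i * restr k G (t i).
  rewrite -big_split /=; apply: eq_bigr => i _; rewrite -mulrDr /restr.
  by case: ifP; rewrite ?addr0.
by rewrite (le_trans (ler_normD _ _))// lerD.
Qed.

Lemma bounded_onZ k M a F : bounded_on k M F -> bounded_on k (`|a| * M) (fun u => a * F u).
Proof.
move=> FM n c t.
have -> : \sum_i c i * restr k (fun u => a * F u) (t i) = a * \sum_i c i * restr k F (t i).
  rewrite mulr_sumr; apply: eq_bigr => i _; rewrite mulrCA /restr.
  by case: ifP; rewrite ?mulr0.
by rewrite normrM -mulrA ler_wpM2l// normr_ge0.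
Qed.

Lemma bounded_on_0 k : bounded_on k 0 (fun=> 0).
Proof.
move=> n c t; rewrite mul0r big1 ?normr0// => i _.
by rewrite /restr; case: ifP; rewrite mulr0.
Qed.

Lemma eq_bounded_on k M F G : (forall u, size u = k -> F u = G u) ->
  bounded_on k M F -> bounded_on k M G.
Proof.
move=> FG FM n c t; have := FM n c t; congr (`|_| <= _); apply: eq_bigr => i _.
by rewrite /restr; case: eqP => // /FG ->.
Qed.

Lemma bounded_on_sum k (I : Type) (s : seq I) (M : I -> C) (F : I -> seq V -> C) :
  (forall i, bounded_on k (M i) (F i)) ->
  bounded_on k (\sum_(i <- s) M i) (fun u => \sum_(i <- s) F i u).
Proof.
move=> FM; elim: s => [|i s IH].
  rewrite big_nil; apply: (@eq_bounded_on k 0 (fun=> 0)); last exact: bounded_on_0.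
  by move=> u _; rewrite big_nil.
rewrite big_cons; apply: eq_bounded_on (bounded_on_add (FM i) IH).
by move=> u _; rewrite big_cons.
Qed.

Lemma bounded_on_le k M N F : M <= N -> bounded_on k M F -> bounded_on k N F.
Proof.
move=> MN FM n c t; apply: le_trans (FM n c t) _.
by rewrite ler_wpM2r// sqrtC_ge0 hnorm2_ge0.
Qed.

Lemma bounded_on_lim k M (F : nat -> seq V -> C) G :
  (forall n, bounded_on k M (F n)) ->
  (forall u, size u = k -> F n u @[n --> \oo] --> (G u : C)) -> bounded_on k M G.
Proof.
move=> FM FG n c t.
apply: (@cvg_norm_le C nat \oo _ (fun m => \sum_i c i * restr k (F m) (t i))
  (\sum_i c i * restr k G (t i))).
  by move=> m; exact: FM.
apply: cvg_big => [|i _]; first exact: add_continuous.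
 apply: cvgMl_tmp.
by rewrite /restr; case: eqP => [tk|_]; [exact: FG|exact: cvg_cst].
Qed.

(** For linear f this amounts to |f x|^2 <= h x x, see dominated_scalar. *)
Definition dominated (f : V -> C) : Prop := psd (fun x y => h x y - (f x)^* * f y).

Definition headf (f : V -> C) (F : seq V -> C) (u : seq V) : C :=
  if u is x :: u' then f x * F u' else 0.

(** The norm of a tensor product of functionals. With h = (h - f^* f) + f^* f in
    the first letter, the kernel M^2 h (x) h_k - |f (x) F|^2 is
    (h - f^* f) (x) M^2 h_k + f^* f (x) (M^2 h_k - F^* F). *)
Lemma bounded_on_headf k M f F : 0 <= M -> dominated f -> bounded_on k M F ->
  bounded_on k.+1 M (headf f F).
Proof.
move=> M0 fh /(bounded_onP _ _ M0) FM; apply/(bounded_onP _ _ M0).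
have [x0|V0] := pselect (exists x0 : V, True); last first.
  apply: eq_psd (psd_rank1 (fun=> 0)) => u w; rewrite mulr0 /hdeg /restr.
  case: u => [|x u]; last by exfalso; apply: V0; exists x.
  by rewrite conjC0 mulr0 mul0r subrr.
have {x0} [x0 _] := x0.
have P1 := psdM (psd_pull (head x0) fh) (psdZ (exprn_ge0 2 M0) (psd_pull behead (psd_hdeg k))).
have P2 := psdM (psd_pull (head x0) (psd_rank1 f)) (psd_pull behead FM).
apply: eq_psd (psdM (psd_indicator k.+1) (psdD P1 P2)) => u w.
rewrite (hdegS _ _ _ x0) /restr /indicator.
case: u => [|x u] /=; first by rewrite conjC0 !mul0r mulr0 subrr.
case: w => [|y w] /=; first by rewrite !mulr0 !mul0r mulr0 subrr.
rewrite !eqSS; case: eqP => _; last by rewrite conjC0 !mul0r mulr0 subrr.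
case: eqP => _; last by rewrite !mulr0 !mul0r mulr0 subrr.
rewrite (rmorphM (Num.conj_op : {rmorphism C -> C})) /=; ring.
Qed.

(** The letter at position j moves to the front. This permutation of the tensor
    factors preserves the norm, and it turns each term of delsum into a tensor
    product of functionals. *)
Fixpoint mvfront j (u : seq V) : seq V :=
  match j, u with
  | j'.+1, x :: u' => if mvfront j' u' is y :: w then y :: x :: w else u
  | _, _ => u
  end.

Lemma size_mvfront j u : size (mvfront j u) = size u.
Proof.
elim: j u => [|j IH] [|x u] //=; have := IH u.
by case: (mvfront j u) => [|y w] /= <-.
Qed.

Lemma hword_mvfront j u w : hword (mvfront j u) (mvfront j w) = hword u w.
Proof.
elim: j u w => [|j IH] // [|x u] [|y w] //=.
- by case: mvfront.
- by case: mvfront.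
have := IH u w; have := size_mvfront j u; have := size_mvfront j w.
case: (mvfront j u) => [|x' u']; case: (mvfront j w) => [|y' w'] //= sw su.
- by move=> <-; rewrite hword_size ?mulr0// -su.
- by move=> <-; case: w sw {IH} => // _; rewrite !mulr0.
by move=> <-; rewrite mulrCA.
Qed.

Lemma bounded_on_mvfront k M j F : bounded_on k M F ->
  bounded_on k M (F \o mvfront j).
Proof.
move=> FM n c t; have := FM n c (fun i => mvfront j (t i)).
rewrite /hnorm2 /restr /hdeg.
under eq_bigr do rewrite size_mvfront.
under [X in sqrtC X]eq_bigr do under eq_bigr do rewrite size_mvfront hword_mvfront.
by [].
Qed.

End TensorNorm.

Section GaussBounds.
Context {C : numClosedFieldType} {V : Type}.
Variable h : V -> V -> C.
Hypothesis h_psd : psd h.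
Local Notation bounded_on := (bounded_on h).
Local Notation dominated := (dominated h).

Lemma delsum_mvfront (f : V -> C) (F : seq V -> C^o) u :
  delsum f F u = \sum_(j < size u) headf f F (mvfront j u).
Proof.
elim: u F => [|x u IH] F /=; first by rewrite big_ord0.
rewrite big_ord_recl /= IH; congr (_ + _); apply: eq_bigr => j _.
rewrite /bump /=; have := ltn_ord j; move: (nat_of_ord j) => m {}j.
by have := size_mvfront m u; case: (mvfront m u) => [|y w] //= su; rewrite -su in j.
Qed.

(** There are k.+1 positions to delete from. *)
Lemma bounded_on_delsum k M f (F : seq V -> C^o) : 0 <= M -> dominated f ->
  bounded_on k M F -> bounded_on k.+1 (k.+1%:R * M) (delsum f F).
Proof.
move=> M0 fh FM; have := bounded_on_sum (index_enum 'I_k.+1)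
  (fun j : 'I_k.+1 => bounded_on_mvfront j (bounded_on_headf h_psd M0 fh FM)).
rewrite sumr_const card_ord -[M *+ _]mulr_natl; apply: (@eq_bounded_on C V h) => u uk.
by rewrite delsum_mvfront uk.
Qed.

Variables (rho : V -> C) (b : V -> V -> C).
Variables (c : nat -> C) (f g : nat -> V -> C) (cc : C).
Hypothesis rho_dom : dominated rho.
Hypothesis f_dom : forall n, dominated (f n).
Hypothesis g_dom : forall n, dominated (g n).
Hypothesis c_ge0 : forall n, 0 <= c n.
Hypothesis c_sum : forall n, \sum_(i < n) c i <= cc.
Hypothesis bE : forall x y,
  \sum_(i < n) c i * (f i x * g i y + g i x * f i y) @[n --> \oo] --> b x y.

Local Notation G := (gauss rho b).

Lemma delsum_cvg (B : nat -> V -> C) (B0 : V -> C) (F : seq V -> C^o) u :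
  (forall y, B n y @[n --> \oo] --> B0 y) ->
  (delsum (B n) F u : C) @[n --> \oo] --> (delsum B0 F u : C).
Proof.
move=> BB; elim: u F => [|x u IH] F /=; first exact: cvg_cst.
by apply: cvgD; [apply: cvgMr_tmp; exact: BB|exact: IH].
Qed.

Lemma delsum_expansion n x (F : seq V -> C^o) u :
  delsum (fun y => \sum_(i < n) c i * (f i x * g i y + g i x * f i y)) F u =
  \sum_(i < n) c i * (f i x * delsum (g i) F u + g i x * delsum (f i) F u).
Proof.
have E a (p q : V -> C) : delsum (fun y => a * p y + q y) F u =
  a * delsum p F u + delsum q F u by exact: delsum_linl.
elim: n => [|n IH].
  rewrite big_ord0; have := E (-1) (fun=> 0) (fun=> 0).
  rewrite [-1 * delsum _ _ _]mulN1r addNr => E0.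
  rewrite -[RHS]E0; apply: eq_delsum_size => // y.
  by rewrite big_ord0 mulr0 addr0.
rewrite big_ord_recr /= -IH addrC mulrDr !mulrA -addrA -!E.
by apply: eq_delsum_size => // y; rewrite big_ord_recr /=; ring.
Qed.

(** The bound M_k on the moments of degree k satisfies
    M_(k+1) = M_k + 2 cc k M_(k-1), for a first letter that is unpaired or paired
    with one of the k others; the second component carries M_(k-1). *)
Fixpoint gbound k : C * C :=
  if k is k'.+1 then ((gbound k').1 + 2 * cc * k'%:R * (gbound k').2, (gbound k').1)
  else (1, 0).

Let cc_ge0 : 0 <= cc.
Proof. by have := c_sum 0; rewrite big_ord0. Qed.

Lemma gbound_ge0 k : 0 <= (gbound k).1 /\ 0 <= (gbound k).2.
Proof.
elim: k => [|k [IH1 IH2]] //=; split=> //.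
by rewrite addr_ge0// !mulr_ge0.
Qed.

(** The pairing of the first letter by b is the limit of its pairings by the
    finite sums of products of f_i and g_i; each of these is bounded by
    bounded_on_headf and bounded_on_delsum, and bounds pass to the limit. *)
Lemma bounded_on_gauss k :
  bounded_on k (gbound k).1 G /\ (forall j, k = j.+1 -> bounded_on j (gbound k).2 G).
Proof.
elim: k => [|k [IH1 IH0]].
  split => //; apply/bounded_onP => //.
  apply: eq_psd (psd_rank1 (fun=> 0)) => u w; rewrite mulr0 /restr /hdeg.
  by case: u w => [|x u] [|y w] //=; rewrite ?conjC1 ?conjC0 ?expr1n ?mulr0 ?mulr1 ?mul0r subrr.
rewrite /=; have [] := gbound_ge0 k; move: IH1 IH0.
case: (gbound k) => M1 M0 /= IH1 IH0 M1_ge0 M0_ge0; split=> [|j [<-]//].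
pose P n (u : seq V) := \sum_(i < n) c i *
  (headf (f i) (delsum (g i) (G : seq V -> C^o)) u +
   headf (g i) (delsum (f i) (G : seq V -> C^o)) u).
pose D u := if u is x :: u' then delsum (b x) (G : seq V -> C^o) u' : C else 0.
have PD u : P n u @[n --> \oo] --> (D u : C).
  case: u => [|x u]; rewrite /P /D /=.
    have -> : (fun n => \sum_(i < n) c i * (0 + 0)) = (fun=> 0).
      by apply/funext => n; rewrite big1// => i _; rewrite addr0 mulr0.
    exact: cvg_cst.
  under eq_cvg => n do rewrite -delsum_expansion.
  exact: delsum_cvg.
have DB : bounded_on k.+1 (2 * cc * k%:R * M0) D.
  case: k IH1 IH0 => [|j] IH1 IH0.
    apply: (@eq_bounded_on _ _ _ 1 _ (fun=> 0)); last first.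
      by rewrite mulr0 mul0r; exact: bounded_on_0.
    by move=> [|x [|y u]].
  apply: (@bounded_on_lim _ _ _ _ _ P) => [n|u _]; last exact: PD.
  have IH := IH0 j erefl.
  have jM0 : 0 <= j.+1%:R * M0 by rewrite mulr_ge0.
  have Fi i : bounded_on j.+2 (`|c i| * (j.+1%:R * M0 + j.+1%:R * M0))
    (fun u => c i * (headf (f i) (delsum (g i) (G : seq V -> C^o)) u +
       headf (g i) (delsum (f i) (G : seq V -> C^o)) u)).
    apply: bounded_onZ; apply: bounded_on_add; apply: bounded_on_headf => //;
      exact: bounded_on_delsum.
  have := bounded_on_sum (index_enum 'I_n) (fun i : 'I_n => Fi i).
  apply: bounded_on_le => //; rewrite -mulr_suml.
  under eq_bigr do rewrite ger0_norm//.
  rewrite [leRHS](_ : _ = cc * (j.+1%:R * M0 + j.+1%:R * M0)); last by ring.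
  by rewrite ler_wpM2r ?c_sum// addr_ge0.
have := bounded_on_add (bounded_on_headf h_psd M1_ge0 rho_dom IH1) DB.
by apply: eq_bounded_on => -[|x u] // _; rewrite /= gauss_cons.
Qed.

(** There are about sqrt(k!) pairings of k letters. The recursion for M_k involves
    two degrees, hence the conjunction; 4 (1 + cc) is large enough for
    2 M_(k+1)^2 + 2 (2 cc (k+1) M_k)^2 to stay below the next bound. *)
Lemma gbound_sqr k (A := 4 * (1 + cc)) :
  (gbound k).1 ^+ 2 <= A ^+ k * k`!%:R /\
  (gbound k.+1).1 ^+ 2 <= A ^+ k.+1 * (k.+1)`!%:R.
Proof.
have A0 : 0 <= A by rewrite mulr_ge0// addr_ge0.
elim: k => [|k [IH0 IH1]].
  rewrite /= mulr0 addr0 expr1n !fact0 expr0 mulr1; split=> //.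
  rewrite -subr_ge0 (_ : _ - _ = 3 + 4 * cc) ?addr_ge0 ?mulr_ge0//.
  by rewrite /A factS fact0; ring.
split=> //; have [] := gbound_ge0 k; have [+ _] := gbound_ge0 k.+1.
rewrite -[(gbound k.+2).1]/((gbound k.+1).1 + 2 * cc * k.+1%:R * (gbound k).1).
move: IH0 IH1; move: (gbound k.+1).1 (gbound k).1 => M1 M0 H0 H1 M10 M00 _.
set y := 2 * cc * _ * _.
have y0 : 0 <= y by rewrite !mulr_ge0.
have : (M1 + y) ^+ 2 <= 2 * M1 ^+ 2 + 2 * y ^+ 2.
  rewrite -subr_ge0 (_ : _ - _ = (M1 - y) ^+ 2); last by ring.
  by rewrite real_exprn_even_ge0// rpredB// ger0_real.
move=> /le_trans; apply.
have -> : y ^+ 2 = 4 * cc ^+ 2 * k.+1%:R ^+ 2 * M0 ^+ 2 by rewrite /y; ring.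
have H0' : 2 * (4 * cc ^+ 2 * k.+1%:R ^+ 2 * M0 ^+ 2) <=
    2 * (4 * cc ^+ 2 * k.+1%:R ^+ 2 * (A ^+ k * k`!%:R)).
  by rewrite !ler_wpM2l ?mulr_ge0 ?exprn_ge0.
have H1' : 2 * M1 ^+ 2 <= 2 * (A ^+ k.+1 * (k.+1)`!%:R) by rewrite ler_wpM2l.
apply: le_trans (lerD H1' H0') _.
rewrite -subr_ge0 !factS; move: (k`!) => T.
rewrite (_ : _ - _ = A ^+ k * T%:R * k.+1%:R *
   (A * (2 + 4 * cc) + k.+1%:R * (16 + 32 * cc + 8 * cc ^+ 2))).
  by rewrite !(mulr_ge0, addr_ge0, exprn_ge0, ler0n, cc_ge0).
by rewrite 2!exprS /A; ring.
Qed.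

End GaussBounds.

Section FormWords.
Context {C : numClosedFieldType} {V : lmodType C}.
Variable h : V -> V -> C.

Lemma form_wordE u w : form_word h u w = (size u)`!%:R * hword h u w.
Proof.
rewrite /form_word; case: eqP => [uw|/eqP uw]; last by rewrite hword_size ?mulr0.
congr (_ * _); elim: u w uw => [|x u IH] [|y w] //=; first by rewrite big_ord0.
by move=> [uw]; rewrite big_ord_recl IH.
Qed.

Hypothesis h_scalar : forall x, scalar (h x).
Hypothesis h_herm : forall x y, h x y = (h y x)^*.

Lemma hword_linr u : semimultilinear idfun (hword h u : seq V -> C^o).
Proof.
move=> a w w' x y; elim: w u => [|z w IH] [|t u] /=.
- by rewrite scaler0 addr0.
- by rewrite h_scalar mulrDl -mulrA.
- by rewrite scaler0 addr0.
by rewrite IH mulrDr; congr (_ + _); exact: mulrCA.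
Qed.

Lemma hword_herm u w : hword h w u = (hword h u w)^*.
Proof.
elim: u w => [|x u IH] [|y w] //=; rewrite ?conjC1 ?conjC0//.
by rewrite (rmorphM (Num.conj_op : {rmorphism C -> C})) /= IH -h_herm.
Qed.

Lemma form_word_linr u : semimultilinear idfun (form_word h u).
Proof.
by move=> a w w' x y; rewrite !form_wordE hword_linr mulrDr; congr (_ + _); exact: mulrCA.
Qed.

Lemma form_word_linl w : semimultilinear Num.conj_op (form_word h ^~ w).
Proof.
move=> a u u' x y; rewrite !form_wordE !size_cat /= ![hword h _ w]hword_herm.
rewrite hword_linr rmorphD mulrDr; congr (_ + _).
rewrite -[_ *: hword _ _ _]/(_ * hword _ _ _).
by rewrite (rmorphM (Num.conj_op : {rmorphism C -> C})) /=; exact: mulrCA.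
Qed.

Lemma talg_form_linl Y a x y :
  talg_form h (a *: x + y) Y = a^* * talg_form h x Y + talg_form h y Y.
Proof. exact: (talg_slift2_linl (s := Num.conj_op) form_word_linl form_word_linr). Qed.

Lemma talg_form_linr X : scalar (talg_form h X).
Proof. exact: (talg_slift2_linr (s := Num.conj_op) form_word_linl form_word_linr). Qed.

Lemma talg_form_word u w : talg_form h (word u) (word w) = form_word h u w.
Proof. exact: (talg_slift2E (s := Num.conj_op) form_word_linl form_word_linr). Qed.

Lemma talg_form_comb (s t : seq (C * seq V)) :
  talg_form h (\sum_(p <- s) p.1 *: word p.2) (\sum_(q <- t) q.1 *: word q.2) =
  \sum_(p <- s) \sum_(q <- t) p.1^* * q.1 * form_word h p.2 q.2.
Proof.
elim: s => [|[a u] s IH].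
  rewrite !big_nil; have := talg_form_linl (\sum_(q <- t) q.1 *: word q.2) (-1) 0 0.
  by rewrite rmorphN1 mulN1r scaleN1r !addNr => ->.
rewrite !big_cons talg_form_linl IH; congr (_ + _).
have lr : linear (talg_form h (word u) : talg V -> C^o) := talg_form_linr _.
rewrite (lin_sum lr) mulr_sumr; apply: eq_bigr => -[b w] _ /=.
by rewrite (linZ lr) talg_form_word -mulrA.
Qed.

(** The squared norm of a tensor splits into degrees, with weights k!. *)
Lemma talg_form_hnorm2 n N (c : 'I_n -> C) (t : 'I_n -> seq V) :
  (forall i, (size (t i) < N)%N) ->
  talg_form h (\sum_i c i *: word (t i)) (\sum_i c i *: word (t i)) =
  \sum_(k < N) k`!%:R * hnorm2 h k c t.
Proof.
move=> tN.
pose s := [seq (c i, t i) | i <- index_enum 'I_n].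
have sE : \sum_i c i *: word (t i) = \sum_(p <- s) p.1 *: word p.2.
  by rewrite big_map.
rewrite sE talg_form_comb big_map.
under eq_bigr do rewrite big_map.
under [RHS]eq_bigr do rewrite mulr_sumr.
rewrite [RHS]exchange_big /=; apply: eq_bigr => i _.
under [RHS]eq_bigr do rewrite mulr_sumr.
rewrite [RHS]exchange_big /=; apply: eq_bigr => j _.
rewrite (bigD1 (Ordinal (tN i)))//= big1 ?addr0 => [|k].
  by rewrite form_wordE /hdeg eqxx mulrCA.
by rewrite /hdeg eq_sym -val_eqE /= => /negbTE ->; rewrite !mulr0.
Qed.

Lemma talg_form0 X : talg_form h X 0 = 0.
Proof. exact: scalar0 (talg_form_linr X). Qed.

Lemma hwordZ s u w : hword (fun x y => s * h x y) u w = s ^+ size u * hword h u w.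
Proof.
elim: u w => [|x u IH] [|y w] /=; rewrite ?expr0 ?mul1r ?mulr0//.
by rewrite IH exprS; ring.
Qed.

Lemma hnorm2Z s k n (c : 'I_n -> C) (t : 'I_n -> seq V) :
  hnorm2 (fun x y => s * h x y) k c t = s ^+ k * hnorm2 h k c t.
Proof.
rewrite /hnorm2 mulr_sumr; apply: eq_bigr => i _; rewrite mulr_sumr.
apply: eq_bigr => j _; rewrite /hdeg; case: eqP => [<-|_]; last by rewrite !mulr0.
by rewrite hwordZ; exact: mulrCA.
Qed.

End FormWords.

(** Cauchy-Schwarz with the weights 2^-(k+1), of sum at most 1. *)
Lemma sqr_norm_sum (C : numClosedFieldType) (z : nat -> C) N :
  `|\sum_(k < N) z k| ^+ 2 <= \sum_(k < N) 2 ^+ k.+1 * `|z k| ^+ 2.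
Proof.
elim: N z => [|N IH] z; first by rewrite !big_ord0 normr0 expr0n.
rewrite !big_ord_recl /= expr1.
set y := \sum_(i < N) _; have /(ler_wpM2l (ler0n C 2)) := IH (fun k => z k.+1).
rewrite mulr_sumr => yB.
have xy : `|z 0%N + y| ^+ 2 <= 2 * `|z 0%N| ^+ 2 + 2 * `|y| ^+ 2.
  apply: (@le_trans _ _ ((`|z 0%N| + `|y|) ^+ 2)).
    by rewrite ler_pXn2r ?nnegrE ?addr_ge0// ler_normD.
  rewrite -subr_ge0 (_ : _ - _ = (`|z 0%N| - `|y|) ^+ 2); last by ring.
  by rewrite real_exprn_even_ge0// rpredB// normr_real.
apply: le_trans xy _; rewrite lerD2l; apply: le_trans yB _.
by apply: ler_sum => i _; rewrite mulrA -exprS.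
Qed.

Section GaussianBound.
Context {C : numClosedFieldType} {V : lmodType C}.
Variable h : V -> V -> C.
Hypothesis h_psd : psd h.
Hypothesis h_scalar : forall x, scalar (h x).
Variables (rho : V -> C) (b : V -> V -> C).
Hypotheses (bC : forall x y, b x y = b y x) (rl : scalar rho) (bl : forall x, scalar (b x)).
Variable A : C.
Hypothesis A_ge0 : 0 <= A.
Variable M : nat -> C.
Hypothesis M_bound : forall k, bounded_on h k (M k) (gauss rho b).
Hypothesis M_ge0 : forall k, 0 <= M k.
Hypothesis M_sqr : forall k, M k ^+ 2 <= A ^+ k * k`!%:R.

(** In degree k the square of the bound M k is at most A^k k!, and k! is part of
    the norm of the tensor algebra; the rescaling of h by 2 A provides A^k and the
    weights 2^k for the sum over the degrees. *)
Lemma gaussian_bound X :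
  `|gaussian rho b X| <= 2 * talg_norm (fun x y => 2 * A * h x y) X.
Proof.
have [s XE] := talg_words X.
pose c (i : 'I_(size s)) := (tnth (in_tuple s) i).1.
pose t (i : 'I_(size s)) := (tnth (in_tuple s) i).2.
pose N := (\max_i size (t i)).+1.
have tN i : (size (t i) < N)%N by rewrite ltnS; exact: (@leq_bigmax _ (fun i => size (t i))).
pose z k := \sum_i c i * restr k (gauss rho b) (t i).
have gE : gaussian rho b X = \sum_(k < N) z k.
  rewrite XE (lin_sum (gaussian_linear bC rl bl)) big_tnth exchange_big /=.
  apply: eq_bigr => i _; rewrite (linZ (gaussian_linear bC rl bl)) gaussianE//.
  rewrite -mulr_sumr; congr (_ * _); rewrite /restr (bigD1 (Ordinal (tN i)))//=.
  rewrite eqxx big1 ?addr0// => k; rewrite eq_sym -val_eqE /= => /negbTE ->//.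
have hs_scalar x : scalar (fun y => 2 * A * h x y).
  by move=> a y y'; rewrite h_scalar mulrDr; congr (_ + _); exact: mulrCA.
have hs_psd := psdZ (mulr_ge0 (ler0n C 2) A_ge0) h_psd.
have fE : talg_form (fun x y => 2 * A * h x y) X X =
    \sum_(k < N) k`!%:R * ((2 * A) ^+ k * hnorm2 h k c t).
  rewrite [in LHS]XE big_tnth.
  rewrite (talg_form_hnorm2 hs_scalar (fun x y => hs_psd.1 y x) c tN).
  by apply: eq_bigr => k _; rewrite hnorm2Z.
have Q0 k : 0 <= hnorm2 h k c t by exact: hnorm2_ge0.
have F0 : 0 <= talg_form (fun x y => 2 * A * h x y) X X.
  by rewrite fE sumr_ge0// => k _; rewrite !mulr_ge0 ?exprn_ge0 ?mulr_ge0.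
rewrite -(@ler_pXn2r _ 2) ?nnegrE//; last by rewrite mulr_ge0// sqrtC_ge0.
rewrite exprMn sqrtCK gE; apply: le_trans (sqr_norm_sum _ _) _.
rewrite fE mulr_sumr; apply: ler_sum => k _.
have zk : `|z k| ^+ 2 <= A ^+ k * k`!%:R * hnorm2 h k c t.
  apply: (@le_trans _ _ (M k ^+ 2 * hnorm2 h k c t)); last by rewrite ler_wpM2r.
  rewrite -[hnorm2 h k c t]sqrtCK -exprMn ler_pXn2r ?nnegrE//; first exact: M_bound.
  by rewrite mulr_ge0// sqrtC_ge0.
apply: le_trans (ler_wpM2l _ zk) _; first exact: exprn_ge0.
rewrite -subr_ge0 (exprMn _ 2 A) (_ : _ - _ = 2 * (2 ^+ k * A ^+ k * k`!%:R * hnorm2 h k c t)).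
  by rewrite !mulr_ge0 ?exprn_ge0.
by rewrite [2 ^+ k.+1]exprS; ring.
Qed.

End GaussianBound.

(** * Complex series *)
Section ComplexSeries.
Context {R : realType}.
Local Notation C := (complexField R).
Local Notation toC := (real_complex R : R -> C).

Lemma pos_complexP (e : C) : 0 < e -> exists2 r : R, 0 < r & e = toC r.
Proof.
move=> e0; exists (complex.Re e).
  by move: e0; rewrite ltcE /= => /andP[].
by apply/esym/RRe_real/gtr0_real.
Qed.

Lemma norm_toC (r : R) : `|toC r| = toC `|r|.
Proof. by rewrite normc_def /= expr0n /= addr0 sqrtr_sqr. Qed.

Lemma cvg_toC (T : Type) (F : set_system T) {FF : Filter F} (f : T -> R) (l : R) :
  f x @[x --> F] --> l -> toC (f x) @[x --> F] --> toC l.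
Proof.
move=> fl; apply/cvgrPdist_lt => _ /pos_complexP[e e0 ->].
move/cvgrPdist_lt : fl => /(_ e e0); apply: filterS => x.
by rewrite -rmorphB norm_toC ltcR.
Qed.

(** Absolute convergence, for real and imaginary parts separately. *)
Lemma abs_summable_cvg (a mu : nat -> C) (S : C) :
  (forall n, `|a n| <= mu n) -> (forall n, \sum_(i < n) mu i <= S) ->
  exists l : C, \sum_(i < n) a i @[n --> \oo] --> l.
Proof.
move=> amu muS; pose m n := complex.Re (mu n).
have mE n : mu n = toC (m n).
  by apply/esym/RRe_real/ger0_real; exact: le_trans (amu n).
have m_ge0 n : 0 <= m n by rewrite -ler0c -mE; exact: le_trans (amu n).
have m_cvg : cvgn (series m).
  apply: nondecreasing_is_cvgn.
    by apply/nondecreasing_seqP => n; rewrite seriesSr lerDl.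
  exists (complex.Re S) => _ [n _ <-]; have := muS n.
  under eq_bigr do rewrite mE.
  by rewrite -rmorph_sum /= seriesEord lecE => /andP[].
have part (g : nat -> R) : (forall n, `|g n| <= m n) ->
    exists l : R, \sum_(i < n) g i @[n --> \oo] --> l.
  move=> gm; have : cvgn (series g).
    apply: normed_cvg; apply: (@series_le_cvg _ _ m) => //= n; exact: normr_ge0.
  move=> /cvg_ex[l gl]; exists (l : R); by move: gl; rewrite seriesEord.
have [r rl] : exists l : R, \sum_(i < n) complex.Re (a i) @[n --> \oo] --> l.
  apply: (part (fun n => complex.Re (a n))) => n; rewrite -lecR -mE; apply: le_trans (amu n).
  exact: normc_ge_Re.
have [s sl] : exists l : R, \sum_(i < n) complex.Im (a i) @[n --> \oo] --> l.
  apply: (part (fun n => complex.Im (a n))) => n; rewrite -lecR -mE; apply: le_trans (amu n).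
  have -> : complex.Im (a n) = - complex.Re (a n * 'i%C) by rewrite ReiNIm opprK.
  rewrite normrN; apply: le_trans (normc_ge_Re _) _; rewrite normrM.
  by rewrite [ `|'i%C|]normc_def /= expr0n expr1n add0r sqrtr1 mulr1.
exists (toC r + 'i%C * toC s).
have -> : (fun n => \sum_(i < n) a i) = (fun n =>
    toC (\sum_(i < n) complex.Re (a i)) + 'i%C * toC (\sum_(i < n) complex.Im (a i))).
  apply/funext => n; rewrite !rmorph_sum mulr_sumr -big_split /=.
  by apply: eq_bigr => i _; rewrite -complexE.
by apply: cvgD; [exact: cvg_toC|apply: cvgMl_tmp; exact: cvg_toC].
Qed.

Lemma partial_sum_le (mu : nat -> C) (l : C) : (forall n, 0 <= mu n) ->
  \sum_(i < n) mu i @[n --> \oo] --> l -> forall n, \sum_(i < n) mu i <= l.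
Proof.
move=> mu0 mul n; rewrite -subr_ge0.
have H : (\sum_(i < m + n) mu i - \sum_(i < n) mu i) @[m --> \oo] --> l - \sum_(i < n) mu i.
  by apply: cvgB; [rewrite (cvg_shiftn n (fun m => \sum_(i < m) mu i) (nbhs l))|exact: cvg_cst].
apply: (cvg_ge0 _ H) => m.
rewrite addnC big_split_ord /= [X in X - _]addrC addrK.
exact: sumr_ge0.
Qed.

Lemma conj_cvg (T : Type) (F : set_system T) {FF : Filter F} (f : T -> C) (l : C) :
  f x @[x --> F] --> l -> (f x)^*%R @[x --> F] --> l^*%R.
Proof.
move=> fl; apply/cvgrPdist_lt => e e0.
move/cvgrPdist_lt : fl => /(_ e e0); apply: filterS => x.
by rewrite -rmorphB norm_conjC.
Qed.

End ComplexSeries.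

(** * Continuous seminorms *)
Section Seminorms.
Context {C : numClosedFieldType} {V : lmodType C}.
Variables (p : V -> C).
Hypothesis ps : seminorm p.

Lemma seminorm_ge0 x : 0 <= p x. Proof. by case: ps. Qed.
Lemma seminormZ a x : p (a *: x) = `|a| * p x. Proof. by case: ps. Qed.
Lemma seminormD x y : p (x + y) <= p x + p y. Proof. by case: ps. Qed.
Lemma seminorm0 : p 0 = 0.
Proof. by rewrite -(scale0r (0 : V)) seminormZ normr0 mul0r. Qed.
Lemma seminormN x : p (- x) = p x.
Proof. by rewrite -scaleN1r seminormZ normrN1 mul1r. Qed.

Lemma seminorm_dist x y : `|p x - p y| <= p (x - y).
Proof.
have H u v : p u - p v <= p (u - v).
  by rewrite lerBlDr; apply: le_trans (seminormD _ _); rewrite subrK.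
have pr : p x - p y \is Num.real by rewrite rpredB// ger0_real// seminorm_ge0.
by rewrite (real_ler_norml _ pr) H andbT lerNl opprB -[p (x - y)]seminormN opprB H.
Qed.

End Seminorms.

Section TvsSeminorms.
Context {C : numClosedFieldType} {V : tvsType C}.

Lemma continuous_seminorm (p : V -> C) : seminorm p ->
  nbhs (0 : V) [set x | p x <= 1] -> continuous p.
Proof.
move=> ps p1 x0; apply/cvgrPdist_lt => e e0.
have e2 : e / 2 != 0 by rewrite gt_eqF// divr_gt0.
have := nbhsT x0 (nbhs0Z e2 p1); apply: filterS => _ [_ [y /= py <-] <-].
apply: le_lt_trans (seminorm_dist ps _ _) _.
rewrite opprD addrA subrr sub0r (seminormN ps) (seminormZ ps).
rewrite gtr0_norm ?divr_gt0//; apply: (@le_lt_trans _ _ (e / 2)).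
  by rewrite ler_piMr// ltW// divr_gt0.
by rewrite ltr_pdivrMr// mulr_natr mulr2n ltrDl.
Qed.

Lemma seminorm_near (q : V -> C) (x0 : V) (e : C) : seminorm q -> continuous q -> 0 < e ->
  \forall x \near x0, q (x - x0) < e.
Proof.
move=> qs qc e0.
have : nbhs (0 : V) [set x | q x < e].
  have := qc 0; move/cvgrPdist_lt => /(_ e e0); apply: filterS => x /=.
  by rewrite (seminorm0 qs) sub0r normrN ger0_norm ?seminorm_ge0.
move=> /(nbhsT x0); apply: filterS => _ [y qy <-] /=.
by rewrite addrC addKr.
Qed.

Lemma continuous_linear_le (f : V -> C) (q : V -> C) : scalar f -> seminorm q ->
  continuous q -> (forall x, `|f x| <= q x) -> continuous f.
Proof.
move=> fl qs qc fq x0; apply/cvgrPdist_lt => e e0.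
have := seminorm_near x0 qs qc e0; apply: filterS => x.
apply: le_lt_trans; rewrite -(seminormN qs) opprB; apply: le_trans (fq _).
by rewrite (scalarB x0 x fl).
Qed.

Lemma seminorm_add (p q : V -> C) : seminorm p -> seminorm q ->
  seminorm (fun x => p x + q x).
Proof.
move=> ps qs; split=> [x|a x|x y].
- by rewrite addr_ge0 ?seminorm_ge0.
- by rewrite (seminormZ ps) (seminormZ qs) mulrDr.
- by rewrite addrACA lerD ?seminormD.
Qed.

Lemma seminormMl (a : C) (p : V -> C) : 0 <= a -> seminorm p -> seminorm (fun x => a * p x).
Proof.
move=> a0 ps; split=> [x|c x|x y].
- by rewrite mulr_ge0 ?seminorm_ge0.
- by rewrite (seminormZ ps) mulrCA.
- by rewrite -mulrDr ler_wpM2l ?seminormD.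
Qed.

Lemma seminorm_norm_scalar (f : V -> C) : scalar f -> seminorm (fun x => `|f x|).
Proof.
move=> fl; split=> // [a x|x y].
  by rewrite -[a *: x]addr0 fl (scalar0 fl) addr0 normrM.
by rewrite -[x in f (x + _)]scale1r fl mul1r ler_normD.
Qed.

(** Only additivity is assumed, so as to cover bilinear forms and forms that are
    antilinear in the first argument. *)
Lemma continuous_form_le (h : V -> V -> C) (q : V -> C) (M : C) :
  (forall x y z, h (x - y) z = h x z - h y z) -> (forall x y z, h z (x - y) = h z x - h z y) ->
  seminorm q -> continuous q -> 0 <= M -> (forall x y, `|h x y| <= M * q x * q y) ->
  continuous (fun z : V * V => h z.1 z.2).
Proof.
move=> hl hr qs qc M0 hq [x0 y0]; apply/cvgrPdist_lt => e e0.
pose T := M * (1 + q x0 + q y0) + 1.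
have T0 : 0 < T by rewrite ltr_wpDl// mulr_ge0// !addr_ge0 ?seminorm_ge0.
pose d := e / (T + e).
have Te : 0 < T + e by rewrite addr_gt0.
have d0 : 0 < d by rewrite divr_gt0.
have d1 : d <= 1 by rewrite ler_pdivrMr// mul1r lerDr ltW.
have dT : d * T < e by rewrite /d mulrAC ltr_pdivrMr// ltr_pM2l// ltrDl.
exists ([set x | q (x - x0) < d], [set y | q (y - y0) < d]).
  by split; exact: seminorm_near.
move=> [x y] [/= qx qy].
have -> : h x0 y0 - h x y = - (h (x - x0) (y - y0) + h (x - x0) y0 + h x0 (y - y0)).
  by rewrite !hl !hr; ring.
rewrite normrN; apply: le_lt_trans dT.
apply: le_trans (ler_normD _ _) _; apply: le_trans (lerD (ler_normD _ _) (lexx _)) _.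
apply: (@le_trans _ _ (M * d * 1 + M * d * q y0 + M * q x0 * d)).
  apply: lerD; first apply: lerD; apply: le_trans (hq _ _) _.
  - apply: ler_pM; rewrite ?mulr_ge0 ?seminorm_ge0//; last exact: le_trans (ltW qy) d1.
    by rewrite ler_wpM2l// ltW.
  - by rewrite ler_wpM2r ?seminorm_ge0// ler_wpM2l// ltW.
  - by rewrite ler_wpM2l ?mulr_ge0 ?seminorm_ge0// ltW.
rewrite -subr_ge0 (_ : _ - _ = d); first exact: ltW.
by rewrite /T; ring.
Qed.

End TvsSeminorms.

Section Gauge.
Context {R : realType}.
Local Notation C := (complexField R).
Local Notation toC := (real_complex R : R -> C).
Context {V : tvsType C}.

Lemma toC_norm (a : C) : `|a| = toC (complex.Re `|a|).
Proof. by apply/esym/RRe_real/normr_real. Qed.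

Section Minkowski.
Variable W : set V.
Hypothesis W_nbhs : nbhs 0 W.
Hypothesis W_balanced : forall a x, `|a| <= 1 -> W x -> W (a *: x).
Hypothesis W_convex : forall (t : R) x y, 0 <= t -> t <= 1 -> W x -> W y ->
  W (toC t *: x + toC (1 - t) *: y).

(** The Minkowski gauge of W is defined as an infimum in R and then viewed in the
    complex numbers. *)
Definition scales x : set R := [set r | 0 < r /\ W (toC r^-1 *: x)].

Lemma W0 : W 0. Proof. exact: nbhs_singleton. Qed.

Lemma scales_nonempty x : scales x !=set0.
Proof.
have := @scale_continuous _ V (0, x) W; rewrite /= scale0r => /(_ W_nbhs).
move=> [[A B] [/= A0 Bx] AB].
have [_ /pos_complexP[d d0 ->] dA] : exists2 e : C, 0 < e & ball (0 : C) e `<=` A by move/nbhs_ballP: A0.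
exists (d / 2)^-1; split; first by rewrite invr_gt0 divr_gt0.
rewrite invrK; apply: (AB (toC (d / 2), x)); split => /=; last exact: nbhs_singleton.
apply: dA; rewrite -ball_normE /= sub0r normrN norm_toC ltcR gtr0_norm ?divr_gt0//.
by rewrite ltr_pdivrMr// mulr_natr mulr2n ltrDl.
Qed.

Lemma scales_up x r s : scales x r -> r <= s -> scales x s.
Proof.
move=> [r0 Wr] rs; have s0 := lt_le_trans r0 rs; split=> //.
have -> : toC s^-1 *: x = toC (r / s) *: (toC r^-1 *: x).
  by rewrite scalerA -rmorphM mulrAC divff ?gt_eqF// mul1r.
apply: W_balanced => //; rewrite norm_toC -[1]/(toC 1) lecR ger0_norm.
  by rewrite ler_pdivrMr// mul1r.
by rewrite divr_ge0// ltW.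
Qed.

Lemma scales_add x y r s : scales x r -> scales y s -> scales (x + y) (r + s).
Proof.
move=> [r0 Wr] [s0 Ws]; have rs0 : 0 < r + s by rewrite addr_gt0.
split=> //; have := W_convex (t := r / (r + s)) _ _ Wr Ws.
have -> : 1 - r / (r + s) = s / (r + s).
  by rewrite -{1}(@divff _ (r + s)) ?gt_eqF// -mulrBl addrC addKr.
have E t : 0 < t -> toC (t / (r + s)) * toC t^-1 = toC (r + s)^-1.
  by move=> t0; rewrite -rmorphM mulrAC divff ?gt_eqF// mul1r.
rewrite !scalerA !E// -scalerDr.
by apply; [rewrite divr_ge0// ltW|rewrite ler_pdivrMr// mul1r lerDl ltW].
Qed.

Lemma scales_scale x r (a : C) : a != 0 -> scales x r -> scales (a *: x) (complex.Re `|a| * r).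
Proof.
move=> a0 [r0 Wr].
have na0 : 0 < complex.Re `|a| by rewrite -ltcR -toC_norm normr_gt0.
split; first by rewrite mulr_gt0.
have -> : toC (complex.Re `|a| * r)^-1 *: (a *: x) = (a / `|a|) *: (toC r^-1 *: x).
  rewrite !scalerA; congr (_ *: _).
  have aV : toC (complex.Re `|a|)^-1 = `|a|^-1 by rewrite fmorphV /= -toC_norm.
  by rewrite invfM rmorphM /= aV mulrAC [_^-1 * a]mulrC.
apply: W_balanced => //.
by rewrite normrM normfV normr_id divff// normr_eq0.
Qed.

Definition rgauge x : R := inf (scales x).

Definition gauge x : C := toC (rgauge x).

Lemma scales_lb x : has_lbound (scales x).
Proof. by exists 0 => r [/ltW]. Qed.

Lemma rgauge_ge0 x : 0 <= rgauge x.
Proof. by apply: lb_le_inf; [exact: scales_nonempty|move=> r [/ltW]]. Qed.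

Lemma rgauge_le x r : scales x r -> rgauge x <= r.
Proof. by move=> xr; apply: ge_inf => //; exact: scales_lb. Qed.

Lemma rgauge_lt x r : rgauge x < r -> scales x r.
Proof.
move=> /(inf_lt (scales_nonempty x))[s xs sr].
exact: scales_up xs (ltW sr).
Qed.

Lemma rgauge_scale_le (a : C) x : rgauge (a *: x) <= complex.Re `|a| * rgauge x.
Proof.
have [->|a0] := eqVneq a 0.
  rewrite scale0r normr0 mul0r; apply/ler_addgt0Pr => e e0; rewrite add0r.
  by apply: rgauge_le; split=> //; rewrite scaler0; exact: W0.
have na0 : 0 < complex.Re `|a| by rewrite -ltcR -toC_norm normr_gt0.
rewrite mulrC -ler_pdivrMr//; apply: lb_le_inf; first exact: scales_nonempty.
by move=> r xr; rewrite ler_pdivrMr// mulrC; apply/rgauge_le/scales_scale.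
Qed.

Lemma gauge_seminorm : seminorm gauge.
Proof.
split=> [x|a x|x y].
- by rewrite /gauge ler0c rgauge_ge0.
- rewrite /gauge toC_norm -rmorphM; congr (toC _); apply/eqP.
  rewrite eq_le rgauge_scale_le andTb.
  have [->|a0] := eqVneq a 0; first by rewrite normr0 mul0r rgauge_ge0.
  have na0 : 0 < complex.Re `|a| by rewrite -ltcR -toC_norm normr_gt0.
  rewrite -ler_pdivlMl//.
  have := rgauge_scale_le a^-1 (a *: x).
  rewrite scalerA mulVf// scale1r => /le_trans; apply.
  have -> : complex.Re `|a^-1| = (complex.Re `|a|)^-1; last by [].
  by rewrite normfV {1}(toC_norm a) -fmorphV.
rewrite /gauge -rmorphD lecR; apply/ler_addgt0Pr => e e0.
have xe : rgauge x < rgauge x + e / 2 by rewrite ltrDl divr_gt0.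
have ye : rgauge y < rgauge y + e / 2 by rewrite ltrDl divr_gt0.
have := rgauge_le (scales_add (rgauge_lt xe) (rgauge_lt ye)).
by rewrite addrACA -splitr.
Qed.

Lemma gauge_lt1 x : gauge x < 1 -> W x.
Proof.
rewrite -[1]/(toC 1) ltcR => /rgauge_lt[_].
by rewrite invr1 rmorph1 scale1r.
Qed.

Lemma gauge_continuous : continuous gauge.
Proof.
apply: (continuous_seminorm gauge_seminorm); apply: filterS W_nbhs => x Wx /=.
rewrite -[1]/(toC 1) lecR; apply: rgauge_le; split=> //.
by rewrite invr1 rmorph1 scale1r.
Qed.

End Minkowski.

(** Local convexity: a neighbourhood of 0 contains a convex one, whose balanced
    core is convex and still a neighbourhood of 0, and the Minkowski gauge of this
    core is a continuous seminorm. *)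
Lemma nbhs0_seminorm (U : set V) : nbhs 0 U ->
  exists p : V -> C, [/\ seminorm p, continuous p & forall x, p x < 1 -> U x].
Proof.
move=> U0; have [B Bconv [Bopen Bbasis]] := @locally_convex _ V.
have [D [BD D0] DU] := Bbasis 0 U U0.
have Dconv : convex_set D by apply: Bconv; rewrite inE.
have Dnb : nbhs 0 D by apply: open_nbhs_nbhs; split=> //; exact: Bopen.
(* the balanced core of D *)
pose W := [set x | forall a : C, `|a| <= 1 -> D (a *: x)].
have Wnb : nbhs 0 W.
  have := @scale_continuous _ V (0, 0) D; rewrite /= scale0r => /(_ Dnb).
  move=> [[A B'] [/= A0 Bx] AB].
  have [d d0 dA] : exists2 e : C, 0 < e & ball (0 : C) e `<=` A by move/nbhs_ballP: A0.
  have d2 : d / 2 != 0 by rewrite gt_eqF// divr_gt0.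
  have := nbhs0Z d2 Bx; apply: filterS => _ [y By <-] a a1.
  rewrite scalerA; apply: (AB (a * (d / 2), y)); split=> //=.
  apply: dA; rewrite -ball_normE /= sub0r normrN normrM.
  rewrite [ `|d / 2|]gtr0_norm ?divr_gt0//.
  apply: (@le_lt_trans _ _ (d / 2)); first by rewrite ler_piMl// ltW// divr_gt0.
  by rewrite ltr_pdivrMr// mulr_natr mulr2n ltrDl.
have Wb a x : `|a| <= 1 -> W x -> W (a *: x).
  move=> a1 Wx c c1; rewrite scalerA; apply: Wx.
  by rewrite normrM mulr_ile1.
have Wc (t : R) x y : 0 <= t -> t <= 1 -> W x -> W y -> W (toC t *: x + toC (1 - t) *: y).
  move=> t0 t1 Wx Wy a a1.
  have tC0 : 0 <= toC t by rewrite ler0c.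
  have tC1 : toC t <= 1 by rewrite -[1]/(toC 1) lecR.
  have := Dconv (a *: x) (a *: y) (Itv01 tC0 tC1).
  rewrite !inE => /(_ (Wx _ a1) (Wy _ a1)).
  rewrite scalerDr !scalerA ![a * _]mulrC -!scalerA rmorphB rmorph1; exact.
exists (gauge W); split.
- exact: gauge_seminorm.
- exact: gauge_continuous.
- move=> x /(gauge_lt1 Wnb Wb) Wx; apply: DU.
  by rewrite -[x]scale1r; apply: Wx; rewrite normr1.
Qed.

(** Continuity at (0, 0) bounds L by 1 on the unit balls of a seminorm p; by
    homogeneity |L x y| <= r s as soon as p x < r and p y < s. For p x <> 0 and
    p y <> 0 take r = 2 p x and s = 2 p y; if p x = 0, let r tend to 0. *)
Lemma bilinear_seminorm (L : V -> V -> C) : bilinear_form L ->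
  continuous (fun z : V * V => L z.1 z.2) ->
  exists p : V -> C, [/\ seminorm p, continuous p & forall x y, `|L x y| <= p x * p y].
Proof.
move=> [Lr Ll] Lc.
have L00 : L 0 0 = 0 by exact: scalar0 (Lr 0).
have [[A B] [/= A0 B0] AB] : nbhs (0 : V, 0 : V) [set z : V * V | `|L z.1 z.2| < 1].
  have := Lc (0, 0); move/cvgrPdist_lt => /(_ 1 ltr01).
  by apply: filterS => z /=; rewrite L00 sub0r normrN.
have [p [ps pc pAB]] := nbhs0_seminorm (filterI A0 B0).
have LZ a c x y : L (a *: x) (c *: y) = a * c * L x y.
  have lin1 z : L (a *: x) z = a * L x z.
    by rewrite -[a *: x]addr0 Ll (scalar0 (Ll z)) addr0.
  by rewrite lin1 -[c *: y]addr0 Lr (scalar0 (Lr x)) addr0 mulrA.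
have Lrs x y r s : 0 < r -> 0 < s -> p x < r -> p y < s -> `|L x y| <= r * s.
  move=> r0 s0 xr ys.
  have px : p (r^-1 *: x) < 1.
    by rewrite (seminormZ ps) gtr0_norm ?invr_gt0// mulrC ltr_pdivrMr// mul1r.
  have py : p (s^-1 *: y) < 1.
    by rewrite (seminormZ ps) gtr0_norm ?invr_gt0// mulrC ltr_pdivrMr// mul1r.
  have [Ax _] := pAB _ px; have [_ By] := pAB _ py.
  have := AB (r^-1 *: x, s^-1 *: y) (conj Ax By).
  have rs0 : 0 <= (r * s)^-1 by rewrite invr_ge0 mulr_ge0 ?(ltW r0) ?(ltW s0).
  rewrite /= LZ normrM -invfM (ger0_norm rs0).
  by rewrite [_^-1 * _]mulrC ltr_pdivrMr ?mulr_gt0// mul1r => /ltW.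
have half (n s : C) : 0 < s -> n / (2 * s) * s = n / 2.
  by move=> s0; rewrite invfM [n * (_ * _)]mulrA mulfVK// gt_eqF.
have L0l x y : p x = 0 -> L x y = 0.
  move=> px; apply/eqP; apply: contraT => Lxy.
  have n0 : 0 < `|L x y| by rewrite normr_gt0.
  have s0 : 0 < p y + 1 by rewrite ltr_wpDl ?seminorm_ge0.
  have := @Lrs x y (`|L x y| / (2 * (p y + 1))) (p y + 1).
  rewrite divr_gt0 ?mulr_gt0// px divr_gt0 ?mulr_gt0// ltrDl ltr01 => /(_ isT s0 isT isT).
  rewrite half// ler_pdivlMr// mulr_natr mulr2n.
  by rewrite gerDl => /(lt_le_trans n0); rewrite ltxx.
have L0r x y : p y = 0 -> L x y = 0.
  move=> py; apply/eqP; apply: contraT => Lxy.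
  have n0 : 0 < `|L x y| by rewrite normr_gt0.
  have s0 : 0 < p x + 1 by rewrite ltr_wpDl ?seminorm_ge0.
  have := @Lrs x y (p x + 1) (`|L x y| / (2 * (p x + 1))).
  rewrite divr_gt0 ?mulr_gt0// py divr_gt0 ?mulr_gt0// ltrDl ltr01 => /(_ s0 isT isT isT).
  rewrite [(_ + 1) * _]mulrC half// ler_pdivlMr// mulr_natr mulr2n.
  by rewrite gerDl => /(lt_le_trans n0); rewrite ltxx.
exists (fun x => 2 * p x); split.
- exact: seminormMl.
- by move=> x; apply: cvgMl_tmp; exact: pc.
move=> x y.
have [px0|px0] := eqVneq (p x) 0; first by rewrite L0l// normr0 px0 mulr0 mul0r.
have [py0|py0] := eqVneq (p y) 0; first by rewrite L0r// normr0 py0 !mulr0.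
have px : 0 < p x by rewrite lt_neqAle eq_sym px0 seminorm_ge0.
have py : 0 < p y by rewrite lt_neqAle eq_sym py0 seminorm_ge0.
by apply: Lrs; rewrite ?mulr_gt0// mulr_natl mulr2n ltrDl.
Qed.

End Gauge.

(** * Hilbert seminorms on nuclear spaces *)
(** Twice the difference of the two sides is a sum over pairs (i, j) of
    mu_i mu_j (a_i - a_j)^2. *)
Lemma weighted_cauchy_schwarz (C : numClosedFieldType) n (mu a : 'I_n -> C) :
  (forall i, 0 <= mu i) -> (forall i, 0 <= a i) ->
  (\sum_i mu i * a i) ^+ 2 <= (\sum_i mu i) * (\sum_i mu i * a i ^+ 2).
Proof.
move=> mu0 a0.
suff : 0 <= 2 * ((\sum_i mu i) * (\sum_i mu i * a i ^+ 2) - (\sum_i mu i * a i) ^+ 2).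
  by rewrite pmulr_rge0// subr_ge0.
have -> : 2 * ((\sum_i mu i) * (\sum_i mu i * a i ^+ 2) - (\sum_i mu i * a i) ^+ 2) =
    \sum_i \sum_j mu i * mu j * (a i - a j) ^+ 2.
  have E (x y : 'I_n -> C) : (\sum_i x i) * (\sum_j y j) = \sum_i \sum_j x i * y j.
    by rewrite mulr_suml; apply: eq_bigr => i _; rewrite mulr_sumr.
  rewrite mulrBr [2 * (_ * _)]mulr_natl mulr2n {2}[(\sum_i mu i) * _]mulrC expr2 !E.
  rewrite -big_split /= mulr_sumr -sumrB; apply: eq_bigr => i _.
  rewrite -big_split /= mulr_sumr -sumrB; apply: eq_bigr => j _; ring.
apply: sumr_ge0 => i _; apply: sumr_ge0 => j _.
apply: mulr_ge0; first by rewrite mulr_ge0.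
by rewrite real_exprn_even_ge0// rpredB// ger0_real.
Qed.

Section PsdForms.
Context {C : numClosedFieldType} {V : lmodType C}.

Lemma psd_form (h : V -> V -> C) : (forall x, scalar (h x)) ->
  (forall x y, h x y = (h y x)^*) -> (forall x, 0 <= h x x) -> psd h.
Proof.
move=> hs hh hp; split=> [x y|n c t]; first exact: hh.
have hl x : linear (h x : V -> C^o) := hs x.
have -> : \sum_i \sum_j (c i)^* * c j * h (t i) (t j) =
    h (\sum_i c i *: t i) (\sum_i c i *: t i); last exact: hp.
have E x : h x (\sum_j c j *: t j) = \sum_j c j * h x (t j).
  by rewrite (lin_sum (hl x)); apply: eq_bigr => j _; rewrite (linZ (hl x)).
have E' x : h (\sum_j c j *: t j) x = \sum_j (c j)^* * h (t j) x.
  rewrite hh E rmorph_sum; apply: eq_bigr => i _.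
  by rewrite (rmorphM (Num.conj_op : {rmorphism C -> C})); congr (_ * _); exact/esym/hh.
rewrite E'; apply: eq_bigr => i _; rewrite E mulr_sumr.
by apply: eq_bigr => j _; rewrite mulrA.
Qed.

Lemma dominated_scalar (h : V -> V -> C) (f : V -> C) : (forall x, scalar (h x)) ->
  (forall x y, h x y = (h y x)^*) -> scalar f -> (forall x, `|f x| ^+ 2 <= h x x) ->
  dominated h f.
Proof.
move=> hs hh fs fh; apply: psd_form => [x a y z|x y|x].
- by rewrite hs fs; ring.
- rewrite rmorphB; congr (_ - _); first exact: hh.
  by rewrite (rmorphM (Num.conj_op : {rmorphism C -> C})) /= conjCK; exact: mulrC.
- by rewrite mulrC -normCK subr_ge0.
Qed.

End PsdForms.

Section NuclearExpansion.
Context {R : realType}.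
Local Notation C := (complexField R).
Context {V : tvsType C}.
Hypothesis V_nuclear : nuclear V.

(** The canonical map to the Banach space of p is a sum of lambda_n f_n(x) b_n
    with b_n in the unit ball, so p(x) <= sum_n |lambda_n| |f_n(x)|, and
    Cauchy-Schwarz for the weights mu_n = |lambda_n| yields squares. Bounding the
    partial sums by T avoids naming the sum of the series. *)
Lemma nuclear_expansion (p : V -> C) : seminorm p -> continuous p ->
  exists (mu : nat -> C) (f : nat -> V -> C) (q : V -> C) (S : C),
    [/\ seminorm q /\ continuous q,
        (forall n, scalar (f n)) /\ (forall n x, `|f n x| <= q x),
        (forall n, 0 <= mu n) /\ (forall n, \sum_(i < n) mu i <= S) &
        forall x T, (forall n, \sum_(i < n) mu i * `|f i x| ^+ 2 <= T) ->
          p x ^+ 2 <= S * T].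
Proof.
move=> ps pc.
have [q [qs qc _ [B [iota [[iotap _] [lambda [f [b [lc fq b1 expn]]]]]]]]] := V_nuclear ps pc.
pose mu n : C := `|lambda n|.
have mu0 n : 0 <= mu n by exact: normr_ge0.
have [S muS] : exists S : C, forall n, \sum_(i < n) mu i <= S.
  move: lc => /cvg_ex[S lS]; exists S; apply: partial_sum_le => //.
  by move: lS; rewrite seriesEord.
exists mu, (fun n => f n : V -> C), q, S; split=> //.
  by split=> // n a x y; rewrite linearP.
move=> x T xT.
have S0 : 0 <= S by have := muS 0%N; rewrite big_ord0.
have T0 : 0 <= T by have := xT 0%N; rewrite big_ord0.
have -> : S * T = sqrtC (S * T) ^+ 2 by rewrite sqrtCK.
rewrite ler_pXn2r ?nnegrE ?sqrtC_ge0 ?mulr_ge0 ?seminorm_ge0//.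
rewrite -iotap -(ger0_norm (normr_ge0 (iota x))).
apply: (@cvg_norm_le C nat \oo _
  (fun n => `|series (fun n => (lambda n * f n x) *: b n) n| : C) _ _ _ (cvg_norm (expn x))) => n.
rewrite normr_id seriesEord /=.
apply: (@le_trans _ _ (\sum_(i < n) mu i * `|f i x|)).
  apply: le_trans (ler_norm_sum _ _ _) _; apply: ler_sum => i _.
  by rewrite normrZ normrM ler_piMr// mulr_ge0.
rewrite -(@ler_pXn2r _ 2) ?nnegrE ?sqrtC_ge0 ?mulr_ge0 ?sumr_ge0//; last first.
  by move=> i _; rewrite mulr_ge0.
rewrite sqrtCK; apply: le_trans (weighted_cauchy_schwarz _ _) _ => //.
by apply: ler_pM; rewrite ?sumr_ge0// => i _; rewrite mulr_ge0// exprn_ge0.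
Qed.

(** In the notation of nuclear_expansion, S sum_n mu_n conj(f_n(x)) f_n(y) is such
    a form; it is continuous because all |f_n| are bounded by one continuous
    seminorm q. *)
Lemma hilbert_domination (p : V -> C) : seminorm p -> continuous p ->
  exists2 h, positive_hermitian_forms V h & forall x, p x ^+ 2 <= h x x.
Proof.
move=> ps pc.
have [mu [f [q [S [[qs qc] [fs fq] [mu0 muS] pT]]]]] := nuclear_expansion ps pc.
have S0 : 0 <= S by have := muS 0%N; rewrite big_ord0.
have : forall z : V * V, exists l : C,
    \sum_(i < n) mu i * ((f i z.1)^* * f i z.2) @[n --> \oo] --> l.
  move=> z; apply: (@abs_summable_cvg R (fun i => mu i * ((f i z.1)^* * f i z.2))
    (fun i => mu i * (q z.1 * q z.2)) (S * (q z.1 * q z.2))).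
    move=> n; rewrite normrM (ger0_norm (mu0 n)) ler_wpM2l// normrM norm_conjC.
    by apply: ler_pM.
  by move=> n; rewrite -mulr_suml ler_wpM2r// mulr_ge0 ?seminorm_ge0.
move=> /choice[k kP].
pose h x y := S * k (x, y).
have kle x y : `|k (x, y)| <= S * (q x * q y).
  apply: cvg_norm_le (kP (x, y)) => n; apply: le_trans (ler_norm_sum _ _ _) _.
  apply: (@le_trans _ _ (\sum_(i < n) mu i * (q x * q y))).
    apply: ler_sum => i _; rewrite normrM (ger0_norm (mu0 i)) ler_wpM2l// normrM norm_conjC.
    by apply: ler_pM.
  by rewrite -mulr_suml ler_wpM2r// mulr_ge0 ?seminorm_ge0.
have ks x : scalar (fun y => k (x, y)).
  move=> a y z; apply: (@cvg_unique C _ (\sum_(i < n) mu i * ((f i x)^* * f i (a *: y + z)) @[n --> \oo])) => //.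
    exact: (kP (x, a *: y + z)).
  have -> : (fun n => \sum_(i < n) mu i * ((f i x)^* * f i (a *: y + z))) =
    (fun n => a * (\sum_(i < n) mu i * ((f i x)^* * f i y)) + \sum_(i < n) mu i * ((f i x)^* * f i z)).
    apply/funext => n; rewrite mulr_sumr -big_split /=; apply: eq_bigr => i _.
    by rewrite fs; ring.
  by apply: cvgD; [apply: cvgMl_tmp; exact: (kP (x, y))|exact: (kP (x, z))].
have kh x y : k (x, y) = (k (y, x))^*.
  apply: (@cvg_unique C _ (\sum_(i < n) mu i * ((f i x)^* * f i y) @[n --> \oo])) => //.
    exact: (kP (x, y)).
  have -> : (fun n => \sum_(i < n) mu i * ((f i x)^* * f i y)) =
      (fun n => (\sum_(i < n) mu i * ((f i y)^* * f i x))^*).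
    apply/funext => n; rewrite rmorph_sum; apply: eq_bigr => i _.
    rewrite !(rmorphM (Num.conj_op : {rmorphism C -> C})) /= conjCK (geC0_conj (mu0 i)).
    by congr (_ * _); exact: mulrC.
  by apply: conj_cvg; exact: (kP (y, x)).
have kT x n : \sum_(i < n) mu i * `|f i x| ^+ 2 <= k (x, x).
  apply: (@partial_sum_le _ (fun i => mu i * `|f i x| ^+ 2)).
    by move=> i; rewrite mulr_ge0// exprn_ge0.
  have -> : (fun n => \sum_(i < n) mu i * `|f i x| ^+ 2) =
      (fun n => \sum_(i < n) mu i * ((f i x)^* * f i x)).
    by apply/funext => m; apply: eq_bigr => i _; rewrite normCKC.
  exact: (kP (x, x)).
have hs x : scalar (h x).
  by move=> a y z; rewrite /h ks mulrDr; congr (_ + _); exact: mulrCA.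
have hh x y : h x y = (h y x)^*.
  by rewrite /h (rmorphM (Num.conj_op : {rmorphism C -> C})) /= (geC0_conj S0) -kh.
exists h; last by move=> x; apply: pT; exact: kT.
split; [exact: hs|exact: hh| |].
  by move=> x; apply: mulr_ge0 => //; have := kT x 0%N; rewrite big_ord0.
apply: (@continuous_form_le _ _ h q (S * S)); [| |exact: qs|exact: qc| |].
- move=> x y z; rewrite hh [h x z]hh [h y z]hh (scalarB x y (hs z)); exact: rmorphB.
- by move=> x y z; exact: (scalarB x y (hs z)).
- exact: mulr_ge0.
by move=> x y; rewrite normrM (ger0_norm S0) -!mulrA ler_wpM2l.
Qed.

End NuclearExpansion.

(** * A real covariance that dominates Lambda *)
Section Covariance.
Context {R : realType}.
Local Notation C := (complexField R).
Context {V : tvsType C} (conjV : antilinear_involution V).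
Hypothesis V_nuclear : nuclear V.
Hypothesis conjV_continuous : continuous conjV.

(** Complex conjugation on the dual; f is real when conjf f = f. *)
Definition conjf (f : V -> C) (x : V) : C := (f (conjV x))^*.

Lemma conjVK : involutive conjV. Proof. exact: ainvol_involutive. Qed.

Lemma conjVl a x y : conjV (a *: x + y) = a^* *: conjV x + conjV y.
Proof. exact: ainvol_antilinear. Qed.

Lemma conjV0 : conjV 0 = 0.
Proof. by have := conjVl (-1) 0 0; rewrite rmorphN1 !scaleN1r addNr => ->; rewrite addNr. Qed.

Lemma conjVZ a x : conjV (a *: x) = a^* *: conjV x.
Proof. by rewrite -[a *: x]addr0 conjVl conjV0 addr0. Qed.

Lemma conjVD x y : conjV (x + y) = conjV x + conjV y.
Proof. by rewrite -[x in LHS]scale1r conjVl rmorph1 scale1r. Qed.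

Lemma conjf_scalar f : scalar f -> scalar (conjf f).
Proof.
move=> fs a x y; rewrite /conjf conjVl fs rmorphD; congr (_ + _).
by rewrite (rmorphM (Num.conj_op : {rmorphism C -> C})) /= conjCK.
Qed.

Lemma seminorm_conjV p : seminorm p -> seminorm (p \o conjV).
Proof.
move=> ps; split=> [x|a x|x y] /=; first exact: seminorm_ge0.
- by rewrite conjVZ (seminormZ ps) norm_conjC.
- by rewrite conjVD seminormD.
Qed.

Lemma seminorm_conj_hull p : seminorm p -> continuous p ->
  exists q : V -> C, [/\ seminorm q, continuous q, forall x, p x <= q x &
    forall x, p (conjV x) <= q x].
Proof.
move=> ps pc; exists (fun x => p x + (p \o conjV) x).
have ps' := seminorm_conjV ps; split.
- exact: seminorm_add.
- move=> x; apply: cvgD; first exact: pc.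
  by apply: continuous_comp; [exact: conjV_continuous|exact: pc].
- by move=> x; rewrite lerDl (seminorm_ge0 ps').
- by move=> x; rewrite lerDr seminorm_ge0.
Qed.

Variable Lambda : V -> V -> C.
Hypothesis Lambda_bilinear : bilinear_form Lambda.
Hypothesis Lambda_continuous : continuous (fun p : V * V => Lambda p.1 p.2).
Hypothesis Lambda_hermitian : hermitian_form conjV Lambda.

(** On (conj x, x) the n-th term of b is mu_n (|f_n(conj x)|^2 + |f_n(x)|^2), so S
    times the sum dominates both p(x)^2 and p(conj x)^2, and thus
    |Lambda(conj x, x)|, which is real because Lambda is Hermitian. Each term is
    symmetric and real by the symmetrisation in f_n and conjf f_n. The expansion
    is part of the conclusion because continuity of the Gaussian functionals
    depends on it. *)
Lemma covariance_exists :
  exists (b : V -> V -> C) (c : nat -> C) (f : nat -> V -> C) (q : V -> C) (cc : C),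
  [/\ (forall x y, b x y = b y x) /\ (forall x, scalar (b x)),
      (forall x y, b (conjV x) (conjV y) = (b x y)^*) /\
      psd (fun v w => Lambda (conjV v) w + b (conjV v) w),
      (forall n, 0 <= c n) /\ (forall n, \sum_(i < n) c i <= cc),
      [/\ seminorm q, continuous q, (forall n, scalar (f n)),
          (forall n x, `|f n x| <= q x) & (forall n x, `|conjf (f n) x| <= q x)] &
      (forall x y, \sum_(i < n) c i * (f i x * conjf (f i) y + conjf (f i) x * f i y)
         @[n --> \oo] --> b x y)].
Proof.
have [p [ps pc pL]] := bilinear_seminorm Lambda_bilinear Lambda_continuous.
have [mu [f [q0 [S [[q0s q0c] [fs fq0] [mu0 muS] pT]]]]] := nuclear_expansion V_nuclear ps pc.
have [q [qs qc q0q q0q']] := seminorm_conj_hull q0s q0c.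
have S0 : 0 <= S by have := muS 0%N; rewrite big_ord0.
have fq n x : `|f n x| <= q x by apply: le_trans (fq0 n x) _.
have gq n x : `|conjf (f n) x| <= q x.
  by rewrite norm_conjC; apply: le_trans (fq0 n _) _.
pose F i x y := f i x * conjf (f i) y + conjf (f i) x * f i y.
have : forall z : V * V, exists l : C,
    \sum_(i < n) mu i * F i z.1 z.2 @[n --> \oo] --> l.
  move=> z; pose T := q z.1 * q z.2 + q z.1 * q z.2.
  have T0 : 0 <= T by rewrite addr_ge0// mulr_ge0 ?seminorm_ge0.
  apply: (@abs_summable_cvg R (fun i => mu i * F i z.1 z.2) (fun i => mu i * T) (S * T)).
    move=> n; rewrite normrM (ger0_norm (mu0 n)) ler_wpM2l//.
    by apply: le_trans (ler_normD _ _) _; rewrite !normrM; apply: lerD; apply: ler_pM.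
  by move=> n; rewrite -mulr_suml ler_wpM2r.
move=> /choice[k kP].
have Fs i x : scalar (F i x).
  move=> a y z; rewrite /F fs (conjf_scalar (fs i)); ring.
have FC i x y : F i x y = F i y x by rewrite /F; ring.
have Fr i x y : F i (conjV x) (conjV y) = (F i x y)^*.
  rewrite /F /conjf !conjVK rmorphD !(rmorphM (Num.conj_op : {rmorphism C -> C})) /= !conjCK.
  by rewrite addrC mulrC [X in _ + X]mulrC.
have Fd i x : F i (conjV x) x = `|f i (conjV x)| ^+ 2 + `|f i x| ^+ 2.
  by rewrite /F /conjf conjVK !normCK [in RHS](mulrC (f i x)).
have kuniq x y (G : nat -> C) l : (forall n, \sum_(i < n) mu i * F i x y = G n) ->
    G n @[n --> \oo] --> l -> k (x, y) = l.
  move=> FG Gl; have := kP (x, y); rewrite /=.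
  have -> : (fun n => \sum_(i < n) mu i * F i x y) = G by apply/funext.
  by move=> kG; exact: (cvg_unique (@norm_hausdorff C C) kG Gl).
have kC x y : k (x, y) = k (y, x).
  apply: kuniq (kP (y, x)) => n; apply: eq_bigr => i _; by rewrite FC.
have ks x : scalar (fun y => k (x, y)).
  move=> a y z; apply: (kuniq _ _ (fun n => a * (\sum_(i < n) mu i * F i x y) +
      \sum_(i < n) mu i * F i x z)).
    move=> n; rewrite mulr_sumr -big_split /=; apply: eq_bigr => i _.
    rewrite Fs; ring.
  by apply: cvgD; [apply: cvgMl_tmp; exact: (kP (x, y))|exact: (kP (x, z))].
have kr x y : k (conjV x, conjV y) = (k (x, y))^*.
  apply: (kuniq _ _ (fun n => (\sum_(i < n) mu i * F i x y)^*)).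
    move=> n; rewrite rmorph_sum; apply: eq_bigr => i _.
    by rewrite (rmorphM (Num.conj_op : {rmorphism C -> C})) /= (geC0_conj (mu0 i)) Fr.
  by apply: conj_cvg; exact: (kP (x, y)).
have kT x n : \sum_(i < n) mu i * (`|f i (conjV x)| ^+ 2 + `|f i x| ^+ 2) <= k (conjV x, x).
  apply: (@partial_sum_le _ (fun i => mu i * (`|f i (conjV x)| ^+ 2 + `|f i x| ^+ 2))).
    by move=> i; rewrite mulr_ge0// addr_ge0// exprn_ge0.
  have -> : (fun n => \sum_(i < n) mu i * (`|f i (conjV x)| ^+ 2 + `|f i x| ^+ 2)) =
      (fun n => \sum_(i < n) mu i * F i (conjV x) x).
    by apply/funext => m; apply: eq_bigr => i _; rewrite Fd.
  exact: (kP (conjV x, x)).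
have k0 x : 0 <= k (conjV x, x) by have := kT x 0%N; rewrite big_ord0.
exists (fun x y => S * k (x, y)), (fun i => S * mu i), f, q, (S * S); split.
- split=> [x y|x a y z]; first by rewrite kC.
  by rewrite ks mulrDr; congr (_ + _); exact: mulrCA.
- split=> [x y|].
    by rewrite kr (rmorphM (Num.conj_op : {rmorphism C -> C})) /= (geC0_conj S0).
  have Hh x y : Lambda (conjV x) y + S * k (conjV x, y) =
      (Lambda (conjV y) x + S * k (conjV y, x))^*.
    rewrite rmorphD (rmorphM (Num.conj_op : {rmorphism C -> C})) /= (geC0_conj S0).
    rewrite Lambda_hermitian conjVK -kr conjVK kC //.
  apply: psd_form => [x a y z|//|x].
    by rewrite Lambda_bilinear.1 ks; ring.
  have bx : `|Lambda (conjV x) x| <= S * k (conjV x, x).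
    apply: le_trans (pL _ _) _.
    have px : p x ^+ 2 <= S * k (conjV x, x).
      apply: pT => n; apply: le_trans (kT x n); apply: ler_sum => i _.
      by rewrite ler_wpM2l// lerDr exprn_ge0.
    have px' : p (conjV x) ^+ 2 <= S * k (conjV x, x).
      apply: pT => n; apply: le_trans (kT x n); apply: ler_sum => i _.
      by rewrite ler_wpM2l// lerDl exprn_ge0.
    rewrite -(@ler_pXn2r _ 2) ?nnegrE ?(mulr_ge0 S0 (k0 x)) ?mulr_ge0 ?(seminorm_ge0 ps)//.
    by rewrite exprMn [leRHS]expr2 ler_pM// exprn_ge0 ?(seminorm_ge0 ps).
  have Lr : Lambda (conjV x) x \is Num.real.
    by apply/CrealP; rewrite {2}Lambda_hermitian conjVK.
  by move: bx; rewrite (real_ler_norml _ Lr) => /andP[+ _]; rewrite lerNl -subr_ge0 opprK addrC.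
- split=> [n|n]; first by rewrite mulr_ge0.
  by rewrite -mulr_sumr ler_wpM2l.
- by split.
move=> x y.
have -> : (fun n => \sum_(i < n) S * mu i * (f i x * conjf (f i) y + conjf (f i) x * f i y)) =
    (fun n => S * \sum_(i < n) mu i * F i x y).
  by apply/funext => n; rewrite mulr_sumr; apply: eq_bigr => i _; rewrite mulrA.
by apply: cvgMl_tmp; exact: (kP (x, y)).
Qed.

End Covariance.

(** * Continuous Gaussian functionals *)
Section TalgTopology.
Context {C : numClosedFieldType} {V : tvsType C}.

Lemma nbhs_talg_ball h (Z : talg V) (e : C) : positive_hermitian_forms V h -> 0 < e ->
  nbhs Z [set Y | talg_norm h (Y - Z) < e].
Proof.
move=> hP e0; apply: open_nbhs_nbhs; split; last first.
  rewrite /= subrr /talg_norm; case: hP => hs hh _ _.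
  by rewrite (talg_form0 hs hh) sqrtC0.
exists [set [set Y | talg_norm h (Y - Z) < e]]; last by rewrite bigcup_set1.
move=> _ ->.
apply: (@finI_from1 _ _ _ (fun i : (V -> V -> C) * talg V * C =>
  [set Y | talg_norm i.1.1 (Y - i.1.2) < i.2]) (h, Z, e)).
by split.
Qed.

Lemma talg_continuous_linear (g : talg V -> C) h (M : C) : scalar g ->
  positive_hermitian_forms V h -> 0 < M ->
  (forall X, `|g X| <= M * talg_norm h X) -> continuous g.
Proof.
move=> gl hP M0 gM Z; apply/(cvgrPdist_lt (FF := nbhs_filter Z)) => e e0.
have YZ : \forall Y \near Z, talg_norm h (Y - Z) < e / M.
  by apply: nbhs_talg_ball => //; exact: divr_gt0.
apply: filterS YZ => Y YZ.
rewrite distrC -(scalarB Y Z gl); apply: le_lt_trans (gM _) _.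
by rewrite mulrC -ltr_pdivlMr.
Qed.

Lemma positive_hermitian_formsD h h' : positive_hermitian_forms V h ->
  positive_hermitian_forms V h' -> positive_hermitian_forms V (fun x y => h x y + h' x y).
Proof.
move=> [hs hh hp hc] [hs' hh' hp' hc']; split.
- by move=> x a y z; rewrite hs hs'; ring.
- by move=> x y; rewrite hh hh' -rmorphD.
- by move=> x; rewrite addr_ge0.
- by move=> z; apply: cvgD; [exact: hc|exact: hc'].
Qed.

Lemma positive_hermitian_formsZ a h : 0 <= a -> positive_hermitian_forms V h ->
  positive_hermitian_forms V (fun x y => a * h x y).
Proof.
move=> a0 [hs hh hp hc]; split.
- by move=> x b y z; rewrite hs; ring.
- by move=> x y; rewrite (rmorphM (Num.conj_op : {rmorphism C -> C})) /= (geC0_conj a0) -hh.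
- by move=> x; rewrite mulr_ge0.
- by move=> z; apply: cvgMl_tmp; exact: hc.
Qed.

Lemma positive_hermitian_forms_psd h : positive_hermitian_forms V h -> psd h.
Proof. by case=> hs hh hp _; exact: psd_form. Qed.

End TalgTopology.

Section RealFunctionals.
Context {R : realType}.
Local Notation C := (complexField R).
Context {V : tvsType C} (conjV : antilinear_involution V).
Hypothesis conjV_continuous : continuous conjV.

Definition real_functional (rho : V -> C) : Prop :=
  [/\ scalar rho, continuous rho & forall x, rho (conjV x) = (rho x)^*].

Lemma real_functional0 : real_functional (fun=> 0).
Proof.
split=> [a x y||x]; first by rewrite mulr0 addr0.
- by move=> x; exact: cvg_cst.
- by rewrite conjC0.
Qed.

Lemma real_functional_comb rho sigma (n : nat) : real_functional rho ->
  real_functional sigma -> real_functional (fun x => rho x + n%:R * sigma x).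
Proof.
move=> [rs rc rr] [ss sc sr]; split=> [a x y|x|x].
- by rewrite rs ss; ring.
- by apply: cvgD; [exact: rc|apply: cvgMl_tmp; exact: sc].
- rewrite rr sr rmorphD (rmorphM (Num.conj_op : {rmorphism C -> C})) /=.
  by rewrite conjC_nat.
Qed.

Lemma conjf_continuous (f : V -> C) : continuous f -> continuous (conjf conjV f).
Proof.
move=> fc x; apply: conj_cvg; apply: continuous_comp; [exact: conjV_continuous|exact: fc].
Qed.

(** Real and imaginary parts f + conjf f and i f - i conjf f are real, so a vector
    v killed by the real functionals is killed by all continuous f, in particular
    by those of the nuclear expansion of any continuous p; so p v = 0. *)
Lemma real_functional_sep v : nuclear V -> hausdorff_space V ->
  (forall rho, real_functional rho -> rho v = 0) -> v = 0.
Proof.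
move=> V_nuclear V_hausdorff H; apply: contrapT => v0.
have [U [Un Uv]] : exists U, nbhs (0 : V) U /\ ~ U v.
  apply: contrapT => HU; apply: v0; apply: V_hausdorff => A B Av B0.
  exists v; split; first exact: nbhs_singleton.
  by apply: contrapT => Bv; apply: HU; exists B.
have [p [ps pc pU]] := nbhs0_seminorm Un.
have [mu [f [q [S [[qs qc] [fs fq] _ pT]]]]] := nuclear_expansion V_nuclear ps pc.
have fv n : f n v = 0.
  have fc : continuous (f n) := continuous_linear_le (fs n) qs qc (fq n).
  have gs := conjf_scalar conjV (fs n); have gc := conjf_continuous fc.
  have Hre : f n v + conjf conjV (f n) v = 0.
    apply: (H (fun x => f n x + conjf conjV (f n) x)); split.
    - by move=> a x y; rewrite fs gs; ring.
    - by move=> x; apply: cvgD; [exact: fc|exact: gc].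
    - by move=> x; rewrite /conjf (conjVK conjV) rmorphD /= conjCK addrC.
  have Him : 'i * f n v - 'i * conjf conjV (f n) v = 0.
    apply: (H (fun x => 'i * f n x - 'i * conjf conjV (f n) x)); split.
    - by move=> a x y; rewrite fs gs; ring.
    - by move=> x; apply: cvgB; apply: cvgMl_tmp; [exact: fc|exact: gc].
    - move=> x; rewrite /conjf (conjVK conjV) rmorphB.
      rewrite !(rmorphM (Num.conj_op : {rmorphism C -> C})) /= conjCK conjCi.
      ring.
  have : 2 * 'i * f n v = 0.
    transitivity ('i * (f n v + conjf conjV (f n) v) +
      ('i * f n v - 'i * conjf conjV (f n) v)); first by ring.
    by rewrite Hre Him mulr0 addr0.
  by move=> /eqP; rewrite !mulf_eq0 pnatr_eq0 (negbTE (neq0Ci C)) => /eqP.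
have : p v ^+ 2 <= S * 0.
  by apply: pT => n; rewrite big1// => i _; rewrite fv normr0 expr0n mulr0.
rewrite mulr0 => pv; apply: Uv; apply: pU.
suff -> : p v = 0 by exact: ltr01.
by apply/eqP; rewrite -sqrf_eq0 eq_le pv exprn_ge0 ?(seminorm_ge0 ps).
Qed.

End RealFunctionals.

Section GaussianContinuity.
Context {R : realType}.
Local Notation C := (complexField R).
Context {V : tvsType C}.
Hypothesis V_nuclear : nuclear V.
Variables (b : V -> V -> C) (c : nat -> C) (f g : nat -> V -> C) (q : V -> C) (cc : C).
Hypothesis bC : forall x y, b x y = b y x.
Hypothesis bl : forall x, scalar (b x).
Hypothesis c_ge0 : forall n, 0 <= c n.
Hypothesis c_sum : forall n, \sum_(i < n) c i <= cc.
Hypothesis qs : seminorm q.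
Hypothesis qc : continuous q.
Hypothesis fs : forall n, scalar (f n).
Hypothesis gs : forall n, scalar (g n).
Hypothesis fq : forall n x, `|f n x| <= q x.
Hypothesis gq : forall n x, `|g n x| <= q x.
Hypothesis bE : forall x y,
  \sum_(i < n) c i * (f i x * g i y + g i x * f i y) @[n --> \oo] --> b x y.

(** One Hilbert seminorm h dominates the forms f_n and g_n, another dominates rho;
    their sum provides the norm of gaussian_bound. *)
Lemma gaussian_continuous (rho : V -> C) : scalar rho -> continuous rho ->
  continuous (gaussian rho b : talg V -> C).
Proof.
move=> rs rc.
have [h0 h0P qh0] := hilbert_domination V_nuclear qs qc.
have rns := seminorm_norm_scalar rs.
have rnc : continuous (fun x => `|rho x|) by move=> x; apply: cvg_norm; exact: rc.
have [h1 h1P rh1] := hilbert_domination V_nuclear rns rnc.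
pose h x y := h0 x y + h1 x y.
have hP : positive_hermitian_forms V h := positive_hermitian_formsD h0P h1P.
have h_psd := positive_hermitian_forms_psd hP.
have [hs hh _ _] := hP.
have h0p x : 0 <= h0 x x by case: h0P.
have h1p x : 0 <= h1 x x by case: h1P.
have dq (k : V -> C) : scalar k -> (forall x, `|k x| <= q x) -> dominated h k.
  move=> kl kq; apply: dominated_scalar => // x.
  apply: (@le_trans _ _ (q x ^+ 2)).
    by rewrite ler_pXn2r ?nnegrE ?normr_ge0 ?(seminorm_ge0 qs).
  by apply: le_trans (qh0 x) _; rewrite lerDl.
have rd : dominated h rho.
  by apply: dominated_scalar => // x; apply: le_trans (rh1 x) _; rewrite lerDr.
have fd n : dominated h (f n) by exact: dq.
have gd n : dominated h (g n) by exact: dq.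
have cc0 : 0 <= cc by have := c_sum 0; rewrite big_ord0.
pose A := 4 * (1 + cc).
have A0 : 0 <= A by rewrite mulr_ge0// addr_ge0.
have bound := gaussian_bound h_psd hs bC rs bl A0
  (fun k => (bounded_on_gauss h_psd rd fd gd c_ge0 c_sum bE k).1)
  (fun k => (gbound_ge0 c_sum k).1) (fun k => (gbound_sqr c_sum k).1).
have gl : scalar (gaussian rho b : talg V -> C) := gaussian_linear bC rs bl.
have hP2 := positive_hermitian_formsZ (mulr_ge0 (ler0n C 2) A0) hP.
exact: (talg_continuous_linear gl hP2 (ltr0n C 2) bound).
Qed.

End GaussianContinuity.

Theorem theorem4p7 (R : realType) (V : tvsType (complexField R))
    (conjV : antilinear_involution V) (Lambda : V -> V -> complexField R)
    (V_hausdorff : hausdorff_space V) (V_nuclear : nuclear V)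
    (conjV_continuous : continuous conjV)
    (Lambda_bilinear : bilinear_form Lambda)
    (Lambda_continuous : continuous (fun p : V * V => Lambda p.1 p.2))
    (Lambda_hermitian : hermitian_form conjV Lambda) :
  \bigcap_(omega in [set omega : {scalar salg V} |
      continuous omega /\ positive_functional conjV Lambda omega])
    [set X : salg V | omega X = 0] = [set 0].
Proof.
apply/seteqP; split=> [X XK|_ -> omega _]; last exact: linear0.
have [b [c [f [q [cc [[bC bl] [br Hpsd] [c0 csum] [qs qc fs fq gq] bE]]]]]] :=
  covariance_exists V_nuclear conjV_continuous Lambda_bilinear Lambda_continuous Lambda_hermitian.
apply: val_inj; apply: (@gaussian_separates _ _ (real_functional conjV) _ _ b bC bl).
- by move=> rho [].
- by move=> v; apply: (real_functional_sep conjV_continuous).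
- by exists (fun=> 0); exact: real_functional0.
- by move=> rho sigma n; exact: real_functional_comb.
- exact: salg_valP.
move=> rho [rs rc rr].
have om_lin : linear_for *%R (fun Y : salg V => gaussian rho b (salg_val Y) : complexField R).
  by move=> a Y Z; exact: (gaussian_linear bC rs bl).
pose omega : {scalar salg V} := HB.pack (fun Y : salg V => gaussian rho b (salg_val Y) : complexField R)
  (GRing.isLinear.Build _ _ _ _ _ om_lin).
apply: (XK omega); split.
- have gc := gaussian_continuous V_nuclear bC bl c0 csum qs qc fs
    (fun n => conjf_scalar conjV (fs n)) fq gq bE rs rc.
  move=> Y; apply: (@continuous_comp (salg V) (talg V) _ (@salg_val _ V)).
    exact: initial_continuous.
  exact: gc.
move=> Y; apply: (@gaussian_positive _ _ Lambda Lambda_bilinear rho b bC rs bl conjV) => //.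
- exact: ainvol_antilinear.
- exact: salg_valP.
Qed.
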